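(* Let $\Phi,\Psi$ be complementary $N$-functions both satisfying the $\Delta_2^0$-condition, let $\varphi=\{\varphi_k\}_{k=0}^\infty$ and $\psi=\{\psi_k\}_{k=0}^\infty$ be weight sequences in $\mathcal{W}$, and suppose there is a constant $M\in(0,\infty)$ such that $k\le M\varphi_k\psi_k$ for all $k\in\mathbb{Z}_+$. Put $\mathbb{A}:=W\cap F\ell_{\varphi,\psi}^{\Phi,\Psi}$. Let $a\in\mathbb{A}$ satisfy $a(t)\neq 0$ for all $t\in\mathbb{T}$ and $\operatorname{ind} a=0$. Then: (a) there exist functions $a_-,a_+$ with $a=a_-a_+$, $a_-^{\pm1}\in\mathbb{A}\cap H_-^\infty$ and $a_+^{\pm1}\in\mathbb{A}\cap H_+^\infty$; (c) if, with $a_\pm$ as in (a), we put $b:=a_-a_+^{-1}$ and $c:=a_-^{-1}a_+$, then for every $\kappa\in\mathbb{N}$, as $n\to\infty$, \[ D_n[a(t)t^{-\kappa}]=G(a)^{n+1}E(a)\{1+\delta_1(n)\}(-1)^{(n+\kappa)\kappa}G(c)^\kappa\Big\{\det\big(b_{n+1+j-k}\big)_{j,k=0}^{\kappa-1}+\delta_2(n)\Big\} \] and \[ D_n[a(t)t^{\kappa}]=G(a)^{n+1}E(a)\{1+\delta_1(n)\}(-1)^{(n+\kappa)\kappa}G(b)^\kappa\Big\{\det\big(c_{-n-1-j+k}\big)_{j,k=0}^{\kappa-1}+\delta_3(n)\Big\}, \] where $\delta_1(n)=o(1)$, $\delta_2(n)=o(1/\psi_n)$ and $\delta_3(n)=o(1/\varphi_n)$.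 (Here the first matrix has first row $b_{n+1},\dots,b_{n-\kappa+2}$ and last row $b_{n+\kappa},\dots,b_{n+1}$; the second has first row $c_{-n-1},\dots,c_{-n+\kappa-2}$ and last row $c_{-n-\kappa},\dots,c_{-n-1}$.)
   Context: $\mathbb{T}$ is the unit circle. For $f\in L^1(\mathbb{T})$, $f_k=\frac1{2\pi}\int_0^{2\pi}f(e^{i\theta})e^{-ik\theta}d\theta$ are its Fourier coefficients. $D_n(f)=\det(f_{j-k})_{j,k=0}^n$ for $n\in\mathbb{Z}_+$; $D_n[a(t)t^{m}]$ denotes $D_n$ of the function $t\mapsto a(t)t^m$. $G(f)=\exp((\log f)_0)$ and $E(f)=\exp\big(\sum_{k=1}^\infty k(\log f)_k(\log f)_{-k}\big)$, where $\log f$ is a continuous logarithm of $f$. $\operatorname{ind}a$ is the winding number (Cauchy index) of the continuous function $a$. $W$ is the Wiener algebra of functions $a(t)=\sum_k a_kt^k$ with $\sum_k|a_k|<\infty$. $H_\pm^\infty=\{f\in L^\infty(\mathbb{T}): f_{\mp n}=0 \text{ for all } n\in\mathbb{N}\}$. An $N$-function pair: let $p:[0,\infty)\to[0,\infty)$ be right-continuous, non-decreasing, $p(0)=0$, $p(t)>0$ for $t>0$, $p(t)\to\infty$ as $t\to\infty$; let $q(s)=\sup\{t:p(t)\le s\}$; then $\Phi(x)=\int_0^xp$, $\Psi(x)=\int_0^xq$ are complementary $N$-functions. $\Phi$ satisfies the $\Delta_2^0$-condition if $\limsup_{x\to0}\Phi(2x)/\Phi(x)<\infty$. $\mathcal{W}$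 is the set of sequences $\{\nu_k\}_{k\ge0}$ of positive numbers with $\nu_0=1$, $\nu_{k-1}\le\nu_k$ for $k\in\mathbb{N}$, and $\nu_{2k}\le C_\nu\nu_k$ for all $k\in\mathbb{N}$ with some constant $C_\nu$. $F\ell_{\varphi,\psi}^{\Phi,\Psi}$ is the set of $a\in L^1(\mathbb{T})$ with $\sum_{k=1}^\infty\Phi(|a_{-k}|\varphi_k)+\sum_{k=0}^\infty\Psi(|a_k|\psi_k)<\infty$. *)

(* Defs.v *)
From HB Require Import structures.
From mathcomp Require Import all_boot all_order all_algebra.
From mathcomp Require Import all_classical all_reals all_analysis.
From mathcomp Require Import complex.

Set Implicit Arguments.
Unset Strict Implicit.
Unset Printing Implicit Defensive.

Import Order.TTheory GRing.Theory Num.Theory.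
Import numFieldNormedType.Exports.
Local Open Scope ring_scope.
Local Open Scope classical_set_scope.

Section ToeplitzDefs.
Variable R : realType.
Local Notation C := R[i].
Local Notation Re := (@complex.Re R).
Local Notation Im := (@complex.Im R).

Definition cabs (z : C) : R := Num.sqrt (Re z ^+ 2 + Im z ^+ 2).

Definition expi (t : R) : C := Complex (cos t) (sin t).

Definition cexp (z : C) : C := Complex (expR (Re z)) 0 * expi (Im z).

Definition Tcirc : set C := [set z | cabs z = 1].

Definition summable (u : nat -> R) : Prop := cvgn (series u).

Definition csum (u : nat -> C) : C :=
  Complex (limn (series (fun k => Re (u k)))) (limn (series (fun k => Im (u k)))).

Definition intC (h : R -> C) : C :=
  Complex (Rintegral lebesgue_measure `[0, 2 * pi] (fun t => Re (h t)))
          (Rintegral lebesgue_measure `[0, 2 * pi] (fun t => Im (h t))).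

Definition L1T (f : C -> C) : Prop :=
  lebesgue_measure.-integrable `[0, 2 * pi] (EFin \o (fun t => Re (f (expi t)))) /\
  lebesgue_measure.-integrable `[0, 2 * pi] (EFin \o (fun t => Im (f (expi t)))).

Definition LinfT (f : C -> C) : Prop :=
  L1T f /\ exists M : R,
    {ae lebesgue_measure, forall t : R, `[0, 2 * pi] t -> cabs (f (expi t)) <= M}.

Definition fcoefth (h : R -> C) (k : int) : C :=
  Complex (2 * pi)^-1 0 * intC (fun t => h t * expi (- (k%:~R * t))).

Definition fcoef (f : C -> C) (k : int) : C := fcoefth (f \o expi) k.

Definition Dn (n : nat) (f : C -> C) : C :=
  \det (\matrix_(j < n.+1, k < n.+1) fcoef f (j%:Z - k%:Z)).

Definition inW (f : C -> C) : Prop :=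
  exists c : int -> C,
    summable (fun k => cabs (c k%:Z)) /\
    summable (fun k => cabs (c (- (k.+1)%:Z))) /\
    forall t, Tcirc t ->
      f t = csum (fun k => c k%:Z * t ^+ k) + csum (fun k => c (- (k.+1)%:Z) * t ^- k.+1).

Definition Hplus (f : C -> C) : Prop :=
  LinfT f /\ forall n : nat, (0 < n)%N -> fcoef f (- n%:Z) = 0.
Definition Hminus (f : C -> C) : Prop :=
  LinfT f /\ forall n : nat, (0 < n)%N -> fcoef f n%:Z = 0.

Definition windnum (a : C -> C) (w : int) : Prop :=
  exists g : R -> C,
    continuous (fun t => Re (g t)) /\ continuous (fun t => Im (g t)) /\
    (forall t, cexp (g t) = a (expi t)) /\
    Im (g (2 * pi)) - Im (g 0) = 2 * pi * w%:~R.

Definition is_clog (f : C -> C) (g : R -> C) : Prop :=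
  continuous (fun t => Re (g t)) /\ continuous (fun t => Im (g t)) /\
  (forall t, g (t + 2 * pi) = g t) /\
  (forall t, cexp (g t) = f (expi t)).

(** a chosen continuous logarithm (junk value 0 if none exists) *)
Definition clog (f : C -> C) : R -> C :=
  match pselect (exists g, is_clog f g) with
  | left H => proj1_sig (cid H)
  | right _ => fun _ => 0
  end.

Definition Gc (f : C -> C) : C := cexp (fcoefth (clog f) 0).
Definition Ec (f : C -> C) : C :=
  cexp (csum (fun k => (k.+1)%:R * fcoefth (clog f) (k.+1)%:Z
                                  * fcoefth (clog f) (- (k.+1)%:Z))).

Definition Ngen (p : R -> R) : Prop :=
  (forall t, 0 <= t -> 0 <= p t) /\
  (forall t, 0 <= t -> p x @[x --> t^'+] --> p t) /\
  (forall s t, 0 <= s -> s <= t -> p s <= p t) /\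
  p 0 = 0 /\
  (forall t, 0 < t -> 0 < p t) /\
  (p x @[x --> +oo] --> +oo).

Definition qinv (p : R -> R) (s : R) : R := sup [set t | 0 <= t /\ p t <= s].
Definition PhiN (p : R -> R) (x : R) : R := Rintegral lebesgue_measure `[0, x] p.
Definition PsiN (p : R -> R) (x : R) : R := Rintegral lebesgue_measure `[0, x] (qinv p).

Definition Delta2_0 (F : R -> R) : Prop :=
  exists K : R, \forall x \near 0^'+, F (2 * x) / F x <= K.

Definition weight (nu : nat -> R) : Prop :=
  nu 0%N = 1 /\ (forall k, 0 < nu k) /\ (forall k, nu k <= nu k.+1) /\
  exists Cnu : R, forall k, (0 < k)%N -> nu (2 * k)%N <= Cnu * nu k.

Definition inFl (Phi Psi : R -> R) (phi psi : nat -> R) (f : C -> C) : Prop :=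
  L1T f /\
  summable (fun k => Phi (cabs (fcoef f (- (k.+1)%:Z)) * phi k.+1)) /\
  summable (fun k => Psi (cabs (fcoef f k%:Z) * psi k)).

Definition inA (Phi Psi : R -> R) (phi psi : nat -> R) (f : C -> C) : Prop :=
  inW f /\ inFl Phi Psi phi psi f.

Definition WHfact (Phi Psi : R -> R) (phi psi : nat -> R) (a am ap : C -> C) : Prop :=
  (forall t, Tcirc t -> a t = am t * ap t) /\
  inA Phi Psi phi psi am /\ Hminus am /\
  inA Phi Psi phi psi (fun t => (am t)^-1) /\ Hminus (fun t => (am t)^-1) /\
  inA Phi Psi phi psi ap /\ Hplus ap /\
  inA Phi Psi phi psi (fun t => (ap t)^-1) /\ Hplus (fun t => (ap t)^-1).

End ToeplitzDefs.

(* Main.v *)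
(** The determinant of the [b_{n+1+j-k}] is itself [o(1/psi_n)], because [|b_k| psi_k -> 0] and
    [psi] is doubling; so one may take [delta_1 = 0] and the asymptotic formula says no more than
    [D_n[a t^-kappa] = o(|G(a)|^n / psi_n)].  The second formula is the first one for the
    reflected symbol [a(1/t)], with the two weights exchanged.

    For the algebra: a Luxemburg-type modular shows that it is closed under products, and a
    continuous logarithm [g] of [a] belongs to it because [a e^{-q} = 1 + s] is close to [1] for
    a Fejer mean [q] of [g], while [log (1 + s)] is a convergent power series (the powers of [s]
    decay geometrically already in the Wiener norm).  Exponentials of the two halves of [g]
    give the factors [a_-] and [a_+].

    For the determinants: if the Toeplitz matrix [T_N] of [a] maps the polynomial [X] to [e_s],
    then [a_+ X = u + c w] and [a_- X = b u + w] with [u] supported on [k <= s] and [w] on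
    [k > N]; only the tails of [b] and [c] couple [u] and [w], so that for large [N] the
    matrix is invertible and [u], [w] are bounded uniformly in [N].  For [s = 0] the constant term
    of the first equation gives [G(a) X_0 = 1 + eps_N], and [sum_N |eps_N|] is finite by Young's
    inequality and [k <= M phi_k psi_k]; as [det T_N X_0 = det T_{N-1}], the determinants are
    [O(|G(a)|^N)].  By Jacobi's identity [D_n[a t^-kappa]] is, up to sign, [det T_{n+kappa}]
    times a minor formed by the last [kappa] entries of the solutions for [s < kappa], and these
    are of the size of the [b_k] with [k > n - kappa]. *)

Require Import Defs.
From HB Require Import structures.
From mathcomp Require Import all_boot all_order all_algebra.
From mathcomp Require Import all_classical all_reals all_analysis.
From mathcomp Require Import complex.
From mathcomp Require Import finmap fingroup perm ring lra zify.
Set Implicit Arguments.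
Unset Strict Implicit.
Unset Printing Implicit Defensive.
Import Order.TTheory GRing.Theory Num.Theory.
Import numFieldNormedType.Exports.
Local Open Scope ring_scope.
Local Open Scope classical_set_scope.

(** * Complex numbers and Fourier coefficients *)

(** [Gc] and [Ec] are values of the exponential, so one can divide by the prefactors, and only upper
    bounds for moduli of determinants have to be proved. The delicate one is the finiteness of sum_N
    |eps_N|: the solutions change with N, and a bound on the norm of each u separately gives no
    sequence dominating all of them. The pointwise maximum of finitely many |u| obeys the same
    contractive system with the widest tails, so its l^1 norm is bounded independently of how many
    are taken. Interchanging sums then turns the number of admissible N below j into the factor j,
    which k <= M phi_k psi_k absorbs. In the algebra the modular is not homogeneous, and a product
    costs a constant K >= 2. Power series converge nevertheless because the weighted radius of f^n
    is linear in that of f, all geometric growth being carried by the Wiener norm. Finally, G(a) is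
    defined by a logarithm while the factorization in the conclusion is arbitrary; uniqueness up to
    constants links the two. *)

Section ComplexBasics.
Variable R : realType.
Local Notation C := R[i].
Local Notation Re := (@complex.Re R).
Local Notation Im := (@complex.Im R).
Implicit Types (z w : C) (x t : R).

Lemma cabsE z : cabs z = ComplexField.Normc.normc z.
Proof. by case: z. Qed.

Lemma cabs_ge0 z : 0 <= cabs z.
Proof. exact: sqrtr_ge0. Qed.

Lemma cabsM z w : cabs (z * w) = cabs z * cabs w.
Proof. by rewrite !cabsE ComplexField.Normc.normcM. Qed.

Lemma cabsV z : cabs z^-1 = (cabs z)^-1.
Proof. by rewrite !cabsE ComplexField.Normc.normcV. Qed.

Lemma cabs0 : cabs (0 : C) = 0.
Proof. by rewrite cabsE ComplexField.Normc.normc0. Qed.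

Lemma cabs1 : cabs (1 : C) = 1.
Proof. by rewrite cabsE ComplexField.Normc.normc1. Qed.

Lemma cabs_eq0 z : cabs z = 0 -> z = 0.
Proof. by rewrite cabsE => /ComplexField.Normc.eq0_normc. Qed.

Lemma cabs_gt0 z : z != 0 -> 0 < cabs z.
Proof.
move=> z0; rewrite lt_neqAle cabs_ge0 andbT eq_sym.
by apply: contra z0 => /eqP/cabs_eq0/eqP.
Qed.

Lemma cabsN z : cabs (- z) = cabs z.
Proof. by rewrite !cabsE normcN. Qed.

Lemma cabsD z w : cabs (z + w) <= cabs z + cabs w.
Proof. by rewrite !cabsE le_normcD. Qed.

Lemma cabsB z w : cabs (z - w) <= cabs z + cabs w.
Proof. by rewrite (le_trans (cabsD _ _))// cabsN. Qed.

Lemma cabsX z n : cabs (z ^+ n) = cabs z ^+ n.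
Proof. by elim: n => [|n IH]; rewrite ?expr0 ?cabs1// !exprS cabsM IH. Qed.

Lemma cabs_sum (I : Type) (r : seq I) (P : pred I) (F : I -> C) :
  cabs (\sum_(i <- r | P i) F i) <= \sum_(i <- r | P i) cabs (F i).
Proof.
elim/big_rec2: _ => [|i y1 y2 _ h]; first by rewrite cabs0.
by rewrite (le_trans (cabsD _ _))// lerD2l.
Qed.

Lemma cabs_prod (I : Type) (r : seq I) (P : pred I) (F : I -> C) :
  cabs (\prod_(i <- r | P i) F i) = \prod_(i <- r | P i) cabs (F i).
Proof.
elim/big_rec2: _ => [|i y1 y2 _ h]; first by rewrite cabs1.
by rewrite cabsM h.
Qed.

Lemma cReD z w : Re (z + w) = Re z + Re w. Proof. by case: z; case: w. Qed.
Lemma cImD z w : Im (z + w) = Im z + Im w. Proof. by case: z; case: w. Qed.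
Lemma cReN z : Re (- z) = - Re z. Proof. by case: z. Qed.
Lemma cImN z : Im (- z) = - Im z. Proof. by case: z. Qed.
Lemma cReB z w : Re (z - w) = Re z - Re w. Proof. by rewrite cReD cReN. Qed.
Lemma cImB z w : Im (z - w) = Im z - Im w. Proof. by rewrite cImD cImN. Qed.
Lemma cReM z w : Re (z * w) = Re z * Re w - Im z * Im w.
Proof. by case: z; case: w. Qed.
Lemma cImM z w : Im (z * w) = Re z * Im w + Im z * Re w.
Proof. by case: z => a b; case: w. Qed.

Lemma cRe_sum (I : Type) (r : seq I) (P : pred I) (F : I -> C) :
  Re (\sum_(i <- r | P i) F i) = \sum_(i <- r | P i) Re (F i).
Proof. exact: (big_morph _ cReD (erefl _)). Qed.
Lemma cIm_sum (I : Type) (r : seq I) (P : pred I) (F : I -> C) :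
  Im (\sum_(i <- r | P i) F i) = \sum_(i <- r | P i) Im (F i).
Proof. exact: (big_morph _ cImD (erefl _)). Qed.

Lemma complex_eq z w : Re z = Re w -> Im z = Im w -> z = w.
Proof. by case: z => a b; case: w => c d /= -> ->. Qed.

Definition rc (x : R) : C := Complex x 0.

Lemma rcD x t : rc (x + t) = rc x + rc t.
Proof. by apply: complex_eq => /=; rewrite ?addr0. Qed.
Lemma rcN x : rc (- x) = - rc x.
Proof. by apply: complex_eq => /=; rewrite ?oppr0. Qed.
Lemma rcM x t : rc (x * t) = rc x * rc t.
Proof. by apply: complex_eq => /=; ring. Qed.
Lemma rc1 : rc 1 = 1. Proof. by []. Qed.
Lemma rc0 : rc 0 = 0. Proof. by []. Qed.
Lemma rc_nat n : rc n%:R = n%:R.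
Proof. by elim: n => [|n IH]; rewrite // -!natr1 rcD IH. Qed.
Lemma rcX x n : rc (x ^+ n) = rc x ^+ n.
Proof. by elim: n => [|n IH]; rewrite ?expr0// !exprS rcM IH. Qed.

Lemma cabs_rc x : cabs (rc x) = `|x|.
Proof. by rewrite /cabs /= expr0n addr0 sqrtr_sqr. Qed.
Lemma cabs_nat n : cabs (n%:R : C) = n%:R.
Proof. by rewrite -rc_nat cabs_rc ger0_norm. Qed.

Lemma complexRI z : z = rc (Re z) + 'i%C * rc (Im z).
Proof. by apply: complex_eq; rewrite /= ?cReM ?cImM /=; ring. Qed.

Lemma Re_le_cabs z : `|Re z| <= cabs z.
Proof. by rewrite -sqrtr_sqr ler_wsqrtr// lerDl sqr_ge0. Qed.
Lemma Im_le_cabs z : `|Im z| <= cabs z.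
Proof. by rewrite -sqrtr_sqr ler_wsqrtr// lerDr sqr_ge0. Qed.

Lemma cabsi : cabs ('i%C : C) = 1.
Proof. by rewrite /cabs /= expr0n add0r expr1n sqrtr1. Qed.

Lemma cabs_le_ReIm z : cabs z <= `|Re z| + `|Im z|.
Proof.
rewrite [z in leLHS]complexRI (le_trans (cabsD _ _))// cabsM cabsi mul1r.
by rewrite !cabs_rc.
Qed.

Lemma sqr_cabs z : cabs z ^+ 2 = Re z ^+ 2 + Im z ^+ 2.
Proof. by rewrite sqr_sqrtr// addr_ge0 ?sqr_ge0. Qed.

Lemma expiD x t : expi (x + t) = expi x * expi t.
Proof.
by apply: complex_eq; rewrite ?cReM ?cImM /= ?cosD ?sinD; ring.
Qed.
Lemma expi0 : expi 0 = 1 :> C.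
Proof. by rewrite /expi cos0 sin0. Qed.
Lemma expi2pi : expi (2 * pi) = 1 :> C.
Proof. by rewrite /expi mulrC mulr_natr cos2pi sin2pi. Qed.
Lemma cabs_expi x : cabs (expi x) = 1.
Proof. by rewrite /cabs /= cos2Dsin2 sqrtr1. Qed.
Lemma expi_neq0 x : expi x != 0.
Proof.
by apply/eqP => h; move: (cabs_expi x); rewrite h cabs0 => /eqP; rewrite eq_sym oner_eq0.
Qed.
Lemma expiN x : expi (- x) = (expi x)^-1.
Proof.
by apply: (mulfI (expi_neq0 x)); rewrite -expiD subrr expi0 divff ?expi_neq0.
Qed.
Lemma expiX x n : expi (n%:R * x) = expi x ^+ n.
Proof.
by elim: n => [|n IH]; rewrite ?mul0r ?expi0 ?expr0// -natr1 mulrDl mul1r expiD IH exprSr.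
Qed.
Lemma expi_periodic x : expi (x + 2 * pi) = expi x.
Proof. by rewrite expiD expi2pi mulr1. Qed.
Lemma expi_int2pi (k : int) : expi (k%:~R * (2 * pi)) = 1 :> C.
Proof.
case: k => n; first by rewrite -pmulrn expiX expi2pi expr1n.
by rewrite NegzE mulrNz mulNr expiN -pmulrn expiX expi2pi expr1n invr1.
Qed.

Lemma cexpD z w : cexp (z + w) = cexp z * cexp w.
Proof.
rewrite /cexp cReD cImD expRD expiD -!/(rc _) rcM; ring.
Qed.
Lemma cexp0 : cexp (0 : C) = 1.
Proof. by rewrite /cexp /= expR0 expi0 mulr1. Qed.
Lemma cabs_cexp z : cabs (cexp z) = expR (Re z).
Proof. by rewrite /cexp cabsM -/(rc _) cabs_rc cabs_expi mulr1 ger0_norm// expR_ge0. Qed.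
Lemma cexp_neq0 z : cexp z != 0.
Proof.
apply/eqP => h; have := cabs_cexp z; rewrite h cabs0 => /esym/eqP.
by rewrite gt_eqF ?expR_gt0.
Qed.
Lemma cexpN z : cexp (- z) = (cexp z)^-1.
Proof. by apply: (mulfI (cexp_neq0 z)); rewrite -cexpD subrr cexp0 divff ?cexp_neq0. Qed.

Lemma cos_eq1_small x : `|x| <= 1 -> cos x = 1 -> x = 0.
Proof.
move=> x1 cx; have pi1 : 1 <= pi :> R by have := pi_ge2 R; lra.
apply/eqP; rewrite -normr_eq0; apply/eqP.
apply: (@cos_inj R); rewrite ?in_itv /= ?normr_ge0 ?lexx ?(le_trans x1)// ?(le_trans ler01)//.
by rewrite cos0 -cx; case: (ger0P x) => // _; rewrite cosN.
Qed.

Lemma cexp_eq1 z : cexp z = 1 -> Re z = 0 /\ cos (Im z) = 1.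
Proof.
move=> h; have r0 : Re z = 0.
  have := cabs_cexp z; rewrite h cabs1 => /esym e1.
  by apply: expR_inj; rewrite e1 expR0.
by split => //; move: h; rewrite /cexp r0 expR0 -/(rc _) rc1 mul1r => -[].
Qed.

(** The periods of the exponential are 2 pi apart, so imaginary parts within 1 leave no ambiguity.
    Two logarithms of one function are identified this way later on. *)
Lemma cexp_inj_small z w : `|Im z - Im w| <= 1 -> cexp z = cexp w -> z = w.
Proof.
move=> s e; have : cexp (z - w) = 1 by rewrite cexpD cexpN e divff ?cexp_neq0.
move=> /cexp_eq1; rewrite cReB cImB => -[r c].
have := cos_eq1_small s c => i0.
by apply: complex_eq; apply/eqP; rewrite -subr_eq0; apply/eqP.
Qed.

End ComplexBasics.

(** * Integrals and Fourier coefficients of continuous functions *)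

Section FourierCoefficients.
Variable R : realType.
Local Notation C := R[i].
Local Notation Re := (@complex.Re R).
Local Notation Im := (@complex.Im R).
Local Notation mu := (@lebesgue_measure R).
Local Notation I2pi := (`[0, 2 * pi]%classic : set R).
Implicit Types (f g h : R -> C) (z : C).

Definition contC h := continuous (Re \o h) /\ continuous (Im \o h).

Lemma contC_cst z : contC (fun=> z).
Proof. by split; apply: cst_continuous. Qed.

Lemma contCD f g : contC f -> contC g -> contC (fun t => f t + g t).
Proof.
move=> [f1 f2] [g1 g2]; split => x.
- rewrite (_ : Re \o _ = (fun t => (Re \o f) t + (Re \o g) t)).
    by apply: continuousD; [exact: f1|exact: g1].
  by apply/funext => t /=; rewrite cReD.
- rewrite (_ : Im \o _ = (fun t => (Im \o f) t + (Im \o g) t)).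
    by apply: continuousD; [exact: f2|exact: g2].
  by apply/funext => t /=; rewrite cImD.
Qed.

Lemma contCM f g : contC f -> contC g -> contC (fun t => f t * g t).
Proof.
move=> [f1 f2] [g1 g2]; split => x.
- rewrite (_ : Re \o _ = (fun t => (Re \o f) t * (Re \o g) t - (Im \o f) t * (Im \o g) t)).
    apply: cvgB; apply: cvgM; [exact: f1|exact: g1|exact: f2|exact: g2].
  by apply/funext => t /=; rewrite cReM.
- rewrite (_ : Im \o _ = (fun t => (Re \o f) t * (Im \o g) t + (Im \o f) t * (Re \o g) t)).
    apply: cvgD; apply: cvgM; [exact: f1|exact: g2|exact: f2|exact: g1].
  by apply/funext => t /=; rewrite cImM.
Qed.

Lemma contCN f : contC f -> contC (fun t => - f t).
Proof.
move=> cf; rewrite (_ : (fun t => - f t) = (fun t => (-1) * f t)); last first.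
  by apply/funext => t; rewrite mulN1r.
exact: contCM (contC_cst _) cf.
Qed.

Lemma contCB f g : contC f -> contC g -> contC (fun t => f t - g t).
Proof. by move=> cf cg; apply: contCD => //; apply: contCN. Qed.

Lemma contC_sum (I : Type) (r : seq I) (P : pred I) (F : I -> R -> C) :
  (forall i, contC (F i)) -> contC (fun t => \sum_(i <- r | P i) F i t).
Proof.
move=> cF; elim: r => [|i r IH].
  rewrite (_ : (fun _ => _) = fun=> 0); first exact: contC_cst.
  by apply/funext => t; rewrite big_nil.
rewrite (_ : (fun _ => _) = fun t => (if P i then F i t else 0) + \sum_(i <- r | P i) F i t).
  apply: contCD => //; case: (P i) => //; exact: contC_cst.
by apply/funext => t; rewrite big_cons; case: ifP; rewrite ?add0r.
Qed.

Lemma contCX f n : contC f -> contC (fun t => f t ^+ n).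
Proof.
move=> cf; elim: n => [|n IH].
  by rewrite (_ : (fun _ => _) = fun=> 1); [exact: contC_cst|apply/funext => t].
rewrite (_ : (fun _ => _) = fun t => f t * f t ^+ n); first exact: contCM.
by apply/funext => t; rewrite exprS.
Qed.

Lemma contC_expiM (r : R) : contC (fun t => expi (r * t)).
Proof.
split => x /=; apply: continuous_comp.
- by apply: continuousM; [exact: cst_continuous|].
- exact: continuous_cos.
- by apply: continuousM; [exact: cst_continuous|].
- exact: continuous_sin.
Qed.

Lemma contC_expi : contC (@expi R).
Proof.
have := contC_expiM 1; rewrite (_ : (fun t => _) = @expi R)//.
by apply/funext => t; rewrite mul1r.
Qed.

Lemma pi2_gt0 : 0 < 2 * pi :> R.
Proof. by rewrite mulr_gt0// pi_gt0. Qed.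

Lemma integrable_2pi (h : R -> R) : continuous h -> mu.-integrable I2pi (EFin \o h).
Proof.
move=> ch; apply: continuous_compact_integrable; first exact: segment_compact.
by apply: continuous_subspaceT.
Qed.

Lemma mu_2pi : fine (mu I2pi) = 2 * pi.
Proof. by rewrite lebesgue_measure_itv /= lte_fin pi2_gt0 /= subr0. Qed.

Lemma Rint_bound (h : R -> R) B : continuous h -> (forall x, `|h x| <= B) ->
  `|Rintegral mu I2pi h| <= 2 * pi * B.
Proof.
move=> ch hB; apply: (le_trans (le_normr_Rintegral _ (integrable_2pi ch))) => //.
have -> : 2 * pi * B = Rintegral mu I2pi (fun=> B).
  by rewrite Rintegral_cst// mu_2pi mulrC.
apply: le_Rintegral => //.
- by apply: (@integrable_2pi (fun x => `|h x|)) => x; apply: continuous_comp; [exact: ch|exact: norm_continuous].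
- by apply: (@integrable_2pi (fun=> B)) => x; exact: cst_continuous.
Qed.

Lemma intCD f g : contC f -> contC g ->
  intC (fun t => f t + g t) = intC f + intC g.
Proof.
move=> [f1 f2] [g1 g2]; apply: complex_eq; rewrite ?cReD ?cImD /=.
- under eq_Rintegral do rewrite cReD.
  by rewrite RintegralD//; exact: integrable_2pi.
- under eq_Rintegral do rewrite cImD.
  by rewrite RintegralD//; exact: integrable_2pi.
Qed.

Lemma continuousZ (r : R) (f : R -> R) : continuous f -> continuous (fun t => r * f t).
Proof. by move=> cf x; apply: continuousM; [exact: cst_continuous|exact: cf]. Qed.

Lemma intCZ z f : contC f -> intC (fun t => z * f t) = z * intC f.
Proof.
move=> [f1 f2]; apply: complex_eq; rewrite ?cReM ?cImM /=.
- under eq_Rintegral do rewrite cReM.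
  by rewrite RintegralB ?RintegralZl//; apply: integrable_2pi => //; apply: continuousZ.
- under eq_Rintegral do rewrite cImM.
  by rewrite RintegralD ?RintegralZl//; apply: integrable_2pi => //; apply: continuousZ.
Qed.

(** The leading 2 comes from estimating real and imaginary parts separately; the same factor appears
    in [fcoef_bound] and [fcoef0_dom]. *)
Lemma intC_bound f B : contC f -> (forall x, cabs (f x) <= B) ->
  cabs (intC f) <= 2 * (2 * pi * B).
Proof.
move=> [f1 f2] fB; rewrite (le_trans (cabs_le_ReIm _))//=.
rewrite [leRHS](_ : _ = 2 * pi * B + 2 * pi * B); last by ring.
by apply: lerD; apply: Rint_bound => // x; apply: le_trans (fB x);
  [exact: Re_le_cabs|exact: Im_le_cabs].
Qed.

Let expk (k : int) t : C := expi (- (k%:~R * t)).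
Let cexpk k : contC (expk k).
Proof.
rewrite (_ : expk k = fun t => expi ((- k%:~R) * t)); first exact: contC_expiM.
by apply/funext => t; rewrite mulNr.
Qed.

Let cfe f k : contC f -> contC (fun t => f t * expi (- (k%:~R * t))).
Proof. by move=> cf; apply: contCM => //; apply: cexpk. Qed.

Lemma fcoefD f g k : contC f -> contC g ->
  fcoefth (fun t => f t + g t) k = fcoefth f k + fcoefth g k.
Proof.
move=> cf cg; rewrite /fcoefth -mulrDr -intCD; [|exact: cfe|exact: cfe].
by congr (_ * intC _); apply/funext => t; rewrite mulrDl.
Qed.

Lemma fcoefZ z f k : contC f -> fcoefth (fun t => z * f t) k = z * fcoefth f k.
Proof.
move=> cf; rewrite /fcoefth mulrCA -(intCZ z (cfe k cf)).
by congr (_ * intC _); apply/funext => t; rewrite mulrA.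
Qed.

Lemma fcoefN f k : contC f -> fcoefth (fun t => - f t) k = - fcoefth f k.
Proof.
move=> cf; rewrite -mulN1r -fcoefZ//; congr (fcoefth _ k); apply/funext => t.
by rewrite mulN1r.
Qed.

Lemma fcoefB f g k : contC f -> contC g ->
  fcoefth (fun t => f t - g t) k = fcoefth f k - fcoefth g k.
Proof. by move=> cf cg; rewrite fcoefD ?fcoefN//; apply: contCN. Qed.

Lemma fcoef_sum (I : Type) (r : seq I) (P : pred I) (F : I -> R -> C) k :
  (forall i, contC (F i)) ->
  fcoefth (fun t => \sum_(i <- r | P i) F i t) k = \sum_(i <- r | P i) fcoefth (F i) k.
Proof.
move=> cF; elim: r => [|i r IH].
  rewrite big_nil (_ : (fun _ => _) = fun t => 0 * 0).
    by rewrite (fcoefZ _ _ (contC_cst 0)) mul0r.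
  by apply/funext => t; rewrite big_nil mul0r.
rewrite big_cons -IH; case: ifPn => Pi.
  rewrite -fcoefD//; last exact: contC_sum.
  by congr (fcoefth _ k); apply/funext => t; rewrite big_cons Pi.
by congr (fcoefth _ k); apply/funext => t; rewrite big_cons (negbTE Pi).
Qed.

Lemma fcoef_bound f B k : contC f -> (forall x, cabs (f x) <= B) ->
  cabs (fcoefth f k) <= 2 * B.
Proof.
move=> cf fB; rewrite /fcoefth cabsM -/(rc _) cabs_rc ger0_norm; last first.
  by rewrite invr_ge0 ltW// pi2_gt0.
rewrite mulrC ler_pdivrMr ?pi2_gt0// (_ : 2 * B * _ = 2 * (2 * pi * B)); last by ring.
apply: intC_bound; first exact: cfe.
by move=> x; rewrite cabsM /expk cabs_expi mulr1.
Qed.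

Lemma fcoef_shift f (m k : int) :
  fcoefth (fun t => f t * expi (m%:~R * t)) k = fcoefth f (k - m).
Proof.
rewrite /fcoefth; congr (_ * intC _); apply/funext => t.
by rewrite -mulrA -expiD; congr (_ * expi _); rewrite intrD rmorphN /=; ring.
Qed.

Lemma Rint_trig (m : int) (F G : R -> R) : m != 0 -> continuous G ->
  (forall x : R, is_derive x 1 F (G x)) -> F (2 * pi) = F 0 ->
  Rintegral mu I2pi G = 0.
Proof.
move=> m0 cG dF F0; rewrite /Rintegral (@continuous_FTC2 _ G F 0 (2 * pi)) ?pi2_gt0//.
- by rewrite F0 /= subrr.
- exact: continuous_subspaceT.
- have cF : continuous F.
    by move=> x; apply: differentiable_continuous; apply/derivable1_diffP; have [] := dF x.
  split => [x _| |].
  + by have [] := dF x.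
  + by apply: cvg_at_right_filter; exact: cF.
  + by apply: cvg_at_left_filter; exact: cF.
- by move=> x _; rewrite derive1E; have := dF x => dFx; rewrite derive_val.
Qed.

Lemma intC_expi (m : int) : m != 0 -> intC (fun t => expi (m%:~R * t)) = 0 :> C.
Proof.
move=> m0; have mR0 : (m%:~R : R) != 0 by rewrite intr_eq0.
have e := @expi_int2pi R m; have [c s] : cos (m%:~R * (2 * pi)) = 1 :> R /\ sin (m%:~R * (2 * pi)) = 0 :> R.
  by move: e => [-> ->].
have [cc cs] := contC_expiM m%:~R.
apply: complex_eq => /=.
- apply: (@Rint_trig m (fun x => m%:~R^-1 * sin (m%:~R * x))) => //.
    by move=> x; apply: is_derive_eq; rewrite /GRing.scale /= ?mulr0 ?add0r ?addr0 ?mulr1; field.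
  by rewrite s !mulr0 sin0 mulr0.
- apply: (@Rint_trig m (fun x => - (m%:~R^-1 * cos (m%:~R * x)))) => //.
    by move=> x; apply: is_derive_eq; rewrite /GRing.scale /= ?mulr0 ?add0r ?addr0 ?mulr1; field.
  by rewrite c mulr0 cos0.
Qed.

Lemma fcoef_cst z k : fcoefth (fun=> z) k = if k == 0 then z else 0.
Proof.
rewrite /fcoefth (_ : intC _ = z * intC (fun t => expi ((- k)%:~R * t))).
  have [->|k0] := eqVneq k 0; last by rewrite intC_expi ?oppr_eq0// !mulr0.
  rewrite (_ : intC _ = rc (2 * pi)); last first.
    apply: complex_eq => /=; under eq_Rintegral do rewrite oppr0 mul0r ?cos0 ?sin0.
      by rewrite Rintegral_cst// mu_2pi mul1r.
    by rewrite Rintegral_cst// mul0r.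
  rewrite -/(rc _) mulrCA -rcM mulVf ?mulr1// gt_eqF//; exact: pi2_gt0.
rewrite -intCZ; last exact: contC_expiM.
by congr intC; apply/funext => t; rewrite rmorphN /= mulNr.
Qed.

Lemma fcoef_expi (m k : int) : fcoefth (fun t => expi (m%:~R * t)) k = (k == m)%:R :> C.
Proof.
rewrite (_ : (fun t => _) = (fun t => 1 * expi (m%:~R * t))); last first.
  by apply/funext => t; rewrite mul1r.
rewrite (fcoef_shift (fun=> 1)) fcoef_cst subr_eq0; by case: eqP.
Qed.

End FourierCoefficients.

(** * Fejér means and uniqueness of Fourier coefficients *)

Section Fejer.
Variable R : realType.
Local Notation C := R[i].
Local Notation Re := (@complex.Re R).
Local Notation mu := (@lebesgue_measure R).
Local Notation I2pi := (`[0, 2 * pi]%classic : set R).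
Implicit Types (f g h : R -> C) (z : C).

Definition per2pi (T : Type) (h : R -> T) := forall t, h (t + 2 * pi) = h t.

Lemma per2piZ (T : Type) (h : R -> T) (k : int) t : per2pi h -> h (t + k%:~R * (2 * pi)) = h t.
Proof.
move=> ph; have pn n s : h (s + n%:R * (2 * pi)) = h s.
  elim: n => [|n IH]; first by rewrite mul0r addr0.
  by rewrite -natr1 mulrDl mul1r addrA ph.
case: k => n; first by rewrite -pmulrn pn.
by rewrite -(pn n.+1) NegzE mulrNz -addrA mulNr -pmulrn addNr addr0.
Qed.

Lemma reduce_2pi (t r : R) : exists k : int, r <= t + k%:~R * (2 * pi) < r + 2 * pi.
Proof.
exists (- Num.floor ((t - r) / (2 * pi))).
have := floor_itv ((t - r) / (2 * pi)).
rewrite ler_pdivlMr ?pi2_gt0// ltr_pdivrMr ?pi2_gt0// => /andP[h1].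
rewrite intrD mulrDl -[1%:~R]/(1:R) mul1r => h2.
by rewrite rmorphN mulNr; apply/andP; split; lra.
Qed.

Lemma per_bounded (u : R -> R) : continuous u -> per2pi u -> exists B, forall x, `|u x| <= B.
Proof.
move=> cu pu.
have [|c _ hc] := @EVT_max R (fun x => `|u x|) 0 (2 * pi) (ltW (pi2_gt0 R)).
  apply: continuous_subspaceT => x.
  by apply: continuous_comp; [exact: cu|exact: norm_continuous].
exists `|u c| => x; have [k /andP[k1 k2]] := reduce_2pi x 0.
rewrite -(per2piZ k x pu); apply: hc; rewrite in_itv /= k1.
by rewrite ltW// (lt_le_trans k2)// add0r.
Qed.

Lemma per_unif_cont (u : R -> R) (e : R) : continuous u -> per2pi u -> 0 < e ->
  exists2 d, 0 < d & forall x t, `|x - t| < d -> `|u x - u t| <= e.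
Proof.
move=> cu pu e0.
pose P (d t : R) := forall x, `|x - t| < d -> `|u x - u t| <= e.
have [] := (@compact_near_coveringP _ `[0, 2 * pi]%classic).1 (@segment_compact _ _ _) R (0^'+) P.
  move=> t _.
  have /cvgrPdist_lt/(_ (e / 2)) := cu t.
  rewrite divr_gt0// => /(_ isT) /nbhs_ballP[r r0 rP].
  exists (ball t (r / 2), [set d | d < r / 2]).
    split; first by apply: nbhsx_ballx; rewrite divr_gt0.
    by apply: nbhs_right_lt; rewrite divr_gt0.
  move=> [t' d] /= [tt' dr] x xt'.
  have h1 : `|u t - u t'| < e / 2.
    by apply: rP; rewrite /ball /= in tt' *; apply: lt_trans tt' _; move: r0 => /=; lra.
  have h2 : `|u t - u x| < e / 2.
    apply: rP; rewrite /ball /= in tt' *.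
    rewrite (_ : t - x = (t - t') - (x - t')); last by ring.
    rewrite (le_lt_trans (ler_normB _ _))//.
    by have := ltrD tt' (lt_trans xt' dr); rewrite -splitr.
  rewrite (_ : u x - u t' = (u t - u t') - (u t - u x)); last by ring.
  rewrite (le_trans (ler_normB _ _))//.
  by have := ltrD h1 h2; rewrite -splitr => /ltW.
move=> d0 /= d0pos dP.
exists (d0 / 2) => [|x t xt]; first by rewrite divr_gt0.
have [k /andP[k1 k2]] := reduce_2pi t 0.
rewrite -(per2piZ k x pu) -(per2piZ k t pu).
have/= := dP (d0 / 2); apply => //.
- by rewrite /ball /= sub0r normrN gtr0_norm ?divr_gt0// ltr_pdivrMr// ltr_pMr// ltr1n.
- by rewrite divr_gt0.
- by rewrite /= in_itv /= k1 ltW// (lt_le_trans k2)// add0r.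
- by rewrite (_ : _ - _ = x - t)//; ring.
Qed.

(** Near the diagonal modulo 2 pi uniform continuity gives [e]; elsewhere 1 - cos is bounded below
    and a large multiple of it exceeds twice the sup of |u|. In this form the convergence of
    positive operators need only be tested on 1 and e^(it). *)
Lemma korovkin_bound (u : R -> R) (e : R) : continuous u -> per2pi u -> 0 < e ->
  exists2 K, 0 <= K & forall x t, `|u x - u t| <= e + K * (1 - cos (x - t)).
Proof.
move=> cu pu e0; have [B uB] := per_bounded cu pu.
have B0 : 0 <= B by exact: le_trans (normr_ge0 _) (uB 0).
have [d d0 dP] := per_unif_cont cu pu e0.
pose d1 := Num.min d pi; have d10 : 0 < d1 by rewrite lt_min d0 pi_gt0.
have cd : cos d1 < 1.
  by rewrite -cos0 ltr_cos ?in_itv /= ?lexx ?pi_ge0 ?(ltW d10)// ge_min lexx orbT.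
have cd' : 0 < 1 - cos d1 by lra.
(* Then K (1 - cos d1) = 2 B, the trivial bound for |u x - u t|. The cap of [d1] at pi keeps the
   comparison inside [0, pi], where the cosine decreases. *)
pose K := 2 * B / (1 - cos d1); have K0 : 0 <= K by rewrite divr_ge0 ?mulr_ge0// ltW.
exists K => // x t; have cle y : 0 <= 1 - cos y :> R by have := cos_le1 y; lra.
have [k /andP[k1 k2]] := reduce_2pi (x - t) (- pi).
have := per2piZ k x pu; set x' := x + k%:~R * (2 * pi) => <-.
have -> : cos (x - t) = cos (x' - t).
  have := @per2piZ _ (@cos R) k (x - t); rewrite (_ : x - t + k%:~R * (2 * pi) = x' - t); last by rewrite /x'; ring.
  by move=> <-// y; rewrite mulr_natl cosD2pi.
have xt : `|x' - t| <= pi by rewrite ler_norml /x'; apply/andP; split; lra.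
have [xd|xd] := ltP `|x' - t| d1.
  apply: (le_trans (dP _ _ _)); first by rewrite (lt_le_trans xd)// ge_min lexx.
  by rewrite lerDl mulr_ge0.
have h : cos (x' - t) <= cos d1.
  have -> : cos (x' - t) = cos `|x' - t| by case: (ger0P (x' - t)) => // _; rewrite cosN.
  rewrite leNgt ltr_cos ?in_itv /= ?normr_ge0 ?xt ?(ltW d10) ?ge_min ?lexx ?orbT//.
  by rewrite -leNgt.
rewrite (le_trans (ler_normB _ _))// (@le_trans _ _ (2 * B))//.
  by have := lerD (uB x') (uB t); lra.
rewrite (@le_trans _ _ (K * (1 - cos d1)))//.
  by rewrite /K divfK// gt_eqF.
have := ler_wpM2l K0 (_ : 1 - cos d1 <= 1 - cos (x' - t)) => /(_ _); lra.
Qed.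

Lemma per_boundedC h : contC h -> per2pi h -> exists B, forall x, cabs (h x) <= B.
Proof.
move=> [h1 h2] ph.
have [|B1 hB1] := per_bounded h1; first by move=> t /=; rewrite ph.
have [|B2 hB2] := per_bounded h2; first by move=> t /=; rewrite ph.
by exists (B1 + B2) => x; rewrite (le_trans (cabs_le_ReIm _))// lerD// ?hB1 ?hB2.
Qed.

Lemma korovkin_boundC h e : contC h -> per2pi h -> 0 < e ->
  exists2 K, 0 <= K & forall x t, cabs (h x - h t) <= e + K * (1 - cos (x - t)).
Proof.
move=> [h1 h2] ph e0; have e20 : 0 < e / 2 by rewrite divr_gt0.
have [|K1 K10 hK1] := korovkin_bound h1 _ e20; first by move=> t /=; rewrite ph.
have [|K2 K20 hK2] := korovkin_bound h2 _ e20; first by move=> t /=; rewrite ph.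
exists (K1 + K2); first exact: addr_ge0.
move=> x t; rewrite (le_trans (cabs_le_ReIm _))// cReB cImB.
by have := lerD (hK1 x t) (hK2 x t) => /=; lra.
Qed.

(** Monotonicity of the mean value, up to the factor 2. Combined with a non-negative kernel it makes
    the Fejér mean behave as a positive operator. *)
Lemma fcoef0_dom f (u : R -> C) : contC f -> contC u ->
  (forall x, cabs (f x) <= Re (u x)) -> cabs (fcoefth f 0) <= 2 * Re (fcoefth u 0).
Proof.
move=> cf cu fu.
have e (g : R -> C) : fcoefth g 0 = rc (2 * pi)^-1 * intC g.
  rewrite /fcoefth; congr (_ * intC _); apply/funext => t.
  by rewrite mul0r oppr0 expi0 mulr1.
rewrite !e cabsM cabs_rc ger0_norm ?invr_ge0 ?(ltW (pi2_gt0 R))//.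
rewrite cReM /= mul0r subr0 mulrCA ler_pM2l ?invr_gt0 ?pi2_gt0//.
have [[f1 f2] [u1 u2]] := (cf, cu).
have dom (v : R -> R) : continuous v -> (forall x, `|v x| <= Re (u x)) ->
    `|Rintegral mu I2pi v| <= Rintegral mu I2pi (fun t => Re (u t)).
  move=> cv vu; apply: (le_trans (le_normr_Rintegral _ (integrable_2pi cv))) => //.
  apply: le_Rintegral => //; last exact: integrable_2pi.
  apply: (@integrable_2pi _ (fun x => `|v x|)) => x.
  by apply: continuous_comp; [exact: cv|exact: norm_continuous].
rewrite (le_trans (cabs_le_ReIm _))//= -/(rc _).
rewrite [leRHS]mulr_natl [leRHS]mulr2n.
apply: lerD; apply: dom => // x; apply: le_trans (fu x);
  [exact: Re_le_cabs|exact: Im_le_cabs].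
Qed.

Definition fejerK n (y : R) : R := n.+1%:R^-1 * cabs (\sum_(j < n.+1) expi (j%:R * y)) ^+ 2.

(** The Fejér mean before collecting terms: frequency m occurs n + 1 - |m| times among the
    differences j - l. The double sum exhibits the kernel as the square of a modulus and permits
    averaging over l in [fcoef_conv]. *)
Definition fejer n h (t : R) : C :=
  rc n.+1%:R^-1 * \sum_(j < n.+1) \sum_(l < n.+1)
    fcoefth h (j%:Z - l%:Z) * expi ((j%:Z - l%:Z)%:~R * t).

Lemma conjc_expi (y : R) : (expi y)^*%C = expi (- y).
Proof. by rewrite /expi cosN sinN. Qed.

Lemma fejerKE n y : rc (fejerK n y) =
  rc n.+1%:R^-1 * \sum_(j < n.+1) \sum_(l < n.+1) expi ((j%:Z - l%:Z)%:~R * y).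
Proof.
rewrite /fejerK rcM; congr (_ * _).
set S : C := \sum_(j < n.+1) expi (j%:R * y).
have -> : rc (cabs S ^+ 2) = S * (S^*)%C.
  rewrite sqr_cabs; apply: complex_eq; rewrite ?cReM ?cImM; case: S => a b /=; ring.
rewrite {2}/S rmorph_sum mulr_suml; apply: eq_bigr => j _.
rewrite mulr_sumr; apply: eq_bigr => l _.
rewrite -[X in _ * X]/((expi (l%:R * y))^*%C) conjc_expi.
by rewrite -expiD; congr expi; rewrite rmorphB /= -!pmulrn; ring.
Qed.

Lemma fejerK_ge0 n y : 0 <= fejerK n y.
Proof. by rewrite mulr_ge0 ?invr_ge0 ?sqr_ge0. Qed.

Lemma contC_fejerK n t : contC (fun x => rc (fejerK n (t - x))).
Proof.
rewrite (_ : (fun x => _) = fun x => rc n.+1%:R^-1 * \sum_(j < n.+1) \sum_(l < n.+1)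
  (expi ((j%:Z - l%:Z)%:~R * t) * expi ((- (j%:Z - l%:Z)%:~R) * x))).
  apply: contCM; first exact: contC_cst.
  apply: contC_sum => j; apply: contC_sum => l.
  by apply: contCM; [exact: contC_cst|exact: contC_expiM].
apply/funext => x; rewrite fejerKE; congr (_ * _).
apply: eq_bigr => j _; apply: eq_bigr => l _.
by rewrite -expiD; congr expi; ring.
Qed.

Lemma fejerE n h t : contC h ->
  fejer n h t = fcoefth (fun x => h x * rc (fejerK n (t - x))) 0.
Proof.
move=> ch; rewrite /fejer.
rewrite [in RHS](_ : (fun x => _) = fun x => rc n.+1%:R^-1 * \sum_(j < n.+1) \sum_(l < n.+1)
  (expi ((j%:Z - l%:Z)%:~R * t) * (h x * expi ((- (j%:Z - l%:Z))%:~R * x)))); last first.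
  apply/funext => x; rewrite fejerKE mulrCA; congr (_ * _).
  rewrite mulr_sumr; apply: eq_bigr => j _; rewrite mulr_sumr; apply: eq_bigr => l _.
  rewrite mulrCA -expiD; congr (_ * expi _); rewrite mulrNz; ring.
have c1 (j l : 'I_n.+1) : contC (fun x => h x * expi ((- (j%:Z - l%:Z))%:~R * x)).
  by apply: contCM => //; exact: contC_expiM.
have c2 (j l : 'I_n.+1) : contC (fun x => expi ((j%:Z - l%:Z)%:~R * t) * (h x * expi ((- (j%:Z - l%:Z))%:~R * x))).
  by apply: contCM; [exact: contC_cst|exact: c1].
have c3 (j : 'I_n.+1) : contC (fun x => \sum_(l < n.+1) (expi ((j%:Z - l%:Z)%:~R * t) * (h x * expi ((- (j%:Z -
    l%:Z))%:~R * x)))).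
  by apply: contC_sum => l; exact: c2.
rewrite fcoefZ; last by apply: contC_sum.
rewrite fcoef_sum//; congr (_ * _); apply: eq_bigr => j _.
rewrite fcoef_sum//; apply: eq_bigr => l _.
rewrite fcoefZ// fcoef_shift mulrC; congr (_ * fcoefth _ _); lia.
Qed.

Lemma fejer1 n t : fejer n (fun=> 1) t = 1.
Proof.
rewrite /fejer (eq_bigr (fun=> 1)); last first.
  move=> j _; rewrite (bigD1 j)//= big1 => [|l lj].
    by rewrite fcoef_cst subrr eqxx mul0r expi0 mulr1 addr0.
  rewrite fcoef_cst ifF ?mul0r//; apply/negP => /eqP.
  by move=> h; move/eqP: lj; apply; apply: val_inj => /=; lia.
by rewrite sumr_const card_ord -rc_nat -rcM mulVf ?pnatr_eq0.
Qed.

Lemma fejer_expi n t : fejer n (@expi R) t = rc (n%:R / n.+1%:R) * expi t.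
Proof.
have e1 : @expi R = fun x => expi (1%:~R * x) by apply/funext => x; rewrite mul1r.
rewrite /fejer mulrC (mulrC n%:R) rcM -mulrA mulrC; congr (_ * _).
rewrite big_ord_recl big1 ?add0r => [|l _]; last first.
  by rewrite {1}e1 fcoef_expi /= (_ : (_ == _) = false) ?mul0r//; apply/negP => /eqP; lia.
rewrite (eq_bigr (fun=> expi t)) => [|j _].
  by rewrite sumr_const card_ord rc_nat mulr_natl.
rewrite (bigD1 (widen_ord (leqnSn n) j))//= big1 => [|l lj].
  rewrite {1}e1 fcoef_expi addr0 (_ : _ - _ = 1); last by rewrite /bump /=; lia.
  by rewrite mul1r mul1r.
rewrite {1}e1 fcoef_expi (_ : (_ == _) = false) ?mul0r//; apply/negP => /eqP; rewrite /bump /= => h.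
by move/eqP: lj; apply; apply: val_inj => /=; lia.
Qed.

(** Korovkin's argument: the error is dominated by the mean of e/4 + K (1 - cos (x - t)). The means
    of 1 and e^(ix) are explicit, so this mean is e/4 + K/(n+1), doubled by [fcoef0_dom]. *)
Lemma fejer_cvg h (e : R) : contC h -> per2pi h -> 0 < e ->
  \forall n \near \oo, forall t, cabs (h t - fejer n h t) <= e.
Proof.
move=> ch ph e0; have e40 : 0 < e / 4 by rewrite divr_gt0.
have [K K0 hK] := korovkin_boundC ch ph e40.
near=> n => t.
have -> : h t - fejer n h t = - fcoefth (fun x => (h x - h t) * rc (fejerK n (t - x))) 0.
  rewrite (_ : (fun x => _) = fun x => h x * rc (fejerK n (t - x)) - h t * (1 * rc (fejerK n (t - x)))); last first.
    by apply/funext => x; ring.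
  have cK := contC_fejerK n t.
  have c1 : contC (fun x => (1:C) * rc (fejerK n (t - x))) by apply: contCM => //; exact: contC_cst.
  rewrite fcoefB; [|exact: contCM|by apply: contCM => //; exact: contC_cst].
  rewrite fcoefZ// -!fejerE ?fejer1 //; [ring|exact: contC_cst].
rewrite cabsN.
(* The real part of the first factor is e/4 + K (1 - cos (x - t)); the complex form is chosen
   because the Fejér mean of [expi] is known exactly. *)
pose u x := (rc (e / 4 + K) - rc K * (expi (- t) * expi x)) * rc (fejerK n (t - x)).
have cE : contC (fun x => rc (e / 4 + K) - rc K * (expi (- t) * expi x)).
  apply: contCB; first exact: contC_cst.
  apply: contCM; first exact: contC_cst.
  by apply: contCM; [exact: contC_cst|exact: contC_expi].
apply: (@le_trans _ _ (2 * Re (fcoefth u 0))).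
  apply: fcoef0_dom.
  - by apply: contCM; [apply: contCB => //; exact: contC_cst|exact: contC_fejerK].
  - exact: contCM cE (contC_fejerK n t).
  - move=> x; rewrite cabsM cabs_rc (ger0_norm (fejerK_ge0 _ _)) /u cReM.
    have -> : Re (rc (e / 4 + K) - rc K * (expi (- t) * expi x)) = e / 4 + K - K * cos (x - t).
      by rewrite cReB -expiD cReM /= mul0r subr0 [- t + x]addrC.
    rewrite /= mulr0 subr0 ler_wpM2r ?fejerK_ge0// (le_trans (hK x t))//; lra.
rewrite -fejerE//.
have -> : fejer n (fun x => rc (e / 4 + K) - rc K * (expi (- t) * expi x)) t =
   rc (e / 4 + K) * fejer n (fun=> 1) t - rc K * (expi (- t) * fejer n (@expi R) t).
  have cE1 : contC (fun x => expi (- t) * @expi R x) by apply: contCM; [exact: contC_cst|exact: contC_expi].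
  have cE2 : contC (fun x => rc K * (expi (- t) * @expi R x)) by apply: contCM => //; exact: contC_cst.
  rewrite !fejerE//; [|exact: contC_expi|exact: contC_cst].
  have cK := contC_fejerK n t.
  rewrite -!fcoefZ; [|by do ?[apply: contCM; rewrite //=; try exact: contC_cst; try exact: contC_expi]..].
  rewrite -fcoefB; [|by do ?[apply: contCM; rewrite //=; try exact: contC_cst; try exact: contC_expi]..].
  by congr (fcoefth _ 0); apply/funext => x; ring.
rewrite fejer1 fejer_expi.
have -> : expi (- t) * (rc (n%:R / n.+1%:R) * expi t) = rc (n%:R / n.+1%:R).
  by rewrite mulrCA -expiD addNr expi0 mulr1.
rewrite mulr1 -rcM -rcN -rcD /=.
have -> : e / 4 + K - K * (n%:R / n.+1%:R) = e / 4 + K / n.+1%:R.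
  have n0 : n%:R + 1 != 0 :> R by rewrite natr1 pnatr_eq0.
  by rewrite -natr1; field; rewrite // addrC.
rewrite (_ : e = 2 * (e / 4 + e / 4)); last by field.
rewrite ler_pM2l// (_ : 2 * (e / 4 + e / 4) / 4 = e / 4); last by field.
rewrite lerD2l ler_pdivrMr// -ler_pdivrMl//.
rewrite (@le_trans _ _ n%:R) ?ler_nat//.
by near: n; exact: nbhs_infty_ger.
Unshelve. all: by end_near.
Qed.

(** All Fejér means vanish, and they converge uniformly to [h]. *)
Lemma fcoef_unique h : contC h -> per2pi h -> (forall k, fcoefth h k = 0) -> forall t, h t = 0.
Proof.
move=> ch ph h0 t; apply/cabs_eq0/eqP; rewrite eq_le cabs_ge0 andbT.
apply/ler_addgt0Pl => e e0; rewrite addr0.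
have [n _ /(_ n)/= /(_ (leqnn n)) /(_ t)] := fejer_cvg ch ph e0.
rewrite /fejer big1 ?mulr0 ?subr0// => j _.
by rewrite big1// => l _; rewrite h0 mul0r.
Qed.

End Fejer.

(** * Absolutely summable Fourier series *)

Section EsumFacts.
Variable R : realType.
Local Open Scope ereal_scope.

Lemma esum_swap (S T : choiceType) (a : S -> T -> \bar R) :
  (forall i j, 0 <= a i j) ->
  \esum_(i in [set: S]) \esum_(j in [set: T]) a i j =
  \esum_(j in [set: T]) \esum_(i in [set: S]) a i j.
Proof.
move=> a0; rewrite !(esum_esum (J := fun=> setT))//.
rewrite (reindex_esum ([set: T] `*`` (fun=> [set: S])) _ (fun x => (x.2, x.1)))//.
split=> //= [[i1 i2] [j1 j2] /= _ _ [] -> ->//|[i1 i2] /= _].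
by exists (i2, i1).
Qed.

Lemma le_esumZ (T : choiceType) (a : T -> \bar R) (r : R) : (0 <= r)%R -> (forall i, 0 <= a i) ->
  \esum_(i in [set: T]) (r%:E * a i) <= r%:E * \esum_(i in [set: T]) a i.
Proof.
move=> r0 a0; apply: ge_ereal_sup => _ [X [finX _] <-].
rewrite -ge0_mule_fsumr//; apply: lee_wpmul2l; first by rewrite lee_fin.
by apply: ereal_sup_ubound; exists X.
Qed.

Lemma esumZ (T : choiceType) (a : T -> \bar R) (r : R) : (0 <= r)%R -> (forall i, 0 <= a i) ->
  \esum_(i in [set: T]) (r%:E * a i) = r%:E * \esum_(i in [set: T]) a i.
Proof.
move=> r0 a0; apply/eqP; rewrite eq_le le_esumZ//=.
have [->|rn0] := eqVneq r 0%R.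
  by rewrite mul0e esum_ge0// => i _; rewrite mul0e.
have {rn0} r0 : (0 < r)%R by rewrite lt_neqAle eq_sym rn0.
have ri0 : (0 <= r^-1)%R by rewrite invr_ge0 ltW.
have ra i : 0 <= r%:E * a i by rewrite mule_ge0// lee_fin ltW.
have h := le_esumZ ri0 ra.
have E : \esum_(i in [set: T]) (r^-1%:E * (r%:E * a i)) = \esum_(i in [set: T]) a i.
  by apply: eq_esum => i _; rewrite muleA -EFinM mulVf ?gt_eqF// mul1e.
rewrite E in h.
have r0' : 0 <= r%:E by rewrite lee_fin ltW.
have := lee_wpmul2l r0' h.
by rewrite muleA -EFinM mulfV ?gt_eqF// mul1e.
Qed.

Lemma le_esum1 (T : choiceType) (a : T -> \bar R) i : (forall i, 0 <= a i) ->
  a i <= \esum_(i in [set: T]) a i.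
Proof.
move=> a0; apply: esum_ge; exists [set i]; first by split => //; exact: finite_set1.
by rewrite fsbig_set1.
Qed.

Lemma le_esum_sum (T : choiceType) (a : T -> \bar R) (s : seq T) : uniq s -> (forall i, 0 <= a i) ->
  \sum_(i <- s) a i <= \esum_(i in [set: T]) a i.
Proof.
move=> us a0; apply: esum_ge; exists [set` s]; first by split => //; exact: finite_seq.
by rewrite fsbig_seq.
Qed.

Lemma esum_reindex_bij (S T : choiceType) (e : S -> T) (a : T -> \bar R) :
  bijective e -> \esum_(i in [set: T]) a i = \esum_(i in [set: S]) a (e i).
Proof.
move=> [f fe ef]; apply: reindex_esum; split => //= [x y _ _ /(congr1 f)|y _].
  by rewrite !fe.
by exists (f y).
Qed.

Lemma esum_intE (a : int -> \bar R) : (forall k, 0 <= a k) ->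
  \esum_(k in [set: int]) a k =
  \esum_(n in [set: nat]) a n%:Z + \esum_(n in [set: nat]) a (- n.+1%:Z)%R.
Proof.
move=> a0; rewrite (esumID (range Posz))// !setTI.
congr (_ + _); first by rewrite esum_image// => x y _ _ [].
rewrite -(esum_image [set: nat] (fun n => (- n.+1%:Z)%R)); last by move=> x y _ _ /= [].
congr esum; apply/seteqP; split => [k /= kN|_ [n _ <-] [m _]].
  case: k kN => n nN; first by exfalso; apply: nN; exists n.
  by exists n => //; rewrite NegzE.
by rewrite -NegzE.
Qed.

Lemma esum_nat_lim (u : nat -> \bar R) (B : \bar R) : (forall n, 0 <= u n) ->
  (forall N, \sum_(n < N) u n <= B) -> \esum_(n in [set: nat]) u n <= B.
Proof.
move=> u0 uB; rewrite -nneseries_esumT//; apply: lime_le.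
  by apply: is_cvg_nneseries.
by apply: nearW => n; rewrite big_mkord.
Qed.

Lemma le_esum_nat (u : nat -> \bar R) N : (forall n, 0 <= u n) ->
  \sum_(n < N) u n <= \esum_(n in [set: nat]) u n.
Proof.
move=> u0; rewrite -(big_mkord xpredT u); apply: le_esum_sum => //; exact: iota_uniq.
Qed.

Lemma esum_le_real (T : choiceType) (a : T -> \bar R) :
  (forall i, 0 <= a i) -> \esum_(i in [set: T]) a i < +oo ->
  exists2 B : R, (0 <= B)%R & \esum_(i in [set: T]) a i <= B%:E.
Proof.
move=> a0 h; have e0 : 0 <= \esum_(i in [set: T]) a i by apply: esum_ge0.
exists (fine (\esum_(i in [set: T]) a i)); first exact: fine_ge0.
by rewrite fineK// ge0_fin_numE.
Qed.

End EsumFacts.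

Section SeriesFacts.
Variable R : realType.

Lemma summableP (u : nat -> R) : (forall n, 0 <= u n) ->
  Defs.summable u <-> (\esum_(n in [set: nat]) (u n)%:E < +oo)%E.
Proof.
move=> u0; split => [cu|h].
- apply: (@le_lt_trans _ _ (limn (series u))%:E); last exact: ltry.
  apply: esum_nat_lim => [n|N]; first by rewrite lee_fin.
  rewrite sumEFin lee_fin -(big_mkord xpredT u).
  have := nondecreasing_cvgn_le _ cu; rewrite /series /=; apply.
  by apply: nondecreasing_series => n _ _; exact: u0.
- have [B B0 hB] : exists2 B : R, (0 <= B)%R & (\esum_(n in [set: nat]) (u n)%:E <= B%:E)%E.
    by apply: esum_le_real => // n; rewrite lee_fin.
  apply: nondecreasing_is_cvgn; first by apply: nondecreasing_series => n _ _; exact: u0.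
  exists B => _ [n _ <-]; rewrite -lee_fin (le_trans _ hB)// /series /= big_mkord -sumEFin.
  by apply: le_esum_nat => i; rewrite lee_fin.
Qed.

Lemma series_tail (v x : nat -> R) n : (forall k, `|v k| <= x k) -> cvgn (series x) ->
  cvgn (series v) /\ `|limn (series v) - \sum_(k < n) v k| <= limn (series x) - series x n.
Proof.
move=> vx cx; have x0 k : 0 <= x k by apply: le_trans (vx k).
have cv : cvgn (series v).
  apply: normed_cvg; apply: series_le_cvg cx => //; first by move=> k; exact: normr_ge0.
split => //; have -> : \sum_(k < n) v k = series v n by rewrite /series /= big_mkord.
have xm m : series x m <= limn (series x).
  by apply: nondecreasing_cvgn_le => //; apply: nondecreasing_series => k _ _; exact: x0.
have dist m : (n <= m)%N -> `|series v m - series v n| <= limn (series x) - series x n.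
  move=> nm; apply: (@le_trans _ _ (series x m - series x n)); last by rewrite lerB.
  rewrite !sub_series_geq//; apply: le_trans (ler_norm_sum _ _ _) _.
  by apply: ler_sum => i _; exact: vx.
rewrite ler_distl; apply/andP; split.
- apply: limr_ge => //; exists n => // m /= /dist; rewrite ler_distl => /andP[+ _].
  by [].
- apply: limr_le => //; exists n => // m /= /dist; rewrite ler_distl => /andP[_ +].
  by [].
Qed.

Lemma csum_tail (u : nat -> R[i]) (x : nat -> R) n : (forall k, cabs (u k) <= x k) ->
  cvgn (series x) ->
  cabs (csum u - \sum_(k < n) u k) <= 2 * (limn (series x) - series x n).
Proof.
move=> ux cx; rewrite (le_trans (cabs_le_ReIm _))// cReB cImB /= cRe_sum cIm_sum.
have [|_ h1] := @series_tail (fun k => complex.Re (u k)) x n _ cx.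
  by move=> k; apply: le_trans (ux k); exact: Re_le_cabs.
have [|_ h2] := @series_tail (fun k => complex.Im (u k)) x n _ cx.
  by move=> k; apply: le_trans (ux k); exact: Im_le_cabs.
by have := lerD h1 h2; rewrite /=; lra.
Qed.

Lemma contC_unif (h : R -> R[i]) :
  (forall e : R, 0 < e -> exists2 g, contC g & forall t, cabs (h t - g t) <= e) -> contC h.
Proof.
move=> H; split => t; apply/cvgrPdist_le => e e0.
- have [|g [cg _] hg] := H (e / 3); first by rewrite divr_gt0.
  have /cvgrPdist_le/(_ (e / 3)) := cg t; rewrite divr_gt0// => /(_ isT).
  apply: filterS => s /= hs.
  have h1 := le_trans (Re_le_cabs _) (hg t); have h2 := le_trans (Re_le_cabs _) (hg s).
  rewrite !cReB in h1 h2; move: h1 h2 hs; rewrite !ler_norml.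
  by move=> /andP[? ?] /andP[? ?] /andP[? ?]; apply/andP; split; lra.
- have [|g [_ cg] hg] := H (e / 3); first by rewrite divr_gt0.
  have /cvgrPdist_le/(_ (e / 3)) := cg t; rewrite divr_gt0// => /(_ isT).
  apply: filterS => s /= hs.
  have h1 := le_trans (Im_le_cabs _) (hg t); have h2 := le_trans (Im_le_cabs _) (hg s).
  rewrite !cImB in h1 h2; move: h1 h2 hs; rewrite !ler_norml.
  by move=> /andP[? ?] /andP[? ?] /andP[? ?]; apply/andP; split; lra.
Qed.

End SeriesFacts.

(** * The Wiener algebra in the angular variable *)

Section Wiener.
Variable R : realType.
Local Notation C := R[i].
Implicit Types (f g h : R -> C) (z : C) (c : int -> C).

Definition evC c (t : C) : C :=
  csum (fun k => c k%:Z * t ^+ k) + csum (fun k => c (- (k.+1)%:Z) * t ^- k.+1).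

Definition evT c (t : R) : C := evC c (expi t).

Definition trig c n (t : R) : C :=
  \sum_(k < n) c k%:Z * expi (k%:~R * t) +
  \sum_(k < n) c (- (k.+1)%:Z) * expi ((- (k.+1)%:Z)%:~R * t).

Definition nZ c : \bar R := (\esum_(k in [set: int]) (cabs (c k))%:E)%E.

Lemma nZ_summable c : (nZ c < +oo)%E ->
  Defs.summable (fun k => cabs (c k%:Z)) /\ Defs.summable (fun k => cabs (c (- (k.+1)%:Z))).
Proof.
rewrite /nZ esum_intE => [h|k]; last by rewrite lee_fin cabs_ge0.
have p0 (u : nat -> C) : (0 <= \esum_(n in [set: nat]) (cabs (u n))%:E)%E.
  by apply: esum_ge0 => n _; rewrite lee_fin cabs_ge0.
split; apply/summableP => [n|]; rewrite ?cabs_ge0//; apply: le_lt_trans h.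
- by rewrite leeDl.
- by rewrite leeDr.
Qed.

Lemma summable_nZ c :
  Defs.summable (fun k => cabs (c k%:Z)) -> Defs.summable (fun k => cabs (c (- (k.+1)%:Z))) ->
  (nZ c < +oo)%E.
Proof.
move=> /summableP h1 /summableP h2; rewrite /nZ esum_intE => [|k]; last by rewrite lee_fin cabs_ge0.
by apply: lte_add_pinfty; [apply: h1|apply: h2] => n; rewrite cabs_ge0.
Qed.

Lemma contC_trig c n : contC (trig c n).
Proof.
by apply: contCD; apply: contC_sum => k; apply: contCM; [exact: contC_cst|exact: contC_expiM|
  exact: contC_cst|exact: contC_expiM].
Qed.

Lemma fcoef_trig c n k : (`|k| < n)%N -> fcoefth (trig c n) k = c k.
Proof.
move=> kn; rewrite /trig fcoefD; try by apply: contC_sum => i;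
  apply: contCM; [exact: contC_cst|exact: contC_expiM].
rewrite !fcoef_sum; try by move=> i; apply: contCM; [exact: contC_cst|exact: contC_expiM].
have E (m : int) : fcoefth (fun t => c m * expi (m%:~R * t)) k = c m * (k == m)%:R.
  by rewrite fcoefZ ?fcoef_expi//; exact: contC_expiM.
rewrite (eq_bigr (fun i : 'I_n => c i%:Z * (k == i%:Z)%:R)); last by move=> i _; exact: E.
rewrite [X in _ + X](eq_bigr (fun i : 'I_n => c (- i.+1%:Z) * (k == - i.+1%:Z)%:R)); last by move=> i _; exact: E.
have D (a b : int) : a <> b -> c b * (a == b)%:R = 0 by move=> /eqP/negbTE ->; rewrite mulr0.
case: k kn {E} => m mn.
- rewrite [X in _ + X]big1 ?addr0 => [|i _]; last by apply: D; lia.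
  rewrite (bigD1 (Ordinal mn))// big1 => [|i /= im]; first by rewrite eqxx mulr1; exact: addr0.
  apply: D => h; move/eqP: im; apply; apply: val_inj => /=; lia.
- rewrite big1 ?add0r => [|i _]; last by apply: D; lia.
  have mn' : (m < n)%N by lia.
  rewrite (bigD1 (Ordinal mn'))// big1 => [|i /= im]; first by rewrite NegzE eqxx mulr1; exact: addr0.
  apply: D => h; move/eqP: im; apply; apply: val_inj => /=; lia.
Qed.

Lemma evT_tail c : (nZ c < +oo)%E -> exists e : nat -> R,
  (e @ \oo --> 0) /\ forall n t, cabs (evT c t - trig c n t) <= e n.
Proof.
move=> /nZ_summable [h1 h2].
set x1 := (fun k : nat => cabs (c k)) in h1; set x2 := (fun k : nat => _) in h2.
exists (fun n => 2 * (limn (series x1) - series x1 n) + 2 * (limn (series x2) - series x2 n)); split.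
  have tl (x : nat -> R) : cvgn (series x) -> (fun n => 2 * (limn (series x) - series x n)) @ \oo --> 0.
    move=> cx; have : (fun n => 2 * (limn (series x) - series x n)) @ \oo --> 2 * (limn (series x) - limn (series x)).
      by apply: cvgM; [exact: cvg_cst|apply: cvgB => //; exact: cvg_cst].
    by rewrite subrr mulr0.
  suff : (fun n => 2 * (limn (series x1) - series x1 n) + 2 * (limn (series x2) - series x2 n)) @ \oo --> (0 + 0 : R).
    by rewrite addr0.
  by apply: cvgD; exact: tl.
move=> n t; rewrite /evT /evC /trig.
set s1 := csum _; set s2 := csum _.
have -> (u v : C) : s1 + s2 - (u + v) = (s1 - u) + (s2 - v) by ring.
rewrite (le_trans (cabsD _ _))// lerD//.
- have := @csum_tail R (fun k => c k%:Z * expi t ^+ k) x1 n _ h1.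
  under eq_bigr do rewrite -expiX.
  by apply => k; rewrite cabsM cabsX cabs_expi expr1n mulr1.
- have := @csum_tail R (fun k => c (- k.+1%:Z) * expi t ^- k.+1) x2 n _ h2.
  under eq_bigr do rewrite -expiX -expiN -mulNr -[k in k%:R]/(_.+1) pmulrn -mulrNz.
  by apply => k; rewrite cabsM cabsV cabsX cabs_expi expr1n invr1 mulr1.
Qed.

Lemma contC_evT c : (nZ c < +oo)%E -> contC (evT c).
Proof.
move=> /evT_tail [e [e0 he]]; apply: contC_unif => d d0.
have /cvgrPdist_lt/(_ d d0) [n _ /(_ n (leqnn n))/=] := e0.
rewrite sub0r normrN => /ltW h; exists (trig c n); first exact: contC_trig.
by move=> t; rewrite (le_trans (he n t))// (le_trans (ler_norm _)).
Qed.

Lemma per_evT c : per2pi (evT c).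
Proof. by move=> t; rewrite /evT expi_periodic. Qed.

Lemma fcoef_lim_unique f (z : C) k (e : nat -> R) (g : nat -> R -> C) : contC f ->
  (forall n, contC (g n)) -> e @ \oo --> 0 -> (forall n t, cabs (f t - g n t) <= e n) ->
  (\forall n \near \oo, fcoefth (g n) k = z) -> fcoefth f k = z.
Proof.
move=> cf cg e0 fg gz; apply/eqP; rewrite -subr_eq0; apply/eqP/cabs_eq0/eqP.
rewrite eq_le cabs_ge0 andbT; apply/ler_addgt0Pl => d d0; rewrite addr0.
have /cvgrPdist_lt/(_ (d / 2)) := e0; rewrite divr_gt0// => /(_ isT) he.
have [n _ /(_ n (leqnn n)) [/=]] := filterI he gz.
rewrite sub0r normrN => h1 <-; rewrite -fcoefB//.
rewrite (le_trans (fcoef_bound (B := e n) _ _ _))//; first exact: contCB.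
by have := ler_norm (e n); lra.
Qed.

Lemma fcoef_evT c k : (nZ c < +oo)%E -> fcoefth (evT c) k = c k.
Proof.
move=> h; have [e [e0 he]] := evT_tail h.
apply: (fcoef_lim_unique (contC_evT h) (contC_trig c) e0 he).
by exists (`|k|.+1)%N => // n /= kn; exact: fcoef_trig.
Qed.

Definition nW h : \bar R := nZ (fcoefth h).

(** Continuity and periodicity are included because the coefficients alone determine a function only
    almost everywhere on one period. *)
Definition Wf h := [/\ contC h, per2pi h & (nW h < +oo)%E].

Lemma Wf_evT c : (nZ c < +oo)%E -> Wf (evT c).
Proof.
move=> h; split; [exact: contC_evT|exact: per_evT|rewrite /nW (_ : fcoefth _ = c)//].
by apply/funext => k; exact: fcoef_evT.
Qed.

Lemma per2piB f g : per2pi f -> per2pi g -> per2pi (fun t => f t - g t).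
Proof. by move=> pf pg t; rewrite pf pg. Qed.

Lemma Wf_repr h : Wf h -> h = evT (fcoefth h).
Proof.
move=> [ch ph nh]; apply/funext => t; apply/eqP; rewrite -subr_eq0; apply/eqP.
apply: (@fcoef_unique _ (fun t => h t - evT (fcoefth h) t)).
- by apply: contCB => //; exact: contC_evT.
- exact: per2piB ph (@per_evT _).
- by move=> k; rewrite fcoefB//; [rewrite fcoef_evT// subrr|exact: contC_evT].
Qed.

Lemma Tcirc_expi (z : C) : Tcirc z -> exists t, z = expi t.
Proof.
rewrite /Tcirc /= => z1; have := sqr_cabs z; rewrite z1 expr1n => /esym ab.
case: z z1 ab => a b /= z1 ab.
have a1 : -1 <= a <= 1 by apply/andP; split; nra.
have sb : Num.sqrt (1 - a ^+ 2) = `|b| by rewrite -ab addrC addKr sqrtr_sqr.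
have [b0|b0] := ger0P b.
- exists (acos a); rewrite /expi acosK// ?sin_acos// ?sb ?ger0_norm//.
- exists (- acos a); rewrite /expi cosN sinN acosK ?sin_acos// ?sb ?ltr0_norm// opprK//.
Qed.

Lemma inW_Wf (F : C -> C) : inW F <-> Wf (F \o @expi R).
Proof.
split=> [[c [c1 [c2 cF]]]|WF].
- rewrite (_ : F \o _ = evT c); last first.
    by apply/funext => t /=; rewrite cF//= /Tcirc /= cabs_expi.
  exact/Wf_evT/summable_nZ.
- have [c1 c2] := nZ_summable (let: And3 _ _ h := WF in h).
  exists (fcoefth (F \o @expi R)); split => //; split => // z /Tcirc_expi[t ->].
  by have /(congr1 (fun f => f t)) := Wf_repr WF.
Qed.

End Wiener.

(** * Coefficients of products *)

Section Convolution.
Variable R : realType.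
Local Notation C := R[i].
Implicit Types (f g h : R -> C) (x y z : int -> R).

Definition nonneg (T : Type) (x : T -> R) := forall k, 0 <= x k.

Definition convol x y (k : int) : \bar R := (\esum_(j in [set: int]) (x j * y (k - j))%:E)%E.

Lemma esum_conv_le x y (X Y : R) : nonneg x -> nonneg y ->
  (\esum_(k in [set: int]) (x k)%:E <= X%:E)%E ->
  (\esum_(k in [set: int]) (y k)%:E <= Y%:E)%E ->
  (\esum_(k in [set: int]) convol x y k <= (X * Y)%:E)%E.
Proof.
move=> x0 y0 hX hY; rewrite /convol esum_swap; last by move=> i j; rewrite lee_fin mulr_ge0.
have Y0 : 0 <= Y by rewrite -lee_fin (le_trans _ hY)//; apply: esum_ge0 => k _; rewrite lee_fin.
apply: (@le_trans _ _ (\esum_(j in [set: int]) (Y%:E * (x j)%:E))%E).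
  apply: le_esum => j _.
  under eq_esum do rewrite EFinM.
  have py k : (0 <= (y (k - j))%:E)%E by rewrite lee_fin.
  rewrite muleC; apply: (le_trans (le_esumZ (x0 j) py)).
  rewrite lee_wpmul2l ?lee_fin//.
  rewrite -(@esum_reindex_bij _ _ _ (fun k => k - j) (fun k => (y k)%:E))//.
  by exists (fun k => k + j) => k; rewrite ?subrK ?addrK.
have px k : (0 <= (x k)%:E)%E by rewrite lee_fin.
apply: (le_trans (le_esumZ Y0 px)).
have -> : (X * Y)%:E = (Y%:E * X%:E)%E by rewrite mulrC EFinM.
by apply: lee_wpmul2l => //; rewrite lee_fin.
Qed.

Lemma conv_opp x y k : convol (fun k => x (- k)) (fun k => y (- k)) k = convol x y (- k).
Proof.
rewrite /convol (@esum_reindex_bij _ _ _ (fun j : int => - j)); last by exists (fun j => - j) => j; rewrite opprK.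
by apply: eq_esum => j _; rewrite !opprK opprD.
Qed.

Lemma esum_opp (x : int -> \bar R) :
  (\esum_(k in [set: int]) x (- k)%R = \esum_(k in [set: int]) x k)%E.
Proof. by rewrite [RHS](@esum_reindex_bij _ _ _ (fun j : int => - j))//; exists (fun j => - j) => j; rewrite opprK. Qed.

(** There is something to prove only when the right side S is finite. With [f] replaced by a Fejér
    mean, the coefficient becomes an average over l of sums over j; for fixed l the indices j - l
    are distinct, so each inner sum is at most S. Uniform convergence of the means does the rest. *)
Lemma fcoef_conv f g k : contC f -> per2pi f -> contC g -> per2pi g ->
  ((cabs (fcoefth (fun t => f t * g t) k))%:E <=
   convol (fun j => cabs (fcoefth f j)) (fun j => cabs (fcoefth g j)) k)%E.
Proof.
move=> cf pf cg pg; set S := convol _ _ k.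
have p0 j : 0 <= cabs (fcoefth f j) * cabs (fcoefth g (k - j)) by rewrite mulr_ge0 ?cabs_ge0.
have S0 : (0 <= S)%E by apply: esum_ge0 => j _; rewrite lee_fin.
have [Soo|] := ltP S +oo%E; last by move=> /(le_trans _); apply; exact: leey.
have [B B0 SB] := esum_le_real (fun j => p0 j : (0 <= (_ : R)%:E)%E) Soo.
rewrite -(@fineK _ S) ?ge0_fin_numE// lee_fin.
have {B B0 SB} hB (s : seq int) : uniq s -> \sum_(j <- s) cabs (fcoefth f j) * cabs (fcoefth g (k - j)) <= fine S.
  move=> us; rewrite -lee_fin fineK ?ge0_fin_numE// -sumEFin.
  by apply: le_esum_sum => // j; rewrite lee_fin.
have [G hG] := per_boundedC cg pg.
have G0 : 0 <= G by exact: le_trans (cabs_ge0 _) (hG 0).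
have cfj n : contC (fejer n f).
  apply: contCM; first exact: contC_cst.
  by apply: contC_sum => j; apply: contC_sum => l; apply: contCM; [exact: contC_cst|exact: contC_expiM].
have fb n : cabs (fcoefth (fun t => fejer n f t * g t) k) <= fine S.
  rewrite (_ : (fun t => _) = fun t => rc n.+1%:R^-1 * \sum_(j < n.+1) \sum_(l < n.+1)
     (fcoefth f (j%:Z - l%:Z) * (g t * expi ((j%:Z - l%:Z)%:~R * t)))); last first.
    apply/funext => t; rewrite /fejer -mulrA; congr (_ * _); rewrite mulr_suml.
    apply: eq_bigr => j _; rewrite mulr_suml; apply: eq_bigr => l _.
    by rewrite -!mulrA (mulrC (g t)).
  have c1 (m : int) : contC (fun t => g t * expi (m%:~R * t)).
    by apply: contCM => //; exact: contC_expiM.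
  have c2 (m : int) : contC (fun t => fcoefth f m * (g t * expi (m%:~R * t))).
    by apply: contCM => //; exact: contC_cst.
  have c3 (j : 'I_n.+1) : contC (fun t => \sum_(l < n.+1) (fcoefth f (j%:Z - l%:Z) * (g t * expi ((j%:Z -
      l%:Z)%:~R * t)))).
    by apply: contC_sum => l; exact: c2.
  rewrite fcoefZ; last exact: contC_sum.
  rewrite cabsM cabs_rc ger0_norm ?invr_ge0// ler_pdivrMl// fcoef_sum//.
  rewrite (@le_trans _ _ (\sum_(l < n.+1) \sum_(j < n.+1)
     cabs (fcoefth f (j%:Z - l%:Z)) * cabs (fcoefth g (k - (j%:Z - l%:Z)))))//.
    rewrite exchange_big /= (le_trans (cabs_sum _ _ _))//; apply: ler_sum => j _.
    rewrite fcoef_sum// (le_trans (cabs_sum _ _ _))//; apply: ler_sum => l _.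
    by rewrite fcoefZ// fcoef_shift cabsM.
  rewrite (@le_trans _ _ (\sum_(l < n.+1) fine S))//; last by rewrite sumr_const card_ord mulr_natl.
  apply: ler_sum => l _.
  have := hB [seq (j%:Z - l%:Z) | j : 'I_n.+1]; rewrite big_map big_enum; apply.
  by rewrite map_inj_uniq ?enum_uniq// => i j /= h; apply: val_inj => /=; lia.
apply/ler_addgt0Pl => e e0.
(* Chosen so that 2 d (G + 1) = e, the 2 being that of [fcoef_bound]; the added 1 covers G = 0. *)
pose d := e / (2 * (G + 1)); have d0 : 0 < d by rewrite divr_gt0// mulr_gt0// ltr_wpDl.
have [n _ /(_ n (leqnn n)) hn] := fejer_cvg cf pf d0.
have -> : fcoefth (fun t => f t * g t) k = fcoefth (fun t => (f t - fejer n f t) * g t) k + fcoefth (fun t =>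
    fejer n f t * g t) k.
  rewrite -fcoefD; [|apply: contCM => //; exact: contCB|exact: contCM].
  by congr (fcoefth _ k); apply/funext => t; ring.
rewrite (le_trans (cabsD _ _))// lerD//.
apply: (@le_trans _ _ (2 * (d * G))).
  apply: fcoef_bound; first by apply: contCM => //; exact: contCB.
  by move=> t; rewrite cabsM ler_pM ?cabs_ge0.
have hd : 2 * (d * (G + 1)) = e by rewrite /d; field; apply: lt0r_neq0; rewrite ltr_wpDl.
by rewrite -hd ler_pM2l// ler_pM2l// lerDl.
Qed.

Lemma nW_mul f g (F G : R) : contC f -> per2pi f -> contC g -> per2pi g ->
  (nW f <= F%:E)%E -> (nW g <= G%:E)%E -> (nW (fun t => f t * g t)%R <= (F * G)%:E)%E.
Proof.
move=> cf pf cg pg hF hG; apply: le_trans (esum_conv_le _ _ hF hG); try by move=> k; exact: cabs_ge0.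
by apply: le_esum => k _; exact: fcoef_conv.
Qed.

End Convolution.

(** * Weighted Orlicz balls *)

Section YoungFunctions.
Variable R : realType.

(** The third clause says that [p] is a subgradient of [F], i.e. that [F] is convex. *)
Definition young_fun (F : R -> R) := exists p : R -> R,
  [/\ forall z, 0 <= z -> 0 <= p z,
      F 0 = 0,
      forall y z, 0 <= y -> 0 <= z -> F z + p z * (y - z) <= F y,
      forall z, 0 < z -> 0 < F z &
      exists K x0, 0 < x0 /\ forall x, 0 <= x <= x0 -> F (2 * x) <= K * F x].

Variable F : R -> R.
Hypothesis yF : young_fun F.

Lemma young0 : F 0 = 0. Proof. by have [p []] := yF. Qed.

Lemma young_ge0 z : 0 <= z -> 0 <= F z.
Proof.
have [p [_ F0 _ Fp _]] := yF.
by rewrite le_eqVlt => /predU1P[<-|/Fp/ltW//]; rewrite F0.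
Qed.

Lemma young_mono x y : 0 <= x -> x <= y -> F x <= F y.
Proof.
have [p [p0 _ Fs _ _]] := yF => x0 xy.
have := Fs y x (le_trans x0 xy) x0; apply: le_trans.
by rewrite lerDl mulr_ge0 ?p0// subr_ge0.
Qed.

(** The supporting line at z is averaged. Total mass at most 1 suffices because the missing mass can
    be placed at 0, where F vanishes: the subgradient inequality at 0 says p z * z >= F z. *)
Lemma jensen_seq (T : Type) (s : seq T) (w t : T -> R) z : nonneg w -> nonneg t ->
  0 <= z -> \sum_(i <- s) w i <= 1 -> z <= \sum_(i <- s) w i * t i ->
  F z <= \sum_(i <- s) w i * F (t i).
Proof.
have [p [p0 F0 Fs _ _]] := yF => w0 t0 z0 w1 zt.
apply: (@le_trans _ _ (\sum_(i <- s) w i * (F z + p z * (t i - z)))); last first.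
  by apply: ler_sum => i _; rewrite ler_wpM2l// Fs.
have -> : \sum_(i <- s) w i * (F z + p z * (t i - z)) =
    F z * (\sum_(i <- s) w i) + p z * (\sum_(i <- s) w i * t i) - p z * z * \sum_(i <- s) w i.
  rewrite !mulr_sumr -big_split /= -sumrB; apply: eq_bigr => i _; ring.
set W := \sum_(i <- s) w i in w1 *; set T1 := \sum_(i <- s) w i * t i in zt *.
have h1 := Fs 0 z (lexx _) z0; rewrite F0 in h1.
have h2 := ler_wpM2l (p0 _ z0) zt.
have h3 : (p z * z - F z) * W <= (p z * z - F z) * 1 by apply: ler_wpM2l => //; lra.
lra.
Qed.

(* the factor 2 spares a continuity argument when passing to infinite sums *)
Lemma jensen_esum (T : choiceType) (w t : T -> R) z : nonneg w -> nonneg t ->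
  0 <= z -> (\esum_(i in [set: T]) (w i)%:E <= 1)%E ->
  (z%:E <= \esum_(i in [set: T]) (w i * t i)%:E)%E ->
  ((F (z / 2))%:E <= \esum_(i in [set: T]) (w i * F (t i))%:E)%E.
Proof.
move=> w0 t0 z0 w1 zt.
have wF i : (0 <= (w i * F (t i))%:E)%E by rewrite lee_fin mulr_ge0// young_ge0.
move: z0; rewrite le_eqVlt => /predU1P[<-|zp].
  by rewrite mul0r young0; apply: esum_ge0.
have : ((z / 2)%:E < \esum_(i in [set: T]) (w i * t i)%:E)%E.
  by apply: lt_le_trans zt; rewrite lte_fin ltr_pdivrMr// ltr_pMr// ltr1n.
move=> /ereal_sup_gt [_ [X [finX _] <-]].
rewrite fsbig_finite//= sumEFin lte_fin => /ltW h.
apply: (@le_trans _ _ (\sum_(i <- fset_set X) (w i * F (t i)))%:E); last first.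
  by rewrite -sumEFin; apply: le_esum_sum => //; exact: fset_uniq.
rewrite lee_fin; apply: jensen_seq => //; first by rewrite divr_ge0// ltW.
rewrite -lee_fin -sumEFin; apply: le_trans w1.
by apply: le_esum_sum; [exact: fset_uniq|move=> i; rewrite lee_fin].
Qed.

Lemma young_scale z r : 0 <= z -> 1 <= r -> F (z / r) <= F z / r.
Proof.
move=> z0 r1; have r0 : 0 < r by exact: lt_le_trans r1.
have := @jensen_seq unit [:: tt] (fun=> r^-1) (fun=> z) (z / r).
rewrite !big_seq1 mulrC [_ * F _]mulrC; apply => //.
- by move=> _; rewrite invr_ge0 ltW.
- by rewrite mulr_ge0// invr_ge0 ltW.
- by rewrite invf_le1.
Qed.

(** The doubling condition is local at 0. Iterating it handles the arguments up to x0 / 2^n; on the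
    remaining compact range F is bounded below by its value at that point, and a quotient of values
    of F serves as constant. *)
Lemma young_double (B r : R) : 0 <= B -> 0 < r -> exists2 K, 0 <= K & forall x, 0 <= x <= B -> F (r * x) <= K * F x.
Proof.
move=> B0 r0; have [p [p0 F0 Fs Fp [K [x0 [x00 HK]]]]] := yF.
have D2 : exists2 K2, 0 <= K2 & forall n x, 0 <= x -> 2 ^+ n * x <= x0 -> F (2 ^+ n * x) <= K2 ^+ n * F x.
  exists (Num.max 0 K); first by rewrite le_max lexx.
  elim=> [|n IH] x xp; first by rewrite !expr0 !mul1r.
  rewrite !exprS -!mulrA => hx.
  have y0 : 0 <= 2 ^+ n * x by rewrite mulr_ge0// exprn_ge0.
  rewrite (le_trans (HK _ _))//; first by rewrite y0 /=; lra.
  apply: (@le_trans _ _ (Num.max 0 K * F (2 ^+ n * x))).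
    by rewrite ler_wpM2r ?young_ge0// le_max lexx orbT.
  by rewrite ler_wpM2l ?IH// ?le_max ?lexx//; lra.
have [n hn] : exists n, r <= 2 ^+ n :> R.
  have [N _ /(_ N (leqnn N)) hN] := nbhs_infty_ger r; exists N; apply: (le_trans hN).
  by rewrite -natrX ler_nat ltnW// ltn_expl.
have [K2 K20 HK2] := D2; pose x1 := x0 / 2 ^+ n.
have n0 : 0 < 2 ^+ n :> R by rewrite exprn_gt0.
have x1p : 0 < x1 by rewrite divr_gt0.
exists (Num.max (K2 ^+ n) (F (r * B) / F x1)); first by rewrite le_max exprn_ge0.
move=> x /andP[xp xB]; have [xx|xx] := lerP x x1.
  apply: (@le_trans _ _ (F (2 ^+ n * x))).
    by apply: young_mono; rewrite ?mulr_ge0 ?(ltW r0)// ler_wpM2r.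
  rewrite (le_trans (HK2 _ _ xp _))//.
    by move: xx; rewrite /x1 ler_pdivlMr// mulrC.
  by rewrite ler_wpM2r ?young_ge0// le_max lexx.
apply: (@le_trans _ _ (F (r * B))).
  by apply: young_mono; rewrite ?mulr_ge0 ?(ltW r0)// ler_wpM2l// ltW.
apply: (@le_trans _ _ (F (r * B) / F x1 * F x)); last first.
  by rewrite ler_wpM2r ?young_ge0// le_max lexx orbT.
rewrite -mulrA ler_peMr ?young_ge0 ?mulr_ge0 ?(ltW r0)// mulrC ler_pdivlMr ?Fp// mul1r.
by apply: young_mono; rewrite ltW.
Qed.

End YoungFunctions.

Section Weights.
Variable R : realType.
Variable nu : nat -> R.
Hypothesis wnu : weight nu.

Lemma weight_gt0 k : 0 < nu k. Proof. by have [_ []] := wnu. Qed.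
Lemma weight_ge0 k : 0 <= nu k. Proof. exact/ltW/weight_gt0. Qed.

Lemma weight_mono k l : (k <= l)%N -> nu k <= nu l.
Proof.
have [_ [_ [h _]]] := wnu.
by move=> /subnK <-; elim: (l - k)%N => // n IH; exact: le_trans IH (h _).
Qed.

Lemma weight_ge1 k : 1 <= nu k.
Proof. by have [<- _] := wnu; exact: weight_mono. Qed.

(** The form of doubling suited to convolutions: in an index sum k = i + j the larger summand is at
    least k/2. *)
Definition dbl (D : R) := 1 <= D /\ forall k l, (k <= 2 * l)%N -> nu k <= D * nu l.

(** Every larger constant works as well, which lets two weights share one. *)
Lemma weight_dbl : exists D0, forall D, D0 <= D -> dbl D.
Proof.
have [n0 [_ [_ [Cn hC]]]] := wnu.
exists (Num.max 1 Cn) => D; rewrite ge_max => /andP[D1 DC]; split => // k [|l] kl.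
  have -> : k = 0%N by lia.
  by rewrite n0 mulr1.
apply: le_trans (weight_mono kl) _; apply: le_trans (hC l.+1 isT) _.
by rewrite ler_wpM2r ?weight_ge0.
Qed.

End Weights.

(** * Luxemburg balls under convolution and countable sums *)

Section Balls.
Variable R : realType.
Variables (F : R -> R) (nu : nat -> R).
Hypotheses (yF : young_fun F) (wnu : weight nu).
Implicit Types (x y z : int -> R) (l m : R).

(** [pball l x] says that the Luxemburg norm of the weighted sequence [x k * nu k], [k >= 0], is at most [l]. *)
Definition pball l x :=
  (\esum_(k in [set: nat]) (F (x k%:Z * nu k / l))%:E <= 1)%E.

Let arg_ge0 x l k : nonneg x -> 0 < l -> 0 <= x k%:Z * nu k / l.
Proof. by move=> x0 l0; apply: divr_ge0; [apply: mulr_ge0 => //; exact: weight_ge0|exact: ltW]. Qed.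

Lemma pball_le l m x y : nonneg x -> nonneg y -> 0 < l -> l <= m -> (forall k, x k <= y k) ->
  pball l y -> pball m x.
Proof.
move=> x0 y0 l0 lm xy; apply: le_trans; apply: le_esum => k _; rewrite lee_fin.
have m0 := lt_le_trans l0 lm.
apply: young_mono => //; first exact: arg_ge0.
apply: ler_pM.
- by apply: mulr_ge0 => //; exact: weight_ge0.
- by rewrite invr_ge0 ltW.
- by apply: ler_wpM2r => //; exact: weight_ge0.
- by rewrite lef_pV2 ?posrE.
Qed.

Definition possup x (k : int) := if k is Posz n then x k * nu n else 0.

Lemma possup_ge0 x : nonneg x -> nonneg (possup x).
Proof. by move=> x0 [n|n] //=; rewrite mulr_ge0// weight_ge0. Qed.

Lemma esum_possup x l : nonneg x -> 0 < l ->
  (\esum_(k in [set: int]) (F (possup x k / l))%:E =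
   \esum_(k in [set: nat]) (F (x k%:Z * nu k / l))%:E)%E.
Proof.
move=> x0 l0; rewrite esum_intE => [|k]; last first.
  by rewrite lee_fin; apply: young_ge0 => //; rewrite divr_ge0 ?possup_ge0// ltW.
rewrite [X in (_ + X)%E]esum1 ?adde0// => n _.
by rewrite -NegzE /= mul0r young0.
Qed.

Lemma esum_boolE (T : choiceType) (a : bool * T -> \bar R) : (forall i, 0 <= a i)%E ->
  (\esum_(i in [set: bool * T]) a i =
   \esum_(j in [set: T]) a (true, j) + \esum_(j in [set: T]) a (false, j))%E.
Proof.
move=> a0; rewrite (esumID (range (pair true)))// !setTI; congr (_ + _)%E.
  by rewrite esum_image// => x y _ _ [].
rewrite -(esum_image [set: T] (pair false)); last by move=> x y _ _ [].
congr esum; apply/seteqP; split => [[b j] /= h|_ [j _ <-] [i _]//].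
by case: b h => h; [exfalso; apply: h; exists j|exists j].
Qed.

(** Doubling moves the weight of index k onto the larger of j and k - j, so the weighted z is at
    most D times two convolutions in which only one factor is weighted. After normalization these
    form an average of total mass at most (l Y + m X)/L = 1 of the weighted entries of x and y, to
    which Jensen and an interchange of sums apply. The 2 is that of [jensen_esum]. *)
Lemma pball_conv D l m (X Y : R) x y z : dbl nu D -> 0 < l -> 0 < m -> 0 < X -> 0 < Y ->
  nonneg x -> nonneg y -> nonneg z ->
  (\esum_(k in [set: int]) (x k)%:E <= X%:E)%E ->
  (\esum_(k in [set: int]) (y k)%:E <= Y%:E)%E ->
  (forall k, ((z k)%:E <= convol x y k)%E) ->
  pball l x -> pball m y -> pball (2 * D * (l * Y + m * X)) z.
Proof.
move=> [D1 hD] l0 m0 X0 Y0 x0 y0 z0 hX hY zxy bx by_.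
pose L := l * Y + m * X; have L0 : 0 < L by rewrite addr_gt0 ?mulr_gt0.
have D0 : 0 < D by exact: lt_le_trans D1.
rewrite /pball -/L.
(* The tag [true] marks the sum where x carries the weight and y serves as averaging mass, [false]
   the opposite one. *)
pose w (k : int) (i : bool * int) := if i.1 then l * y (k - i.2) / L else m * x i.2 / L.
pose t (k : int) (i : bool * int) := if i.1 then possup x i.2 / l else possup y (k - i.2) / m.
have px := possup_ge0 x0; have py := possup_ge0 y0.
have w0 k i : 0 <= w k i by rewrite /w; case: ifP => _; rewrite divr_ge0 ?mulr_ge0// ltW.
have t0 k i : 0 <= t k i by rewrite /t; case: ifP => _; rewrite divr_ge0// ltW.
have wF k i : (0 <= (w k i * F (t k i))%:E)%E by rewrite lee_fin mulr_ge0// young_ge0.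
apply: (@le_trans _ _ (\esum_(k in [set: nat]) \esum_(i in [set: bool * int]) (w k%:Z i * F (t k%:Z i))%:E)%E).
  apply: le_esum => k _.
  have -> : z k%:Z * nu k / (2 * D * L) = (z k%:Z * nu k / (D * L)) / 2.
    by field; rewrite ?gt_eqF.
  apply: jensen_esum => //.
  - by apply: divr_ge0; [apply: mulr_ge0 => //; exact: weight_ge0|rewrite ltW// mulr_gt0].
  - rewrite esum_boolE; last by move=> i; rewrite lee_fin.
    rewrite /w /=.
    have -> : 1%E = (l * Y / L + m * X / L)%:E :> \bar R by rewrite -mulrDl divff// gt_eqF.
    rewrite EFinD; apply: leeD.
      under eq_esum do rewrite mulrAC EFinM.
      have py' j : (0 <= (y (k%:Z - j))%:E)%E by rewrite lee_fin.
      have lL : 0 <= l / L by rewrite divr_ge0// ltW.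
      apply: le_trans (le_esumZ lL py') _.
      have -> : (l * Y / L)%:E = ((l / L)%:E * Y%:E)%E by rewrite -EFinM mulrAC.
      apply: lee_wpmul2l; first by rewrite lee_fin.
      rewrite -(@esum_reindex_bij _ _ _ (fun j => k%:Z - j) (fun k => (y k)%:E))//.
      by exists (fun j => k%:Z - j) => j; ring.
    under eq_esum do rewrite mulrAC EFinM.
    have px' j : (0 <= (x j)%:E)%E by rewrite lee_fin.
    have lL : 0 <= m / L by rewrite divr_ge0// ltW.
    apply: le_trans (le_esumZ lL px') _.
    have -> : (m * X / L)%:E = ((m / L)%:E * X%:E)%E by rewrite -EFinM mulrAC.
    by apply: lee_wpmul2l; rewrite ?lee_fin.
  - rewrite esum_boolE; last by move=> i; rewrite lee_fin mulr_ge0.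
    rewrite -esumD; try by move=> i _; rewrite lee_fin mulr_ge0.
    have c0 : 0 <= nu k / (D * L) by apply: divr_ge0; [exact: weight_ge0|rewrite ltW// mulr_gt0].
    have cv0 j : (0 <= (x j * y (k%:Z - j))%:E)%E by rewrite lee_fin mulr_ge0.
    rewrite -mulrA mulrC EFinM.
    apply: (@le_trans _ _ ((nu k / (D * L))%:E * convol x y k%:Z)%E); first by apply: lee_wpmul2l; rewrite ?lee_fin.
    rewrite /convol -esumZ//; apply: le_esum => j _; rewrite -EFinM -EFinD lee_fin.
    rewrite /w /t /=.
    have -> : l * y (k%:Z - j) / L * (possup x j / l) + m * x j / L * (possup y (k%:Z - j) / m) =
      (possup x j * y (k%:Z - j) + x j * possup y (k%:Z - j)) / L by field; rewrite ?gt_eqF.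
    have -> : nu k / (D * L) * (x j * y (k%:Z - j)) = (x j * y (k%:Z - j) * nu k / D) / L.
      by field; rewrite ?gt_eqF.
    rewrite ler_pM2r ?invr_gt0// ler_pdivrMr//.
    (* Whichever of j and k - j is at least k/2 is also non-negative, so the doubling inequality
       applies to it. *)
    have [kj|kj] := leP k%:Z (j + j).
      case: j kj => [j|j] kj; last by exfalso; clear -kj; lia.
      rewrite (@le_trans _ _ (possup x j * y (k%:Z - Posz j) * D))//; last first.
        by rewrite ler_pM2r// lerDl mulr_ge0.
      rewrite /=; have := y0 (k%:Z - Posz j); set a := y _ => a0.
      rewrite (_ : x j * nu j * a * D = x j * a * (D * nu j)); last by ring.
      by apply: ler_wpM2l; [exact: mulr_ge0|apply: hD; clear -kj; lia].
    rewrite (@le_trans _ _ (x j * possup y (k%:Z - j) * D))//; last first.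
      by rewrite ler_pM2r// lerDr mulr_ge0.
    case ki: (k%:Z - j) => [i|i]; last by exfalso; clear -ki kj; lia.
    rewrite /= (_ : x j * (y i * nu i) * D = x j * y i * (D * nu i)); last by ring.
    by apply: ler_wpM2l; [exact: mulr_ge0|apply: hD; clear -ki kj; lia].
apply: (@le_trans _ _ (\esum_(k in [set: int]) \esum_(i in [set: bool * int]) (w k i * F (t k i))%:E)%E).
  rewrite [leRHS]esum_intE => [|k]; last exact: esum_ge0.
  by rewrite leeDl// esum_ge0// => n _; exact: esum_ge0.
have -> : 1%E = (l * Y / L + m * X / L)%:E :> \bar R by rewrite -mulrDl divff// gt_eqF.
under eq_esum do rewrite esum_boolE//.
rewrite esumD; try by move=> i _; exact: esum_ge0.
rewrite EFinD /w /t /=.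
have Fx : (\esum_(k in [set: int]) (l / L * F (possup x k / l))%:E <= (l / L)%:E)%E.
  have p0 k : (0 <= (F (possup x k / l))%:E)%E by rewrite lee_fin young_ge0// divr_ge0// ltW.
  have lL : 0 <= l / L by rewrite divr_ge0// ltW.
  under eq_esum do rewrite EFinM.
  apply: le_trans (le_esumZ lL p0) _.
  by rewrite esum_possup// -[leRHS]mule1; apply: lee_wpmul2l; rewrite ?lee_fin.
have Fy : (\esum_(k in [set: int]) (m / L * F (possup y k / m))%:E <= (m / L)%:E)%E.
  have p0 k : (0 <= (F (possup y k / m))%:E)%E by rewrite lee_fin young_ge0// divr_ge0// ltW.
  have lL : 0 <= m / L by rewrite divr_ge0// ltW.
  under eq_esum do rewrite EFinM.
  apply: le_trans (le_esumZ lL p0) _.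
  by rewrite esum_possup// -[leRHS]mule1; apply: lee_wpmul2l; rewrite ?lee_fin.
have pd (u v : R) : 0 <= u -> 0 < v -> 0 <= u / v by move=> u0 v0; rewrite divr_ge0// ltW.
have nFx : nonneg (fun k => l / L * F (possup x k / l)).
  by move=> k; apply: mulr_ge0; [apply: pd => //; exact: ltW|apply: young_ge0 => //; exact: pd].
have nFy : nonneg (fun k => m / L * F (possup y k / m)).
  by move=> k; apply: mulr_ge0; [apply: pd => //; exact: ltW|apply: young_ge0 => //; exact: pd].
apply: leeD.
- have -> : l * Y / L = l / L * Y by ring.
  apply: le_trans (esum_conv_le nFx y0 Fx hY).
  apply: le_esum => k _; apply: le_esum => j _; rewrite lee_fin.
  by have -> : l * y (k - j) / L * F (possup x j / l) = l / L * F (possup x j / l) * y (k - j) by ring.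
- have -> : m * X / L = X * (m / L) by ring.
  apply: le_trans (esum_conv_le x0 nFy hX Fy).
  apply: le_esum => k _; apply: le_esum => j _; rewrite lee_fin.
  by have -> : m * x j / L * F (possup y (k - j) / m) = x j * (m / L * F (possup y (k - j) / m)) by ring.
Qed.

(** A countable triangle inequality: Jensen with the masses l n / L, then an interchange of sums.
    The 2 is that of [jensen_esum]. *)
Lemma pball_esum (T : choiceType) (l : T -> R) (L : R) (x : T -> int -> R) z :
  (forall n, 0 < l n) -> 0 < L -> (\esum_(n in [set: T]) (l n)%:E <= L%:E)%E ->
  (forall n, nonneg (x n)) -> nonneg z ->
  (forall k, ((z k)%:E <= \esum_(n in [set: T]) (x n k)%:E)%E) ->
  (forall n, pball (l n) (x n)) -> pball (2 * L) z.
Proof.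
move=> l0 L0 hL x0 z0 zx bx; rewrite /pball.
have w0 n : 0 <= l n / L by rewrite divr_ge0// ltW.
apply: (@le_trans _ _ (\esum_(k in [set: nat]) \esum_(n in [set: T])
    (l n / L * F (x n k%:Z * nu k / l n))%:E)%E).
  apply: le_esum => k _.
  have -> : z k%:Z * nu k / (2 * L) = (z k%:Z * nu k / L) / 2 by field; rewrite ?gt_eqF.
  apply: jensen_esum => //.
  - by move=> n; exact: arg_ge0.
  - by exact: arg_ge0.
  - under eq_esum do rewrite mulrC EFinM.
    have l0' n : (0 <= (l n)%:E)%E by rewrite lee_fin ltW.
    have Li0 : 0 <= L^-1 by rewrite invr_ge0 ltW.
    apply: le_trans (le_esumZ Li0 l0') _.
    apply: (@le_trans _ _ (L^-1%:E * L%:E)%E); first by apply: lee_wpmul2l; rewrite ?lee_fin.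
    by rewrite -EFinM mulVf// gt_eqF.
  - have c0 : 0 <= nu k / L by apply: divr_ge0; [exact: weight_ge0|exact: ltW].
    have x0' n : (0 <= (x n k%:Z)%:E)%E by rewrite lee_fin x0.
    rewrite -mulrA mulrC EFinM.
    apply: (@le_trans _ _ ((nu k / L)%:E * \esum_(n in [set: T]) (x n k%:Z)%:E)%E).
      by apply: lee_wpmul2l; rewrite ?lee_fin.
    rewrite -esumZ//; apply: le_esum => n _; rewrite -EFinM lee_fin.
    have -> : l n / L * (x n k%:Z * nu k / l n) = nu k / L * x n k%:Z; last exact: lexx.
    by field; rewrite ?gt_eqF.
have F0 n k : (0 <= (F (x n k%:Z * nu k / l n))%:E)%E.
  by rewrite lee_fin; apply: young_ge0 => //; exact: arg_ge0.
rewrite (@esum_swap _ _ _ (fun k n => (l n / L * F (x n k%:Z * nu k / l n))%:E)); last first.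
  by move=> k n; rewrite EFinM; apply: mule_ge0; [rewrite lee_fin; exact: w0|exact: F0].
apply: (@le_trans _ _ (\esum_(n in [set: T]) (L^-1%:E * (l n)%:E))%E).
  apply: le_esum => n _.
  under eq_esum do rewrite EFinM.
  rewrite esumZ// -EFinM mulrC -[leRHS]mule1.
  by apply: lee_wpmul2l; [rewrite lee_fin mulrC; exact: w0|exact: bx].
have Li0 : 0 <= L^-1 by rewrite invr_ge0 ltW.
rewrite esumZ// => [|n]; last by rewrite lee_fin ltW.
apply: (@le_trans _ _ (L^-1%:E * L%:E)%E); first by apply: lee_wpmul2l; rewrite ?lee_fin.
by rewrite -EFinM mulVf// gt_eqF.
Qed.

End Balls.

(** * Exponential and logarithm series *)

Section ComplexSeries.
Variable R : realType.
Local Notation C := R[i].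
Local Notation Re := (@complex.Re R).
Local Notation Im := (@complex.Im R).
Implicit Types (z s : C) (c : nat -> C) (x : nat -> R).

Lemma cst01 (f : R -> R) : (forall u : R, 0 <= u <= 1 -> is_derive u (1 : R) f 0) -> f 1 = f 0.
Proof.
move=> df; have [| |u _] := @MVT R f (fun=> 0) 0 1 ltr01.
- by move=> u; rewrite in_itv /= => /andP[u0 u1]; apply: df; rewrite !ltW.
- apply: (@derivable_within_continuous _ _ f `[0, 1]%R) => u u01.
  by have [] := df u; move: u01; rewrite in_itv.
- by rewrite mul0r => /eqP; rewrite subr_eq0 => /eqP.
Qed.

(** Termwise differentiation along the real axis. The three bounds give convergence at [K] of the
    series and of its first two derived series, with one majorant for all of them. *)
Lemma cpow_derive c x (K u : R) : `|u| < K -> cvgn (series x) ->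
  (forall n, cabs (c n) * K ^+ n <= x n) ->
  (forall n, n.+1%:R * cabs (c n.+1) * K ^+ n <= x n) ->
  (forall n, n.+1%:R * (n.+2%:R * cabs (c n.+2)) * K ^+ n <= x n) ->
  is_derive u (1 : R) (fun v => Re (csum (fun n => c n * rc v ^+ n)))
    (Re (csum (fun n => n.+1%:R * c n.+1 * rc u ^+ n))) /\
  is_derive u (1 : R) (fun v => Im (csum (fun n => c n * rc v ^+ n)))
    (Im (csum (fun n => n.+1%:R * c n.+1 * rc u ^+ n))).
Proof.
move=> uK cx h0 h1 h2; have K0 : 0 < K by exact: le_lt_trans uK.
have cv (d : nat -> R) : (forall n, `|d n| * K ^+ n <= x n) -> cvgn (pseries d K).
  move=> dx; apply: (series_tail 0 _ cx).1 => k.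
  by rewrite normrM (ger0_norm (exprn_ge0 _ (ltW K0))).
have gen (P : C -> R) : (forall a b, P (a * rc b) = P a * b) ->
    (forall a, `|P a| <= cabs a) ->
    is_derive u (1 : R) (fun v => limn (series (fun n => P (c n * rc v ^+ n))))
     (limn (series (fun n => P (n.+1%:R * c n.+1 * rc u ^+ n)))).
  move=> PM Pc.
  have e1 (d : nat -> C) v : series (fun n => P (d n * rc v ^+ n)) = pseries (fun n => P (d n)) v.
    by rewrite /pseries; congr series; apply/funext => n; rewrite -rcX PM.
  have -> : (fun v => limn (series (fun n => P (c n * rc v ^+ n)))) =
     fun v => limn (pseries (fun n => P (c n)) v) by apply/funext => v; rewrite e1.
  rewrite (e1 (fun n => n.+1%:R * c n.+1)).
  have Pn n a : P (n%:R * a) = n%:R * P a by rewrite -rc_nat mulrC PM mulrC.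
  have -> : (fun n => P (n.+1%:R * c n.+1)) = pseries_diffs (fun n => P (c n)).
    by apply/funext => n; rewrite Pn.
  have Kn n : 0 <= K ^+ n by rewrite exprn_ge0// ltW.
  apply: (@pseries_snd_diffs _ _ K).
  - by apply: cv => n; apply: le_trans (h0 n); rewrite ler_wpM2r.
  - apply: cv => n; apply: le_trans (h1 n); rewrite /pseries_diffs ler_wpM2r// normrM.
    by rewrite ger0_norm// ler_wpM2l.
  - apply: cv => n; apply: le_trans (h2 n); rewrite /pseries_diffs ler_wpM2r//.
    by rewrite normrM ger0_norm// ler_wpM2l// normrM ger0_norm// ler_wpM2l.
  - by rewrite (gtr0_norm K0).
split; apply: gen.
- by move=> a b; rewrite cReM /= mulr0 subr0.
- exact: Re_le_cabs.
- by move=> a b; rewrite cImM /= mulr0 add0r.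
- exact: Im_le_cabs.
Qed.

Lemma csum_lim (u : nat -> C) x z : cvgn (series x) -> (forall n, cabs (u n) <= x n) ->
  (fun n => cabs (z - \sum_(k < n) u k)) @ \oo --> 0 -> csum u = z.
Proof.
move=> cx ux zu; apply/eqP; rewrite -subr_eq0; apply/eqP/cabs_eq0/eqP.
rewrite eq_le cabs_ge0 andbT; apply/ler_addgt0Pl => e e0; rewrite addr0.
have e30 : 0 < e / 3 by rewrite divr_gt0.
have /cvgrPdist_lt/(_ _ e30) h1 := zu.
have /cvgrPdist_lt/(_ _ e30) h2 := cx.
have [n _ /(_ n (leqnn n)) [/= k1 k2]] := filterI h1 h2.
rewrite sub0r normrN ger0_norm ?cabs_ge0// in k1.
have k3 := csum_tail n ux cx.
have -> : csum u - z = (csum u - \sum_(k < n) u k) - (z - \sum_(k < n) u k) by ring.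
have := cabsB (csum u - \sum_(k < n) u k) (z - \sum_(k < n) u k).
have := ler_norm (limn (series x) - series x n); rewrite -/(series x n) in k2 *; lra.
Qed.

Lemma cvgn_seriesZ x (r : R) : cvgn (series x) -> cvgn (series (fun n => r * x n)).
Proof.
move=> cx; have -> : series (fun n => r * x n) = (fun n => r * series x n).
  by apply/funext => n; rewrite /series /= mulr_sumr.
by apply/cvg_ex; exists (r * limn (series x)); apply: cvgM => //; exact: cvg_cst.
Qed.

Lemma csumZ (u : nat -> C) x z : cvgn (series x) -> (forall n, cabs (u n) <= x n) ->
  csum (fun n => z * u n) = z * csum u.
Proof.
move=> cx ux; apply: (@csum_lim _ (fun n => cabs z * x n)).
- exact: cvgn_seriesZ.
- by move=> n; rewrite cabsM ler_wpM2l ?cabs_ge0.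
- apply: (@squeeze_cvgr _ _ _ _ (fun=> 0) (fun n => cabs z * (2 * (limn (series x) - series x n)))).
  + apply: nearW => n; rewrite cabs_ge0 -mulr_sumr -mulrBr cabsM ler_wpM2l ?cabs_ge0//.
    exact: csum_tail.
  + exact: cvg_cst.
  + suff : (fun n => cabs z * (2 * (limn (series x) - series x n))) @ \oo --> cabs z * (2 * (limn (series x) -
      limn (series x))).
      by rewrite subrr !mulr0.
    apply: cvgM; first exact: cvg_cst.
    by apply: cvgM; [exact: cvg_cst|apply: cvgB => //; exact: cvg_cst].
Qed.

Lemma csum0 (u : nat -> C) : (forall n, (0 < n)%N -> u n = 0) -> csum u = u 0%N.
Proof.
move=> h; have E n : \sum_(k < n.+1) u k = u 0%N.
  by rewrite big_ord_recl big1 ?addr0// => i _; rewrite h.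
have eRe : (fun n => series (fun k => Re (u k)) n.+1) = fun=> Re (u 0%N).
  by apply/funext => n; rewrite /series /= big_mkord -cRe_sum E.
have eIm : (fun n => series (fun k => Im (u k)) n.+1) = fun=> Im (u 0%N).
  by apply/funext => n; rewrite /series /= big_mkord -cIm_sum E.
apply: complex_eq => /=; apply: cvg_lim => //; rewrite -cvg_shiftS /=.
  by rewrite eRe; exact: cvg_cst.
by rewrite eIm; exact: cvg_cst.
Qed.

Lemma csum_geom (w : C) : cabs w < 1 -> csum (fun n => w ^+ n) = (1 - w)^-1.
Proof.
move=> w1; have w0 := cabs_ge0 w.
have cx : cvgn (series (geometric 1 (cabs w))) by apply: is_cvg_geometric_series; rewrite ger0_norm.
have w1' : 1 - w != 0.
  rewrite subr_eq0; apply/eqP => h; by rewrite -h cabs1 ltxx in w1.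
apply: (csum_lim cx); first by move=> n; rewrite cabsX /= mul1r.
apply: (@squeeze_cvgr _ _ _ _ (fun=> 0) (fun n => cabs (1 - w)^-1 * geometric 1 (cabs w) n)).
- apply: nearW => n; rewrite cabs_ge0 /= mul1r -cabsX -cabsM.
  have -> : (1 - w)^-1 - \sum_(k < n) w ^+ k = (1 - w)^-1 * w ^+ n.
    have h := subrX1 w n.
    apply: (mulfI w1'); rewrite mulrBr divff// mulrA divff// mul1r.
    have -> : (1 - w) * \sum_(k < n) w ^+ k = 1 - w ^+ n by rewrite -opprB mulNr -h opprB.
    by rewrite opprB addrC subrK.
  exact: lexx.
- exact: cvg_cst.
- suff : (fun n => cabs (1 - w)^-1 * geometric 1 (cabs w) n) @ \oo --> cabs (1 - w)^-1 * 0 by rewrite mulr0.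
  by apply: cvgM; [exact: cvg_cst|apply: cvg_geometric; rewrite ger0_norm].
Qed.

Definition expc z n : C := z ^+ n / n`!%:R.

Lemma cabs_expc z n : cabs (expc z n) = exp_coeff (cabs z) n.
Proof. by rewrite /expc cabsM cabsX cabsV cabs_nat. Qed.

Lemma expcS z n : n.+1%:R * expc z n.+1 = z * expc z n.
Proof.
have n0 : (n.+1%:R : C) != 0 by rewrite pnatr_eq0.
by rewrite /expc factS natrM exprS invfM mulrCA !mulrA mulfK// mulrC.
Qed.

(** The series y(u) = sum (z u)^n / n! satisfies y' = z y, so e^(-zu) y(u) is constant on [0, 1]. *)
Lemma cexp_series z : cexp z = csum (expc z).
Proof.
set b := Im z; set a := Re z.
pose P u := Re (csum (fun n => expc z n * rc u ^+ n)).
pose Q u := Im (csum (fun n => expc z n * rc u ^+ n)).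
have dPQ (u : R) : 0 <= u <= 1 -> is_derive u (1 : R) P (a * P u - b * Q u) /\ is_derive u (1 : R) Q (a * Q u +
    b * P u).
  (* The summands of [m] cover the series and its two derived series, each derivative costing a
     factor |z|; the radius 2 leaves room beyond [0, 1]. *)
  move=> /andP[u0 u1]; pose m := 1 + cabs z + cabs z ^+ 2.
  have z0 := cabs_ge0 z; have e0 n : 0 <= exp_coeff (cabs z * 2) n.
    by rewrite exp_coeff_ge0// mulr_ge0.
  have cx : cvgn (series (fun n => m * exp_coeff (cabs z * 2) n)).
    by apply: cvgn_seriesZ; exact: is_cvg_series_exp_coeff.
  have eK n : cabs (expc z n) * 2 ^+ n = exp_coeff (cabs z * 2) n.
    by rewrite cabs_expc /exp_coeff /= exprMn mulrAC.
  have nE n : n.+1%:R * cabs (expc z n.+1) = cabs z * cabs (expc z n).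
    by rewrite -(cabs_nat R n.+1) -!cabsM expcS.
  have [||||] := @cpow_derive (expc z) (fun n => m * exp_coeff (cabs z * 2) n) 2 u _ cx.
  - by rewrite ger0_norm//; lra.
  - by move=> n; rewrite eK ler_peMl// /m -addrA lerDl addr_ge0// exprn_ge0.
  - move=> n; rewrite nE -mulrA eK ler_wpM2r// /m.
    by rewrite addrAC lerDr addr_ge0// exprn_ge0.
  - move=> n; rewrite nE mulrCA nE -!mulrA eK mulrA ler_wpM2r// /m -expr2.
    by rewrite lerDr addr_ge0.
  have -> : csum (fun n => n.+1%:R * expc z n.+1 * rc u ^+ n) = z * csum (fun n => expc z n * rc u ^+ n).
    rewrite -(csumZ z (is_cvg_series_exp_coeff (cabs z * 2))).
      by congr csum; apply/funext => n; rewrite expcS mulrA.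
    move=> n; rewrite cabsM -eK ler_wpM2l ?cabs_ge0// cabsX cabs_rc lerXn2r ?nnegrE//.
    by rewrite ger0_norm//; lra.
  by rewrite cReM cImM => dP dQ; split; [exact: dP|exact: dQ].
(* [f] and [g] are the real and imaginary parts of e^(-zu) (P + iQ). *)
pose f u := expR (- (a * u)) * (P u * cos (b * u) + Q u * sin (b * u)).
pose g u := expR (- (a * u)) * (Q u * cos (b * u) - P u * sin (b * u)).
have fE : f 1 = f 0.
  apply: cst01 => u /dPQ[dP dQ]; rewrite /f; apply: is_derive_eq.
  by rewrite /GRing.scale /=; ring.
have gE : g 1 = g 0.
  apply: cst01 => u /dPQ[dP dQ]; rewrite /g; apply: is_derive_eq.
  by rewrite /GRing.scale /=; ring.
have E0 : csum (fun n => expc z n * rc 0 ^+ n) = 1.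
  rewrite csum0 => [|n n0]; first by rewrite /expc !expr0 fact0 divr1 mulr1.
  by rewrite rc0 expr0n (gtn_eqF n0) mulr0.
have P0 : P 0 = 1 by rewrite /P E0.
have Q0 : Q 0 = 0 by rewrite /Q E0.
have E1 : csum (fun n => expc z n * rc 1 ^+ n) = csum (expc z).
  by congr csum; apply/funext => n; rewrite rc1 expr1n mulr1.
have P1 : P 1 = Re (csum (expc z)) by rewrite /P E1.
have Q1 : Q 1 = Im (csum (expc z)) by rewrite /Q E1.
move: fE gE; rewrite /f /g !mulr1 !mulr0 oppr0 expR0 cos0 sin0 P0 Q0 P1 Q1 => fE gE.
have ea : expR a * expR (- a) = 1 by rewrite -expRD subrr expR0.
have cs := cos2Dsin2 b.
set p := Re (csum (expc z)) in fE gE *; set q := Im (csum (expc z)) in fE gE *.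
have hX : p * cos b + q * sin b = expR a.
  by rewrite -[LHS]mul1r -ea -mulrA fE; ring.
have hY : q * cos b - p * sin b = 0.
  by rewrite -[LHS]mul1r -ea -mulrA gE; ring.
apply: complex_eq; rewrite /cexp -/a -/b ?cReM ?cImM /= ?mul0r ?subr0 ?addr0 -hX -/p -/q.
- have -> : (p * cos b + q * sin b) * cos b = p * (cos b ^+ 2 + sin b ^+ 2) + (q * cos b - p * sin b) * sin b by ring.
  by rewrite cs hY mul0r addr0 mulr1.
- have -> : (p * cos b + q * sin b) * sin b = q * (cos b ^+ 2 + sin b ^+ 2) - (q * cos b - p * sin b) * cos b by ring.
  by rewrite cs hY mul0r subr0 mulr1.
Qed.

Definition logc s n : C := if n is m.+1 then - (- s) ^+ m.+1 / m.+1%:R else 0.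

Lemma logcS s n : n.+1%:R * logc s n.+1 = s * (- s) ^+ n.
Proof.
have n0 : (n.+1%:R : C) != 0 by rewrite pnatr_eq0.
by rewrite /logc mulrCA mulfV// mulr1 exprS mulNr opprK.
Qed.

Lemma cabs_logcS s n : n.+1%:R * cabs (logc s n.+1) = cabs s ^+ n.+1.
Proof. by rewrite -(cabs_nat R n.+1) -cabsM logcS cabsM cabsX cabsN exprS. Qed.

Lemma cabs_logc s n : cabs (logc s n) <= cabs s ^+ n.
Proof.
case: n => [|n]; first by rewrite cabs0 expr0 ler01.
by rewrite -cabs_logcS ler_peMl ?cabs_ge0// ler1n.
Qed.

Definition clog1p s := csum (logc s).

(** With y(u) the logarithmic series at u s one has y' (1 + u s) = s, so e^(-y(u)) (1 + u s) is
    constant on [0, 1]. *)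
Lemma cexp_clog1p s : cabs s <= 2^-1 -> cexp (clog1p s) = 1 + s.
Proof.
move=> s2; set b := Im s; set a := Re s.
pose P u := Re (csum (fun n => logc s n * rc u ^+ n)).
pose Q u := Im (csum (fun n => logc s n * rc u ^+ n)).
have s0 := cabs_ge0 s.
(* At radius 3/2 the terms are at most (3/4)^n. The factor n + 1 of the second derived series is
   absorbed by n + 6 <= 6 (7/6)^n, and (7/6)(3/4) = 7/8. *)
pose x n : R := geometric 6 (7 / 8) n.
have cx : cvgn (series x) by apply: is_cvg_geometric_series; rewrite ger0_norm; lra.
have g6 n : n.+1%:R * (3 / 4) ^+ n <= x n.
  have bern : n%:R + 6 <= 6 * (7 / 6) ^+ n :> R.
    elim: n => [|n IH]; first by rewrite expr0; lra.
    by rewrite exprS -natr1; have := ler0n R n; lra.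
  have -> : x n = 6 * (7 / 6) ^+ n * (3 / 4) ^+ n.
    by rewrite /x /geometric /= -mulrA -exprMn; congr (_ * _ ^+ _); field.
  have h : 0 <= (3 / 4 : R) ^+ n by rewrite exprn_ge0//; lra.
  by apply: ler_wpM2r => //; rewrite -natr1; lra.
have sK n : cabs s ^+ n * (3 / 2) ^+ n <= (3 / 4) ^+ n.
  by rewrite -exprMn lerXn2r// ?nnegrE; lra.
have p0 n : 0 <= (3 / 4 : R) ^+ n by rewrite exprn_ge0//; lra.
have k0 n : 0 <= (3 / 2 : R) ^+ n by rewrite exprn_ge0//; lra.
have xle n : (3 / 4) ^+ n <= x n.
  by apply: le_trans (g6 n); rewrite ler_peMl ?ler1n.
have sle n : cabs s ^+ n.+1 <= cabs s ^+ n.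
  by rewrite exprS ler_piMl ?exprn_ge0//; lra.
have cx0 (u : R) : 0 <= u <= 1 -> forall n, cabs ((- (rc u * s)) ^+ n) <= x n.
  move=> /andP[u0 u1] n; rewrite cabsX cabsN cabsM cabs_rc ger0_norm//.
  apply: le_trans (xle n); apply: lerXn2r; rewrite ?nnegrE ?mulr_ge0//; nra.
(* The two identities are the real and imaginary parts of (p' + i q') (1 + u s) = s. *)
have dPQ (u : R) : 0 <= u <= 1 -> exists p' q' : R, [/\ is_derive u (1 : R) P p', is_derive u (1 : R) Q q',
    p' * (1 + u * a) - q' * (u * b) = a & q' * (1 + u * a) + p' * (u * b) = b].
  move=> u01; have /andP[u0 u1] := u01.
  have [||||] := @cpow_derive (logc s) x (3 / 2) u _ cx.
  - by rewrite ger0_norm//; lra.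
  - move=> n; apply: le_trans (xle n); apply: le_trans (sK n).
    by rewrite ler_wpM2r// cabs_logc.
  - move=> n; rewrite cabs_logcS; apply: le_trans (xle n); apply: le_trans (sK n).
    by rewrite ler_wpM2r.
  - move=> n; rewrite cabs_logcS -mulrA; apply: le_trans (g6 n); rewrite ler_wpM2l//.
    by apply: le_trans (sK n); rewrite ler_wpM2r// (le_trans (sle _)).
  have us1 : cabs (- (rc u * s)) < 1.
    by rewrite cabsN cabsM cabs_rc ger0_norm//; nra.
  have -> : csum (fun n => n.+1%:R * logc s n.+1 * rc u ^+ n) = s * (1 - - (rc u * s))^-1.
    rewrite -csum_geom// -(csumZ s cx (cx0 u u01)).
    congr csum; apply/funext => n; rewrite logcS -mulrA -exprMn.
    by congr (_ * _ ^+ _); ring.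
  set w := s * _ => dP dQ; exists (Re w), (Im w).
  have nz : 1 - - (rc u * s) != 0.
    by rewrite subr_eq0; apply/negP => /eqP h; move: us1; rewrite -h cabs1 ltxx.
  have hw : w * (1 + rc u * s) = s by rewrite -[in X in _ * (_ + X)](opprK (rc u * s)) /w mulfVK.
  split; [exact: dP|exact: dQ| |].
  - have := congr1 Re hw; rewrite /= cReM cReD cImD cReM cImM /= !mul0r subr0 addr0 add0r => h.
    exact: h.
  - have := congr1 Im hw; rewrite /= cImM cReD cImD cReM cImM /= !mul0r subr0 addr0 add0r => h.
    by rewrite addrC; exact: h.
(* [f] and [g] are the real and imaginary parts of e^(-(P + iQ)) (1 + u s). *)
pose f u := expR (- P u) * ((1 + u * a) * cos (Q u) + u * b * sin (Q u)).
pose g u := expR (- P u) * (u * b * cos (Q u) - (1 + u * a) * sin (Q u)).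
have fE : f 1 = f 0.
  apply: cst01 => u /dPQ[p' [q' [dP dQ h1 h2]]]; rewrite /f; apply: is_derive_eq.
  rewrite /GRing.scale /=; set E := expR _; set c := cos _; set d := sin _.
  transitivity (E * (c * (a - (p' * (1 + u * a) - q' * (u * b))) + d * (b - (q' * (1 + u * a) + p' * (u *
      b))))); first by ring.
  by rewrite h1 h2; ring.
have gE : g 1 = g 0.
  apply: cst01 => u /dPQ[p' [q' [dP dQ h1 h2]]]; rewrite /g; apply: is_derive_eq.
  rewrite /GRing.scale /=; set E := expR _; set c := cos _; set d := sin _.
  transitivity (E * (c * (b - (q' * (1 + u * a) + p' * (u * b))) - d * (a - (p' * (1 + u * a) - q' * (u *
      b))))); first by ring.
  by rewrite h1 h2; ring.
have E0 : csum (fun n => logc s n * rc 0 ^+ n) = 0.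
  rewrite csum0 => [|n n0]; first by rewrite mul0r.
  by rewrite rc0 expr0n (gtn_eqF n0) mulr0.
have E1 : csum (fun n => logc s n * rc 1 ^+ n) = clog1p s.
  by congr csum; apply/funext => n; rewrite rc1 expr1n mulr1.
have P0 : P 0 = 0 by rewrite /P E0.
have Q0 : Q 0 = 0 by rewrite /Q E0.
have P1 : P 1 = Re (clog1p s) by rewrite /P E1.
have Q1 : Q 1 = Im (clog1p s) by rewrite /Q E1.
move: fE gE; rewrite /f /g !mul1r !mul0r P0 Q0 P1 Q1 oppr0 expR0 cos0 sin0.
set p := Re _; set q := Im _ => fE gE.
have ea : expR p * expR (- p) = 1 by rewrite -expRD subrr expR0.
have hX : (1 + a) * cos q + b * sin q = expR p.
  by have := congr1 (fun y => expR p * y) fE; rewrite /= mulrA ea mul1r => ->; ring.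
have hY : b * cos q - (1 + a) * sin q = 0.
  by have := congr1 (fun y => expR p * y) gE; rewrite /= mulrA ea mul1r => ->; ring.
have cs := cos2Dsin2 q.
apply: complex_eq; rewrite /cexp -/p -/q ?cReM ?cImM ?cReD ?cImD /= ?mul0r ?subr0 ?addr0 ?add0r -hX -/a -/b.
- have -> : ((1 + a) * cos q + b * sin q) * cos q = (1 + a) * (cos q ^+ 2 + sin q ^+ 2) + (b * cos q - (1 + a)
    * sin q) * sin q by ring.
  by rewrite cs hY mul0r addr0 mulr1.
- have -> : ((1 + a) * cos q + b * sin q) * sin q = b * (cos q ^+ 2 + sin q ^+ 2) - (b * cos q - (1 + a) * sin
    q) * cos q by ring.
  by rewrite cs hY mul0r subr0 mulr1.
Qed.

End ComplexSeries.

(** * Luxemburg balls and the modular *)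

Section BallFacts.
Variable R : realType.
Variables (F : R -> R) (nu : nat -> R).
Hypotheses (yF : young_fun F) (wnu : weight nu).
Implicit Types (x y z : int -> R) (l m : R).

Let arg_ge0 x l k : nonneg x -> 0 < l -> 0 <= x k%:Z * nu k / l.
Proof. by move=> x0 l0; apply: divr_ge0; [apply: mulr_ge0 => //; exact: weight_ge0|exact: ltW]. Qed.

Lemma pballZ l r x : 0 < r -> pball F nu l x -> pball F nu (r * l) (fun k => r * x k).
Proof.
move=> r0; apply: le_trans; apply: le_esum => k _; rewrite lee_fin invfM.
rewrite (_ : r * _ * _ * (r^-1 * l^-1) = x k%:Z * nu k / l) ?lexx//.
have rr : r * r^-1 = 1 by rewrite divff// gt_eqF.
have -> : r * x k * nu k * (r^-1 * l^-1) = (r * r^-1) * (x k * nu k / l) by ring.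
by rewrite rr mul1r.
Qed.

Lemma pball_add l m x y : 0 < l -> 0 < m -> nonneg x -> nonneg y ->
  pball F nu l x -> pball F nu m y -> pball F nu (l + m) (fun k => x k + y k).
Proof.
move=> l0 m0 x0 y0 hx hy; have lm : 0 < l + m by exact: addr_gt0.
have wl : 0 <= l / (l + m) by rewrite divr_ge0 ?ltW.
have wm : 0 <= m / (l + m) by rewrite divr_ge0 ?ltW.
have Fx k : (0 <= (F (x k%:Z * nu k / l))%:E)%E by rewrite lee_fin; apply: young_ge0 => //; exact: arg_ge0.
have Fy k : (0 <= (F (y k%:Z * nu k / m))%:E)%E by rewrite lee_fin; apply: young_ge0 => //; exact: arg_ge0.
apply: (@le_trans _ _ (\esum_(k in [set: nat]) ((l / (l + m))%:E * (F (x k%:Z * nu k / l))%:E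
   + (m / (l + m))%:E * (F (y k%:Z * nu k / m))%:E))%E).
  apply: le_esum => k _; rewrite -!EFinM -EFinD lee_fin.
  have := @jensen_seq R F yF bool [:: true; false]
    (fun b => if b then l / (l + m) else m / (l + m))
    (fun b => if b then x k%:Z * nu k / l else y k%:Z * nu k / m)
    ((x k%:Z + y k%:Z) * nu k / (l + m)).
  rewrite !big_cons !big_nil !addr0; apply.
  - by case.
  - by case; exact: arg_ge0.
  - apply: divr_ge0; [apply: mulr_ge0; [exact: addr_ge0|exact: weight_ge0]|exact: ltW].
  - by rewrite -mulrDl divff// gt_eqF.
  - have -> : l / (l + m) * (x k%:Z * nu k / l) + m / (l + m) * (y k%:Z * nu k / m) =
      (x k%:Z + y k%:Z) * nu k / (l + m) by field; rewrite ?gt_eqF.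
    exact: lexx.
have mZ w v : 0 <= w -> (0 <= v)%E -> (0 <= w%:E * v)%E by move=> w0 v0; apply: mule_ge0; rewrite ?lee_fin.
rewrite esumD => [|k _|k _]; [|exact: mZ|exact: mZ].
rewrite !esumZ//.
have -> : 1%E = ((l / (l + m))%:E * 1 + (m / (l + m))%:E * 1 :> \bar R)%E.
  by rewrite !mule1 -EFinD -mulrDl divff// gt_eqF.
by apply: leeD; apply: lee_wpmul2l; rewrite ?lee_fin.
Qed.

Lemma pball_modular (B l : R) x : nonneg x -> 1 <= l -> B <= l ->
  (\esum_(k in [set: nat]) (F (x k%:Z * nu k))%:E <= B%:E)%E -> pball F nu l x.
Proof.
move=> x0 l1 Bl h; have l0 : 0 < l by exact: lt_le_trans l1.
have xn k : 0 <= x k%:Z * nu k by apply: mulr_ge0 => //; exact: weight_ge0.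
have li0 : 0 <= l^-1 by rewrite invr_ge0 ltW.
have F0 k : (0 <= (F (x k%:Z * nu k))%:E)%E by rewrite lee_fin young_ge0.
apply: (@le_trans _ _ (\esum_(k in [set: nat]) (l^-1%:E * (F (x k%:Z * nu k))%:E))%E).
  by apply: le_esum => k _; rewrite -EFinM lee_fin [l^-1 * _]mulrC; apply: young_scale.
rewrite esumZ//; apply: (@le_trans _ _ (l^-1%:E * B%:E)%E).
  by apply: lee_wpmul2l; rewrite ?lee_fin.
by rewrite -EFinM lee_fin mulrC ler_pdivrMr// mul1r.
Qed.

(** The converse of [pball_modular], and the place where doubling of F is used: the normalized
    entries are bounded, so [young_double] undoes the division by [l] at the cost of a constant. *)
Lemma modular_pball l x : nonneg x -> 0 < l -> pball F nu l x ->
  (\esum_(k in [set: nat]) (F (x k%:Z * nu k))%:E < +oo)%E.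
Proof.
move=> x0 l0 hx; have ax k := @arg_ge0 x l k x0 l0.
have F0 k : (0 <= (F (x k%:Z * nu k / l))%:E)%E by rewrite lee_fin young_ge0.
have [B B1 hB] : exists2 B, 0 <= B & forall k, x k%:Z * nu k / l <= B.
  have [p [p0 _ Fs Fp _]] := yF.
  have F1 : 0 < F 1 by exact: Fp.
  (* An entry t > 1 satisfies F 1 <= F t / t <= 1 / t by convexity, hence t <= 1 / F 1. *)
  exists (1 + (F 1)^-1); first by rewrite addr_ge0// invr_ge0 ltW.
  move=> k; have [h|h] := lerP (x k%:Z * nu k / l) 1.
    by rewrite (le_trans h)// lerDl invr_ge0 ltW.
  have Fk : F (x k%:Z * nu k / l) <= 1.
    by rewrite -lee_fin (le_trans _ hx)//; exact: (le_esum1 k F0).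
  set t := x k%:Z * nu k / l in h Fk *.
  have := young_scale yF (ltW (lt_trans ltr01 h)) (ltW h).
  have t0 : 0 < t by exact: lt_trans h.
  rewrite divff ?gt_eqF// ler_pdivlMr// => h2.
  rewrite (@le_trans _ _ (F 1)^-1)//; last by rewrite lerDr.
  rewrite -[leRHS]mul1r ler_pdivlMr// mulrC; exact: le_trans Fk.
have [K K0 hK] := young_double yF B1 l0.
apply: (@le_lt_trans _ _ (\esum_(k in [set: nat]) (K%:E * (F (x k%:Z * nu k / l))%:E))%E).
  apply: le_esum => k _; rewrite -EFinM lee_fin.
  have := hK (x k%:Z * nu k / l); rewrite [l * _]mulrC divfK ?gt_eqF//; apply.
  by rewrite ax hB.
rewrite esumZ//; apply: (@le_lt_trans _ _ (K%:E * 1)%E); last by rewrite mule1 ltry.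
by apply: lee_wpmul2l; rewrite ?lee_fin.
Qed.

(** The terms of the convergent modular tend to 0, and F is monotone and positive off 0. This is the
    source of every o(1/psi_n). *)
Lemma pball_cvg0 l x : nonneg x -> 0 < l -> pball F nu l x ->
  (fun k : nat => x k%:Z * nu k) @ \oo --> 0.
Proof.
move=> x0 l0 hx; have xn k : 0 <= x k%:Z * nu k by apply: mulr_ge0 => //; exact: weight_ge0.
have /summableP cs : (\esum_(k in [set: nat]) (F (x k%:Z * nu k))%:E < +oo)%E by exact: modular_pball hx.
have {}cs := cvg_series_cvg_0 (cs (fun k => young_ge0 yF (xn k))).
apply/cvgrPdist_le => e e0; have [p [_ _ _ Fp _]] := yF.
have /cvgrPdist_lt/(_ _ (Fp _ e0)) := cs; apply: filterS => k /=.
rewrite !sub0r !normrN ger0_norm ?(young_ge0 yF)// ger0_norm ?xn// => h.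
rewrite leNgt; apply/negP => ex; move: h; rewrite ltNge => /negP; apply.
exact: (young_mono yF (ltW e0) (ltW ex)).
Qed.

End BallFacts.

(** * The weighted algebra *)

Section WienerEstimates.
Variable R : realType.
Local Notation C := R[i].
Implicit Types (f g h s : R -> C).

Lemma sup_le_nW h t : Wf h -> ((cabs (h t))%:E <= nW h)%E.
Proof.
move=> wh; have [_ _ nh] := wh.
have he0 : h t = evT (fcoefth h) t by have := congr1 (fun f => f t) (Wf_repr wh).
rewrite he0 {he0}.
have c0 k : (0 <= (cabs (fcoefth h k))%:E)%E by rewrite lee_fin cabs_ge0.
have [e [e0 he]] := evT_tail nh.
have S0 : (0 <= nW h)%E by apply: esum_ge0.
rewrite -(fineK (_ : nW h \is a fin_num)) ?ge0_fin_numE// lee_fin.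
have tb n : cabs (trig (fcoefth h) n t) <= fine (nW h).
  rewrite -lee_fin fineK ?ge0_fin_numE//.
  rewrite /nW /nZ esum_intE// (le_trans (_ : _ <= (\sum_(k < n) cabs (fcoefth h k%:Z))%:E + (\sum_(k < n) cabs
      (fcoefth h (- (k.+1)%:Z)))%:E)%E)//.
    rewrite -EFinD lee_fin (le_trans (cabsD _ _))// lerD// (le_trans (cabs_sum _ _ _))//;
    by apply: ler_sum => k _; rewrite cabsM cabs_expi mulr1.
  rewrite -!sumEFin; apply: leeD.
    by apply: (@le_esum_nat _ (fun k => (cabs (fcoefth h k%:Z))%:E)).
  by apply: (@le_esum_nat _ (fun k => (cabs (fcoefth h (- k.+1%:Z)))%:E)).
apply/ler_addgt0Pl => d d0.
have /cvgrPdist_lt/(_ _ d0) [n _ /(_ n (leqnn n))/=] := e0.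
rewrite sub0r normrN => /(le_lt_trans (ler_norm _)) /ltW h1.
have -> : evT (fcoefth h) t = (evT (fcoefth h) t - trig (fcoefth h) n t) + trig (fcoefth h) n t by rewrite subrK.
by rewrite (le_trans (cabsD _ _))// lerD// (le_trans (he n t)).
Qed.

Lemma nW_fin h (M : nat) (B : R) : 0 <= B ->
  (forall k, (M < `|k|)%N -> fcoefth h k = 0) -> (forall k, cabs (fcoefth h k) <= B) ->
  (nW h <= ((2 * M + 1)%:R * B)%:E)%E.
Proof.
move=> B0 hz hB; have c0 k : (0 <= (cabs (fcoefth h k))%:E)%E by rewrite lee_fin cabs_ge0.
rewrite /nW /nZ esum_intE//.
have gen (u : nat -> int) (M' : nat) : (forall n, (M' <= n)%N -> (M < `|u n|)%N) ->
    (\esum_(n in [set: nat]) (cabs (fcoefth h (u n)))%:E <= (M'%:R * B)%:E)%E.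
  move=> hu; apply: esum_nat_lim => // N; rewrite sumEFin lee_fin.
  have : forall N, \sum_(n < N) cabs (fcoefth h (u n)) <= (minn N M')%:R * B.
    elim=> [|N' IH]; first by rewrite big_ord0 min0n mul0r.
    rewrite big_ord_recr /=; have [h1|h1] := leqP M' N'.
      rewrite hz ?hu// cabs0 addr0 (minn_idPr _); last exact: leqW.
      by rewrite (le_trans IH)// ler_wpM2r// ler_nat geq_minr.
    rewrite (minn_idPl h1) -natr1 mulrDl mul1r lerD//.
    by rewrite (le_trans IH)// ler_wpM2r// ler_nat geq_minl.
  by move=> /(_ N) /le_trans; apply; rewrite ler_wpM2r// ler_nat geq_minr.
have -> : ((2 * M + 1)%:R * B)%:E = ((M.+1%:R * B)%:E + (M%:R * B)%:E)%E.
  by rewrite -EFinD -mulrDl -natrD; congr (_%:R * _)%:E; lia.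
by apply: leeD; apply: gen => n; lia.
Qed.

Lemma nW_add f g (F G : R) : contC f -> contC g -> (nW f <= F%:E)%E -> (nW g <= G%:E)%E ->
  (nW (fun t => f t + g t)%R <= (F + G)%:E)%E.
Proof.
move=> cf cg hF hG; rewrite EFinD; apply: le_trans (leeD hF hG).
rewrite /nW /nZ -esumD; try by move=> k _; rewrite lee_fin cabs_ge0.
by apply: le_esum => k _; rewrite -EFinD lee_fin fcoefD// cabsD.
Qed.

Lemma nW_scale z f (r F : R) : contC f -> cabs z <= r -> (nW f <= F%:E)%E ->
  (nW (fun t => z * f t)%R <= (r * F)%:E)%E.
Proof.
move=> cf zr hF; have r0 : 0 <= r by exact: le_trans (cabs_ge0 _) zr.
have c0 k : (0 <= (cabs (fcoefth f k))%:E)%E by rewrite lee_fin cabs_ge0.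
rewrite EFinM; apply: (@le_trans _ _ (r%:E * nW f)%E); last by apply: lee_wpmul2l; rewrite ?lee_fin.
rewrite /nW /nZ -esumZ//; apply: le_esum => k _.
by rewrite -EFinM lee_fin fcoefZ// cabsM ler_wpM2r ?cabs_ge0.
Qed.

Lemma nW_sum (I : Type) (r : seq I) (G : I -> R -> C) (B : I -> R) :
  (forall i, contC (G i)) -> (forall i, (nW (G i) <= (B i)%:E)%E) ->
  (nW (fun t => \sum_(i <- r) G i t)%R <= (\sum_(i <- r) B i)%:E)%E.
Proof.
move=> cG hB; elim: r => [|i r IH].
  rewrite big_nil (_ : (fun t => _) = fun=> 0); last by apply/funext => t; rewrite big_nil.
  rewrite /nW /nZ esum1// => k _; rewrite fcoef_cst; by case: ifP => _; rewrite cabs0.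
rewrite big_cons (_ : (fun t => _) = fun t => G i t + \sum_(i <- r) G i t); last first.
  by apply/funext => t; rewrite big_cons.
by apply: nW_add => //; exact: contC_sum.
Qed.

Lemma per2piM f g : per2pi f -> per2pi g -> per2pi (fun t => f t * g t).
Proof. by move=> pf pg t; rewrite pf pg. Qed.
Lemma per2piD f g : per2pi f -> per2pi g -> per2pi (fun t => f t + g t).
Proof. by move=> pf pg t; rewrite pf pg. Qed.
Lemma per2piX f n : per2pi f -> per2pi (fun t => f t ^+ n).
Proof. by move=> pf t; rewrite pf. Qed.

Lemma nW_pow f n (F : R) : contC f -> per2pi f -> (nW f <= F%:E)%E ->
  (nW (fun t => f t ^+ n)%R <= (F ^+ n)%:E)%E.
Proof.
move=> cf pf hF; elim: n => [|n IH].
  rewrite (_ : (fun t => _) = fun=> 1); last by apply/funext => t.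
  have := @nW_fin (fun=> 1) 0 1 ler01; rewrite muln0 add0n !mulr1; apply.
    by move=> k k0; rewrite fcoef_cst ifF//; apply/negP => /eqP k1; rewrite k1 in k0.
  by move=> k; rewrite fcoef_cst; case: ifP => _; rewrite ?cabs1 ?cabs0.
rewrite (_ : (fun t => _) = fun t => f t * f t ^+ n); last by apply/funext => t; rewrite exprS.
by rewrite exprS; apply: nW_mul => //; [exact: contCX|exact: per2piX].
Qed.

(** A polynomial loss is traded for a slower geometric rate: n + 6 <= 6 (7/6)^n and (7/6)(3/4) =
    7/8. *)
Lemma natr_geom n : n.+1%:R * (3 / 4) ^+ n <= 6 * (7 / 8) ^+ n :> R.
Proof.
have bern : n%:R + 6 <= 6 * (7 / 6) ^+ n :> R.
  elim: n => [|n IH]; first by rewrite expr0; lra.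
  by rewrite exprS -natr1; have := ler0n R n; lra.
have -> : 6 * (7 / 8) ^+ n = 6 * (7 / 6) ^+ n * (3 / 4) ^+ n :> R.
  by rewrite -mulrA -exprMn; congr (_ * _ ^+ _); field.
have h : 0 <= (3 / 4 : R) ^+ n by rewrite exprn_ge0//; lra.
by apply: ler_wpM2r => //; rewrite -natr1; lra.
Qed.

(* Spectral radius: powers of a trigonometric polynomial of degree [d] have at most
   [2nd+1] coefficients, each bounded by the sup norm. *)
Lemma nW_pow_decay s (e : R) : Wf s -> (forall t, cabs (s t) <= 2^-1) -> 0 < e ->
  exists2 m, (0 < m)%N & (nW (fun t => s t ^+ m)%R <= e%:E)%E.
Proof.
move=> ws s2 e0; have [cs ps ns] := ws.
have c0 k : (0 <= (cabs (fcoefth s k))%:E)%E by rewrite lee_fin cabs_ge0.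
have S0 : (0 <= nW s)%E by exact: esum_ge0.
(* The frequencies in [X] form a trigonometric polynomial P whose remainder g has Wiener norm at
   most 1/8, so that |P| <= 1/2 + 1/8 = 5/8. *)
have [X [finX _] hX] : exists2 X, fsets [set: int] X & (nW s - (8^-1)%:E < \sum_(k \in X) (cabs (fcoefth s k))%:E)%E.
  have e8 : (0 < 8^-1 :> R)%R by [].
  have nf : nW s \is a fin_num by rewrite ge0_fin_numE.
  by have [_ [X fX <-] hX] := ub_ereal_sup_adherent e8 nf; exists X.
pose P t := \sum_(k <- fset_set X) fcoefth s k * expi (k%:~R * t).
have cE k : contC (fun t => fcoefth s k * expi (k%:~R * t)).
  by apply: contCM; [exact: contC_cst|exact: contC_expiM].
have cP : contC P by exact: contC_sum.
have pE (k : int) : per2pi (fun t : R => expi (k%:~R * t)).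
  by move=> t; rewrite mulrDr expiD expi_int2pi mulr1.
have pP : per2pi P by move=> t; rewrite /P; apply: eq_bigr => k _; rewrite pE.
pose g t := s t - P t.
have cg : contC g by exact: contCB.
have pg : per2pi g by move=> t; rewrite /g ps pP.
have coefP k : fcoefth P k = if k \in X then fcoefth s k else 0.
  rewrite /P fcoef_sum// (eq_bigr (fun i => fcoefth s i * (k == i)%:R)); last first.
    by move=> i _; rewrite fcoefZ ?fcoef_expi//; exact: contC_expiM.
  case: ifPn => kX.
    rewrite (bigD1_seq k) ?fset_uniq ?in_fset_set//= eqxx mulr1 big1 ?addr0// => i ik.
    by rewrite eq_sym (negbTE ik) mulr0.
  rewrite big_seq big1// => i; rewrite in_fset_set// => iX.
  have -> : (k == i) = false by apply/negP => /eqP ki; rewrite ki iX in kX.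
  by rewrite mulr0.
have gW : (nW g <= (8^-1)%:E)%E.
  have -> : nW g = (\esum_(k in ~` X) (cabs (fcoefth s k))%:E)%E.
    rewrite esum_mkcond; apply: eq_esum => k _; rewrite /g fcoefB// coefP in_setC.
    by case: ifP => _; rewrite ?subrr ?cabs0 ?subr0.
  have := hX; rewrite -(esum_fset finX) => [|i _]; last exact: c0.
  have E : nW s = (\esum_(k in X) (cabs (fcoefth s k))%:E + \esum_(k in ~` X) (cabs (fcoefth s k))%:E)%E.
    by rewrite /nW /nZ (esumID X)// !setTI.
  have A0 : (0 <= \esum_(k in X) (cabs (fcoefth s k))%:E)%E by exact: esum_ge0.
  have B0 : (0 <= \esum_(k in ~` X) (cabs (fcoefth s k))%:E)%E by exact: esum_ge0.
  move: ns E; rewrite -/(nW s) => ns E; rewrite E in ns *.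
  move: A0 B0 ns.
  case: (\esum_(k in X) _)%E => [A| |]//; case: (\esum_(k in ~` X) _)%E => [B| |]//.
  by rewrite -EFinD -EFinB lte_fin !lee_fin; lra.
have Pb t : cabs (P t) <= 5 / 8.
  have -> : P t = s t - g t by rewrite /g; ring.
  rewrite (le_trans (cabsB _ _))//.
  have wg : Wf g by split; [exact: cg|exact: pg|exact: le_lt_trans gW (ltry _)].
  have := le_trans (sup_le_nW t wg) gW; rewrite lee_fin => h1.
  have h2 := s2 t; lra.
pose d := (\max_(k <- fset_set X) `|k|%N)%N.
have Ps j k : (j * d < `|k|)%N -> fcoefth (fun t => P t ^+ j) k = 0.
  elim: j k => [|j IH] k kj.
    rewrite (_ : (fun t => _) = fun=> 1); last by apply/funext => t.
    by rewrite fcoef_cst ifF//; apply/negP => /eqP k0; move: kj; rewrite k0.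
  have -> : (fun t => P t ^+ j.+1) = fun t => \sum_(i <- fset_set X) fcoefth s i * (P t ^+ j * expi (i%:~R * t)).
    by apply/funext => t; rewrite exprSr mulr_sumr; apply: eq_bigr => i _; ring.
  have cPE i : contC (fun t => P t ^+ j * expi (i%:~R * t)).
    by apply: contCM; [exact: contCX|exact: contC_expiM].
  rewrite fcoef_sum => [|i]; last by apply: contCM => //; exact: contC_cst.
  rewrite big_seq big1// => i iX; rewrite fcoefZ// fcoef_shift IH ?mulr0//.
  have : (`|i| <= d)%N by rewrite /d; apply: (@leq_bigmax_seq _ _ xpredT (fun k : int => `|k|%N)).
  move: kj; rewrite mulSn; set q := (j * d)%N; lia.
have PW j m : (j <= m)%N -> (nW (fun t => P t ^+ j)%R <= ((2 * m * d + 1)%:R * (2 * (5 / 8) ^+ j))%:E)%E.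
  move=> jm; have p0 : 0 <= 2 * (5 / 8 : R) ^+ j by rewrite mulr_ge0// exprn_ge0//; lra.
  apply: le_trans (nW_fin (M := (j * d)%N) p0 _ _) _.
  - exact: Ps.
  - move=> k; apply: fcoef_bound; first exact: contCX.
    by move=> t; rewrite cabsX lerXn2r// nnegrE ?cabs_ge0//; lra.
  - by rewrite lee_fin ler_wpM2r// ler_nat leq_add2r -mulnA leq_mul2l leq_mul2r jm !orbT.
(* In the binomial expansion of (P + g)^m each P costs 5/8, up to a factor linear in m, and each g
   costs 1/8; the sum 3/4 is below 1. *)
have sW m : (nW (fun t => s t ^+ m)%R <= (2 * (2 * m * d + 1)%:R * (3 / 4) ^+ m)%:E)%E.
  have -> : (fun t => s t ^+ m) = fun t => \sum_(i < m.+1) ('C(m, i))%:R * (P t ^+ (m - i) * g t ^+ i).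
    apply/funext => t; rewrite (_ : s t = P t + g t); last by rewrite /g; ring.
    by rewrite exprDn; apply: eq_bigr => i _; rewrite mulr_natl.
  pose B (i : 'I_m.+1) : R := 'C(m, i)%:R * ((2 * m * d + 1)%:R * (2 * (5 / 8) ^+ (m - i)) * 8^-1 ^+ i).
  have -> : 2 * (2 * m * d + 1)%:R * (3 / 4) ^+ m = \sum_(i < m.+1) B i.
    rewrite (_ : 3 / 4 = 5 / 8 + 8^-1); last by field.
    rewrite exprDn mulr_sumr; apply: eq_bigr => i _; rewrite /B -[_ *+ 'C(m, i)]mulr_natl; ring.
  apply: (@nW_sum _ _ (fun (i : 'I_m.+1) t => ('C(m, i))%:R * (P t ^+ (m - i) * g t ^+ i))) => i.
    by apply: contCM; [exact: contC_cst|apply: contCM; exact: contCX].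
  apply: nW_scale; [by apply: contCM; exact: contCX|by rewrite cabs_nat|].
  by apply: nW_mul; [exact: contCX|exact: per2piX|exact: contCX|exact: per2piX|apply: PW; exact:
      leq_subr|exact: nW_pow].
have [m hm] : exists m, (4 * d + 2)%:R * (6 * (7 / 8) ^+ m.+1) <= e.
  have : (fun m => (4 * d + 2)%:R * geometric 6 (7 / 8) m) @ \oo --> (4 * d + 2)%:R * (0 : R).
    apply: cvgM; first exact: cvg_cst.
    by apply: cvg_geometric; rewrite ger0_norm; lra.
  rewrite mulr0 => /cvgrPdist_le/(_ _ e0) [N _ /(_ N.+1 (leqnSn N))/=].
  by rewrite sub0r normrN => /(le_trans (ler_norm _)) h; exists N.
exists m.+1 => //; apply: le_trans (sW m.+1) _; rewrite lee_fin.
apply: le_trans hm; apply: (@le_trans _ _ ((4 * d + 2)%:R * (m.+2%:R * (3 / 4) ^+ m.+1))); last first.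
  by rewrite ler_wpM2l// natr_geom.
have p0 : 0 <= (3 / 4 : R) ^+ m.+1 by rewrite exprn_ge0//; lra.
rewrite mulrA; apply: ler_wpM2r => //.
by rewrite -!natrM ler_nat; nia.
Qed.

End WienerEstimates.

(** * Closure of the weighted class under sums, products and series *)

Section WeightedAlgebra.
Variable R : realType.
Local Notation C := R[i].
Variables (F1 F2 : R -> R) (nu1 nu2 : nat -> R).
Hypotheses (yF1 : young_fun F1) (yF2 : young_fun F2) (wnu1 : weight nu1) (wnu2 : weight nu2).
Implicit Types (f g h s : R -> C) (x : int -> R) (z : C) (L l M m r : R).

(** Index 0 is counted in both halves, so that k -> -k simply exchanges the two conditions. *)
Definition sball l x := pball F1 nu1 l x /\ pball F2 nu2 l (fun k => x (- k)).

Definition acoef h (k : int) : R := cabs (fcoefth h k).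

Lemma acoef_ge0 h : nonneg (acoef h).
Proof. by move=> k; exact: cabs_ge0. Qed.

Definition contper h := contC h /\ per2pi h.

Lemma contperM f g : contper f -> contper g -> contper (fun t => f t * g t).
Proof. by move=> [cf pf] [cg pg]; split; [exact: contCM|exact: per2piM]. Qed.
Lemma contperD f g : contper f -> contper g -> contper (fun t => f t + g t).
Proof. by move=> [cf pf] [cg pg]; split; [exact: contCD|exact: per2piD]. Qed.
Lemma contper_cst (z : C) : contper (fun=> z).
Proof. by split; [exact: contC_cst|]. Qed.
Lemma contperX f n : contper f -> contper (fun t => f t ^+ n).
Proof. by move=> [cf pf]; split; [exact: contCX|exact: per2piX]. Qed.

(** The Wiener bound [L] and the weighted radius [l] are kept apart because powers affect them
    differently. *)
Definition Ab h L l := [/\ contper h, 0 < L, 0 < l, (nW h <= L%:E)%E & sball l (acoef h)].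

(* With [F1 = Psi], [nu1 = psi], [F2 = Phi] and [nu2 = phi] this is the class of all [a (e^it)]
   with [a] in the algebra of the theorem. *)
Definition inAf h := exists L l, Ab h L l.

Lemma Ab_weaken h L L' l l' : Ab h L l -> L <= L' -> l <= l' -> Ab h L' l'.
Proof.
move=> [ch L0 l0 hL [h1 h2]] LL ll; have p := @acoef_ge0 h.
split => //; [exact: lt_le_trans LL|exact: lt_le_trans ll|by apply: le_trans hL _; rewrite lee_fin|split].
- exact: (pball_le yF1 wnu1 p p l0 ll (fun k => lexx _) h1).
- have p' : nonneg (fun k => acoef h (- k)) by move=> k; exact: p.
  exact: (pball_le yF2 wnu2 p' p' l0 ll (fun k => lexx _) h2).
Qed.

Lemma Ab_scale z f r L l : Ab f L l -> 0 < r -> cabs z <= r -> Ab (fun t => z * f t) (r * L) (r * l).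
Proof.
move=> [cf L0 l0 hL [h1 h2]] r0 zr; split; try exact: mulr_gt0.
- by apply: contperM => //; exact: contper_cst.
- by apply: nW_scale => //; case: cf.
have le k : acoef (fun t => z * f t) k <= r * acoef f k.
  by rewrite /acoef fcoefZ; [rewrite cabsM ler_wpM2r ?cabs_ge0|case: cf].
have rl : 0 < r * l by exact: mulr_gt0.
have p := @acoef_ge0 (fun t => z * f t); have pf := @acoef_ge0 f.
have rf : nonneg (fun k => r * acoef f k) by move=> k; rewrite mulr_ge0// ltW.
split.
- exact: (pball_le yF1 wnu1 p rf rl (lexx _) le (pballZ r0 h1)).
- apply: (pball_le yF2 wnu2 _ _ rl (lexx _) (fun k => le (- k)) (pballZ r0 h2)).
  + by move=> k; exact: p.
  + by move=> k; exact: rf.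
Qed.

Lemma Ab_add f g L M l m : Ab f L l -> Ab g M m -> Ab (fun t => f t + g t) (L + M) (l + m).
Proof.
move=> [cf L0 l0 hL [h1 h2]] [cg M0 m0 hM [k1 k2]].
have [[cf1 pf1] [cg1 pg1]] := (cf, cg).
split; try exact: addr_gt0.
- exact: contperD.
- exact: nW_add.
have le k : acoef (fun t => f t + g t) k <= acoef f k + acoef g k.
  by rewrite /acoef fcoefD// cabsD.
have lm : 0 < l + m by exact: addr_gt0.
have p := @acoef_ge0 (fun t => f t + g t); have pf := @acoef_ge0 f; have pg := @acoef_ge0 g.
have ps : nonneg (fun k => acoef f k + acoef g k) by move=> k; rewrite addr_ge0.
split.
- exact: (pball_le yF1 wnu1 p ps lm (lexx _) le (pball_add yF1 wnu1 l0 m0 pf pg h1 k1)).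
- apply: (pball_le yF2 wnu2 _ _ lm (lexx _) (fun k => le (- k)) (pball_add yF2 wnu2 l0 m0 _ _ h2 k2));
  by move=> k /=; rewrite ?addr_ge0 ?cabs_ge0.
Qed.

Lemma pball_fin (F : R -> R) (nu : nat -> R) x N : young_fun F -> weight nu -> nonneg x ->
  (forall k, (N <= `|k|)%N -> x k = 0) -> exists B, forall l, B <= l -> 1 <= l -> pball F nu l x.
Proof.
move=> yF wnu x0 xN.
have F0 k : (0 <= (F (x k%:Z * nu k))%:E)%E.
  by rewrite lee_fin; apply: young_ge0 => //; apply: mulr_ge0 => //; exact: weight_ge0.
exists (\sum_(k < N) F (x k%:Z * nu k)) => l Bl l1.
apply: (pball_modular yF wnu x0 l1 Bl); apply: esum_nat_lim => // M.
rewrite sumEFin lee_fin.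
elim: M => [|M IH]; first by rewrite big_ord0; apply: sumr_ge0 => k _; have := F0 k; rewrite lee_fin.
have [MN|NM] := leqP N M.
  by rewrite big_ord_recr /= xN ?mul0r ?(young0 yF) ?addr0.
rewrite -(big_mkord xpredT (fun k => F (x k%:Z * nu k))) -[leRHS](big_mkord xpredT (fun k => F (x k%:Z * nu k))).
rewrite (big_cat_nat (n := M.+1) (p := N))//= lerDl.
by apply: sumr_ge0 => k _; have := F0 k; rewrite lee_fin.
Qed.

Lemma Ab_fin h N : contper h -> (forall k, (N <= `|k|)%N -> fcoefth h k = 0) -> inAf h.
Proof.
move=> ch hN; have [cc pc] := ch; have [B hB] := per_boundedC cc pc.
have B0 : 0 <= B by exact: le_trans (cabs_ge0 _) (hB 0).
have aN k : (N <= `|k|)%N -> acoef h k = 0 by move=> /hN hk; rewrite /acoef hk cabs0.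
have [B1 h1] := pball_fin yF1 wnu1 (@acoef_ge0 h) aN.
have [|B2 h2] := @pball_fin F2 nu2 (fun k => acoef h (- k)) N yF2 wnu2 (fun k => cabs_ge0 _).
  by move=> k kN; apply: aN; rewrite abszN.
exists (1 + (2 * N + 1)%:R * (2 * B)), (Num.max 1 (Num.max B1 B2)); split => //.
- by rewrite ltr_pwDl// mulr_ge0// mulr_ge0.
- by rewrite lt_max ltr01.
- apply: le_trans (nW_fin (M := N) (B := 2 * B) _ _ _) _.
  + by rewrite mulr_ge0.
  + by move=> k /ltnW; exact: hN.
  + by move=> k; exact: fcoef_bound.
  + by rewrite lee_fin lerDr.
- by split; [apply: h1|apply: h2]; rewrite !le_max !lexx ?orbT.
Qed.

Lemma Ab_cst (z : C) : inAf (fun=> z).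
Proof.
apply: (@Ab_fin _ 1); first exact: contper_cst.
by move=> k k1; rewrite fcoef_cst ifF//; apply/negP => /eqP k0; rewrite k0 in k1.
Qed.

Lemma nonneg_opp x : nonneg x -> nonneg (fun k => x (- k)).
Proof. by move=> x0 k; exact: x0. Qed.

(** Uniform approximation by partial sums bounds each coefficient of [h] by the sum of those of the
    terms. This bound is part of the conclusion because the supports of exponentials are read off
    from it; the 2 is that of [pball_esum]. *)
Lemma Ab_series (f : nat -> R -> C) (Ls ls : nat -> R) L l h :
  (forall n, Ab (f n) (Ls n) (ls n)) -> 0 < L -> 0 < l ->
  (\esum_(n in [set: nat]) (Ls n)%:E <= L%:E)%E ->
  (\esum_(n in [set: nat]) (ls n)%:E <= l%:E)%E -> per2pi h ->
  (forall e, 0 < e -> exists N, forall t, cabs (h t - \sum_(n < N) f n t) <= e) ->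
  Ab h L (2 * l) /\ forall k, ((acoef h k)%:E <= \esum_(n in [set: nat]) (acoef (f n) k)%:E)%E.
Proof.
move=> fA L0 l0 hL hl ph happ.
have cf n : contC (f n) by have [[]] := fA n.
have cS N : contC (fun t => \sum_(n < N) f n t) by apply: contC_sum => n; exact: cf.
have ch : contC h.
  apply: contC_unif => e /happ[N hN]; exists (fun t => \sum_(n < N) f n t) => //; exact: cS.
have a0 n k : (0 <= (acoef (f n) k)%:E)%E by rewrite lee_fin cabs_ge0.
have dom k : ((acoef h k)%:E <= \esum_(n in [set: nat]) (acoef (f n) k)%:E)%E.
  apply/lee_addgt0Pr => e e0; have e20 : 0 < e / 2 by rewrite divr_gt0.
  have [N hN] := happ _ e20.
  apply: (@le_trans _ _ ((\sum_(n < N) acoef (f n) k)%:E + e%:E)%E).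
    rewrite -EFinD lee_fin /acoef.
    have -> : fcoefth h k = fcoefth (fun t => h t - \sum_(n < N) f n t) k + \sum_(n < N) fcoefth (f n) k.
      rewrite -fcoef_sum => [|n]; last exact: cf.
      by rewrite fcoefB// subrK.
    rewrite (le_trans (cabsD _ _))// addrC lerD//; first exact: cabs_sum.
    rewrite (le_trans (fcoef_bound _ _ hN))//; first exact: contCB.
    by rewrite mulrC divfK.
  by apply: leeD => //; rewrite -sumEFin; exact: (@le_esum_nat _ (fun n => (acoef (f n) k)%:E)).
split => //; split => //; first by rewrite mulr_gt0.
- apply: (@le_trans _ _ (\esum_(k in [set: int]) \esum_(n in [set: nat]) (acoef (f n) k)%:E)%E).
    by apply: le_esum => k _; exact: dom.
  rewrite esum_swap//; apply: le_trans hL; apply: le_esum => n _.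
  by have [] := fA n.
- have l0' n : 0 < ls n by have [] := fA n.
  split.
  + apply: (pball_esum yF1 wnu1 l0' l0 hl (x := fun n => acoef (f n))).
    * by move=> n; exact: acoef_ge0.
    * exact: acoef_ge0.
    * exact: dom.
    * by move=> n; have [_ _ _ _ []] := fA n.
  + apply: (pball_esum yF2 wnu2 l0' l0 hl (x := fun n k => acoef (f n) (- k))).
    * by move=> n; apply: nonneg_opp; exact: acoef_ge0.
    * by apply: nonneg_opp; exact: acoef_ge0.
    * by move=> k; exact: dom.
    * by move=> n; have [_ _ _ _ []] := fA n.
Qed.

Variable D : R.
Hypotheses (hD1 : dbl nu1 D) (hD2 : dbl nu2 D).
Let K := 2 * D.
Let K2 : 2 <= K.
Proof. by have [D1 _] := hD1; rewrite /K; lra. Qed.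
Let K0 : 0 < K. Proof. by have := K2; lra. Qed.

(** A Leibniz-type estimate: each term pairs the weighted radius of one factor with the Wiener norm
    of the other. *)
Lemma Ab_mul f g L M l m : Ab f L l -> Ab g M m ->
  Ab (fun t => f t * g t) (L * M) (K * (l * M + m * L)).
Proof.
move=> [cf L0 l0 hL [h1 h2]] [cg M0 m0 hM [k1 k2]].
have [[cf1 pf1] [cg1 pg1]] := (cf, cg).
split.
- exact: contperM.
- exact: mulr_gt0.
- by rewrite mulr_gt0// addr_gt0// mulr_gt0.
- exact: nW_mul.
have p := @acoef_ge0 (fun t => f t * g t); have pf := @acoef_ge0 f; have pg := @acoef_ge0 g.
have cv k : ((acoef (fun t => f t * g t) k)%:E <= convol (acoef f) (acoef g) k)%E by exact: fcoef_conv.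
split.
- exact: (pball_conv yF1 wnu1 hD1 l0 m0 L0 M0 pf pg p hL hM cv h1 k1).
- apply: (pball_conv yF2 wnu2 hD2 l0 m0 L0 M0 (nonneg_opp pf) (nonneg_opp pg) (nonneg_opp p) _ _ _ h2 k2).
  + by rewrite (esum_opp (fun k => (acoef f k)%:E)).
  + by rewrite (esum_opp (fun k => (acoef g k)%:E)).
  + by move=> k; rewrite conv_opp.
Qed.

(** The radius [l] enters only linearly, and the growth (K L)^n involves the Wiener norm alone.
    Hence the exponential series always converges, and the logarithmic one as soon as some power has
    small Wiener norm. *)
Lemma Ab_pow f L l n : Ab f L l ->
  Ab (fun t => f t ^+ n.+1) (L ^+ n.+1) (l * n.+1%:R * (K * L) ^+ n).
Proof.
move=> fA; have [_ L0 l0 _ _] := fA.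
elim: n => [|n IH].
  rewrite expr1 expr0 !mulr1 (_ : (fun t => _) = f)//.
rewrite (_ : (fun t => _) = fun t => f t * f t ^+ n.+1); last by apply/funext => t; rewrite exprS.
apply: Ab_weaken (Ab_mul fA IH) _ _; first by rewrite -exprS.
have -> : K * (l * L ^+ n.+1 + l * n.+1%:R * (K * L) ^+ n * L) =
  l * (K * L ^+ n.+1 + n.+1%:R * (K * L) ^+ n.+1) by rewrite [(K * L) ^+ n.+1]exprS; ring.
rewrite -mulrA ler_pM2l// -[in leRHS]natr1 mulrDl mul1r addrC lerD2l.
rewrite exprMn ler_wpM2r ?exprn_ge0 ?(ltW L0)// exprS ler_peMr ?(ltW K0)//.
by apply: exprn_ege1; have := K2; lra.
Qed.

Lemma inAf_mul f g : inAf f -> inAf g -> inAf (fun t => f t * g t).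
Proof. by move=> [L [l fA]] [M [m gA]]; do 2 eexists; exact: Ab_mul fA gA. Qed.

Lemma inAf_add f g : inAf f -> inAf g -> inAf (fun t => f t + g t).
Proof. by move=> [L [l fA]] [M [m gA]]; do 2 eexists; exact: Ab_add fA gA. Qed.

End WeightedAlgebra.

(** * Exponentials and logarithms in the weighted class *)

Section ExpLog.
Variable R : realType.
Local Notation C := R[i].
Variables (F1 F2 : R -> R) (nu1 nu2 : nat -> R).
Hypotheses (yF1 : young_fun F1) (yF2 : young_fun F2) (wnu1 : weight nu1) (wnu2 : weight nu2).
Implicit Types (f g h s : R -> C) (x : int -> R) (z : C) (L l M m r : R).
Local Notation Ab := (@Ab R F1 F2 nu1 nu2).
Local Notation inAf := (@inAf R F1 F2 nu1 nu2).

Lemma inAf_fejer n h : inAf (fejer n h).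
Proof.
apply: (Ab_fin yF1 yF2 wnu1 wnu2 (N := n.+1)).
  split.
    apply: contCM; first exact: contC_cst.
    by apply: contC_sum => j; apply: contC_sum => l; apply: contCM; [exact: contC_cst|exact: contC_expiM].
  move=> t; rewrite /fejer; congr (_ * _); apply: eq_bigr => j _; apply: eq_bigr => l _.
  by rewrite mulrDr expiD expi_int2pi mulr1.
move=> k kn; rewrite /fejer fcoefZ.
  rewrite fcoef_sum => [|j]; last first.
    by apply: contC_sum => l; apply: contCM; [exact: contC_cst|exact: contC_expiM].
  rewrite big1 ?mulr0// => j _; rewrite fcoef_sum => [|l]; last first.
    by apply: contCM; [exact: contC_cst|exact: contC_expiM].
  rewrite big1// => l _; rewrite fcoefZ; last exact: contC_expiM.
  rewrite fcoef_expi (_ : (_ == _) = false) ?mulr0//; apply/negP => /eqP.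
  by have := ltn_ord j; have := ltn_ord l; lia.
by apply: contC_sum => j; apply: contC_sum => l; apply: contCM; [exact: contC_cst|exact: contC_expiM].
Qed.

Variable D : R.
Hypotheses (hD1 : dbl nu1 D) (hD2 : dbl nu2 D).
Let K := 2 * D.
Let K2 : 2 <= K.
Proof. by have [D1 _] := hD1; rewrite /K; lra. Qed.
Let K0 : 0 < K. Proof. by have := K2; lra. Qed.

Lemma sum_exp_le (r : R) N : 0 <= r -> \sum_(n < N) r ^+ n / n`!%:R <= expR r.
Proof.
move=> r0; rewrite -(big_mkord xpredT (fun n => r ^+ n / n`!%:R)).
have := nondecreasing_cvgn_le _ (is_cvg_series_exp_coeff r); apply.
by apply: nondecreasing_series => n _ _; exact: exp_coeff_ge0.
Qed.

Lemma esum_exp_le (c r : R) : 0 <= r -> 0 <= c ->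
  (\esum_(n in [set: nat]) (c * (r ^+ n / n`!%:R))%:E <= (c * expR r)%:E)%E.
Proof.
move=> r0 c0; have p n : 0 <= r ^+ n / n`!%:R :> R by rewrite divr_ge0// exprn_ge0.
apply: esum_nat_lim => [n|N]; first by rewrite lee_fin mulr_ge0.
by rewrite sumEFin lee_fin -mulr_sumr ler_wpM2l// sum_exp_le.
Qed.

Lemma cvg_tail (x : nat -> R) : cvgn (series x) ->
  forall e : R, 0 < e -> exists N, 2 * (limn (series x) - series x N.+1) <= e.
Proof.
move=> cx e e0; have e20 : 0 < e / 2 by rewrite divr_gt0.
have /cvgrPdist_le/(_ _ e20) [N _ /(_ N.+1 (leqnSn N))/=] := cx.
by move=> /(le_trans (ler_norm _)) h; exists N; move: h; rewrite -/(series x N.+1); lra.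
Qed.

(* The second part shows later on that [exp f - 1] keeps the support of [f]. *)
Lemma Ab_exp f L l : Ab f L l -> inAf (fun t => cexp (f t)) /\
  forall k, ((acoef (fun t => cexp (f t) - 1)%R k)%:E <=
    \esum_(n in [set: nat]) (acoef (fun t => expc (f t) n.+1) k)%:E)%E.
Proof.
move=> fA; have [[cf pf] L0 l0 _ _] := fA.
have [B hB] := per_boundedC cf pf.
have B0 : 0 <= B by exact: le_trans (cabs_ge0 _) (hB 0).
pose fn n t := expc (f t) n.+1.
have f0 n : 0 < n.+1`!%:R :> R by rewrite ltr0n fact_gt0.
have fnA n : Ab (fn n) ((n.+1`!%:R)^-1 * L ^+ n.+1) ((n.+1`!%:R)^-1 * (l * n.+1%:R * (K * L) ^+ n)).
  have -> : fn n = fun t => (n.+1`!%:R)^-1 * f t ^+ n.+1 by apply/funext => t; rewrite /fn /expc mulrC.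
  apply: (Ab_scale yF1 yF2 wnu1 wnu2) (Ab_pow yF1 yF2 wnu1 wnu2 hD1 hD2 n fA) _ _; first by rewrite invr_gt0.
  by rewrite cabsV cabs_nat.
have KL : 0 <= K * L by rewrite mulr_ge0 ?ltW ?K0.
have [] := @Ab_series R F1 F2 nu1 nu2 yF1 yF2 wnu1 wnu2 fn
   (fun n => (n.+1`!%:R)^-1 * L ^+ n.+1) (fun n => (n.+1`!%:R)^-1 * (l * n.+1%:R * (K * L) ^+ n))
   (L * expR L) (l * expR (K * L)) (fun t => cexp (f t) - 1) fnA.
- by rewrite mulr_gt0// expR_gt0.
- by rewrite mulr_gt0// expR_gt0.
- apply: le_trans (esum_exp_le (ltW L0) (ltW L0)); apply: le_esum => n _; rewrite lee_fin.
  rewrite exprS mulrC -mulrA ler_pM2l// ler_pM2l ?exprn_gt0// lef_pV2 ?posrE ?ltr0n ?fact_gt0//.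
  by rewrite ler_nat factS leq_pmull.
- apply: le_trans (esum_exp_le KL (ltW l0)); apply: le_esum => n _; rewrite lee_fin.
  rewrite le_eqVlt; apply/orP; left; apply/eqP.
  have n0 : (n.+1%:R : R) != 0 by rewrite pnatr_eq0.
  rewrite factS natrM invfM; transitivity (n.+1%:R^-1 * n.+1%:R * (l * ((K * L) ^+ n / n`!%:R))); first by ring.
  by rewrite mulVf// mul1r.
- by move=> t; rewrite pf.
- move=> e e0; have [N hN] := cvg_tail (is_cvg_series_exp_coeff B) e0.
  exists N => t; rewrite cexp_series.
  have h : forall n, cabs (expc (f t) n) <= exp_coeff B n.
    move=> n; rewrite cabs_expc /exp_coeff /= ler_wpM2r ?invr_ge0//.
    by apply: lerXn2r; rewrite ?nnegrE ?cabs_ge0.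
  have := csum_tail N.+1 h (is_cvg_series_exp_coeff B).
  rewrite big_ord_recl /= {2}/expc expr0 fact0 divr1 opprD addrA => h1.
  by apply: le_trans h1 hN.
move=> eA hk; split=> //.
have [L1 [l1 oneA]] := Ab_cst yF1 yF2 wnu1 wnu2 (1 : C).
have := Ab_add yF1 yF2 wnu1 wnu2 eA oneA.
have -> : (fun t => cexp (f t) - 1 + 1) = fun t => cexp (f t) by apply/funext => t; rewrite subrK.
by move=> h; do 2 eexists; exact: h.
Qed.

Lemma sum_divn (f : nat -> R) (m N : nat) : (0 < m)%N ->
  \sum_(n < N * m) f (n %/ m)%N = (\sum_(k < N) f k) * m%:R.
Proof.
move=> m0; elim: N => [|N IH]; first by rewrite mul0n !big_ord0 mul0r.
rewrite big_ord_recr /= mulrDl -IH mulSn addnC.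
rewrite big_split_ord /=; congr (_ + _).
rewrite (eq_bigr (fun=> f N)) => [|i _]; first by rewrite sumr_const card_ord mulr_natr.
by rewrite divnMDl// divn_small ?addn0.
Qed.

(** Every quotient occurs m times, and 6 times the sum of the (7/8)^k is 48. *)
Lemma esum_divn_geom (c : R) (m : nat) : 0 <= c -> (0 < m)%N ->
  (\esum_(n in [set: nat]) (c * (6 * (7 / 8) ^+ (n %/ m)))%:E <= (c * (48 * m%:R))%:E)%E.
Proof.
move=> c0 m0; have q0 k : 0 <= 6 * (7 / 8) ^+ k :> R by rewrite mulr_ge0// exprn_ge0//; lra.
apply: esum_nat_lim => [n|N]; first by rewrite lee_fin mulr_ge0.
rewrite sumEFin lee_fin -mulr_sumr ler_wpM2l//.
apply: (@le_trans _ _ (\sum_(n < N * m) 6 * (7 / 8) ^+ (n %/ m))).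
  rewrite -(big_mkord xpredT (fun n => 6 * (7 / 8) ^+ (n %/ m))) -[leRHS](big_mkord xpredT (fun n => 6 * (7 /
      8) ^+ (n %/ m))).
  rewrite (big_cat_nat (n := N) (p := (N * m)%N)) ?leq_pmulr//= lerDl.
  by apply: sumr_ge0.
rewrite (sum_divn (fun k => 6 * (7 / 8) ^+ k))// ler_wpM2r// -mulr_sumr.
have := subrX1 (7 / 8 : R) N; set S := \sum_(i < N) _ => h.
have : 0 <= (7 / 8 : R) ^+ N by rewrite exprn_ge0//; lra.
lra.
Qed.

(** Write n + 1 = (r + 1) + q m with r < m. The factor s^(r+1) is one of finitely many, and since K
    times the Wiener norm of s^m is at most 1/2, the radius of (s^m)^q decays like q 2^(-q). The sup
    bound 1/2 yields such an m even if the Wiener norm of [s] is large. *)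
Lemma Ab_log s L l : Ab s L l -> (forall t, cabs (s t) <= 2^-1) ->
  inAf (fun t => clog1p (s t)).
Proof.
move=> sA0 s2.
(* With L >= 1 the bounds for s, ..., s^m increase with the exponent, so the [A] and [B] introduced
   below serve all of them. *)
have {L sA0} [L L1 sA] : exists2 L, 1 <= L & Ab s L l.
  exists (Num.max 1 L); first by rewrite le_max lexx.
  by apply: (Ab_weaken yF1 yF2 wnu1 wnu2 sA0); rewrite // le_max lexx orbT.
have [[cs ps] L0 l0 hL _] := sA.
have e0 : 0 < (2 * K)^-1 by rewrite invr_gt0 mulr_gt0 ?K0.
have ws : Wf s by split; [exact: cs|exact: ps|exact: le_lt_trans hL (ltry _)].
have [m m0 hm] := nW_pow_decay ws s2 e0.
set eps := (2 * K)^-1 in e0 hm.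
have Keps : K * eps = 2^-1 by rewrite /eps invfM mulrCA mulfV ?mulr1// gt_eqF ?K0.
have [lh hA] : exists lh, Ab (fun t => s t ^+ m) eps lh.
  case: m m0 hm => // m _ hm; have [c1 _ l1 _ b1] := Ab_pow yF1 yF2 wnu1 wnu2 hD1 hD2 m sA.
  by eexists; split; [exact: c1|exact: e0|exact: l1|exact: hm|exact: b1].
have [_ _ lh0 _ _] := hA.
pose A := L ^+ m; pose B := l * m%:R * (K * L) ^+ m.
have m0R : 0 < m%:R :> R by rewrite ltr0n.
have KL1 : 1 <= K * L by have := K2; nra.
have KL0 : 0 < K * L by lra.
have A0 : 0 < A by rewrite exprn_gt0//; lra.
have B0 : 0 < B by rewrite !mulr_gt0// exprn_gt0.
have small (r : nat) : (r < m)%N -> Ab (fun t => s t ^+ r.+1) A B.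
  move=> rm; apply: (Ab_weaken yF1 yF2 wnu1 wnu2 (Ab_pow yF1 yF2 wnu1 wnu2 hD1 hD2 r sA)).
    by apply: ler_weXn2l.
  rewrite /B; apply: ler_pM.
  - by rewrite mulr_ge0// ltW.
  - by rewrite exprn_ge0// ltW.
  - by rewrite ler_pM2l// ler_nat.
  - by apply: ler_weXn2l => //; exact: ltnW.
pose M := 2 * K * lh * A + K * B + A + B.
have two0 : 0 < 2 :> R by [].
have c1 : 0 < 2 * K * lh * A by exact: mulr_gt0 (mulr_gt0 (mulr_gt0 two0 K0) lh0) A0.
have c2 : 0 < K * B by exact: mulr_gt0 K0 B0.
have M0 : 0 < M by rewrite /M; lra.
have bound n : Ab (fun t => s t ^+ n.+1) (M * (6 * (7 / 8) ^+ (n %/ m))) (M * (6 * (7 / 8) ^+ (n %/ m))).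
  have rm : (n %% m < m)%N by rewrite ltn_mod.
  have geo k : k.+1%:R * 2^-1 ^+ k <= 6 * (7 / 8) ^+ k :> R.
    apply: le_trans (natr_geom R k); rewrite ler_wpM2l//.
    by apply: lerXn2r; rewrite ?nnegrE; lra.
  have -> : (fun t => s t ^+ n.+1) = fun t => s t ^+ (n %% m).+1 * (s t ^+ m) ^+ (n %/ m).
    by apply/funext => t; rewrite -exprM -exprD; congr (_ ^+ _); rewrite addSn mulnC addnC -divn_eq.
  case: (n %/ m)%N => [|k].
    have -> : (fun t => s t ^+ (n %% m).+1 * (s t ^+ m) ^+ 0) = fun t => s t ^+ (n %% m).+1.
      by apply/funext => t; rewrite expr0 mulr1.
    by apply: (Ab_weaken yF1 yF2 wnu1 wnu2 (small _ rm)); rewrite expr0 mulr1 /M; lra.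
  have hk := Ab_pow yF1 yF2 wnu1 wnu2 hD1 hD2 k hA.
  have p2k : 0 <= 2^-1 ^+ k.+1 :> R by rewrite exprn_ge0.
  have e2 : k.+1%:R * 2^-1 ^+ k.+1 <= k.+2%:R * 2^-1 ^+ k.+1 :> R by rewrite ler_wpM2r// ler_nat.
  have e1 : eps ^+ k.+1 <= k.+2%:R * 2^-1 ^+ k.+1.
    apply: (@le_trans _ _ (2^-1 ^+ k.+1)); last by rewrite ler_peMl// ler1n.
    apply: lerXn2r; rewrite ?nnegrE ?(ltW e0)//.
    by have := K2; have := Keps; nra.
  have q0 : 0 <= 6 * (7 / 8) ^+ k.+1 :> R by rewrite mulr_ge0// exprn_ge0//; lra.
  apply: (Ab_weaken yF1 yF2 wnu1 wnu2 (Ab_mul yF1 yF2 wnu1 wnu2 hD1 hD2 (small _ rm) hk)).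
  - have h := ler_wpM2l (ltW A0) (le_trans e1 (geo k.+1)).
    apply: le_trans h _; rewrite ler_wpM2r// /M.
    by lra.
  - have -> : K * (B * eps ^+ k.+1 + lh * k.+1%:R * (K * eps) ^+ k * A) =
        K * B * eps ^+ k.+1 + 2 * K * lh * A * (k.+1%:R * 2^-1 ^+ k.+1).
      rewrite Keps [2^-1 ^+ k.+1]exprS; move: (eps ^+ k.+1) (2^-1 ^+ k) => Y X; by field.
    have h1 := ler_wpM2l (ltW c2) (le_trans e1 (geo k.+1)).
    have h2 := ler_wpM2l (ltW c1) (le_trans e2 (geo k.+1)).
    apply: le_trans (lerD h1 h2) _; rewrite -mulrDl ler_wpM2r// /M.
    by lra.
pose fn n t := logc (s t) n.+1.
have fnA n : Ab (fn n) (1 * (M * (6 * (7 / 8) ^+ (n %/ m)))) (1 * (M * (6 * (7 / 8) ^+ (n %/ m)))).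
  have -> : fn n = fun t => (- (-1) ^+ n.+1 / n.+1%:R) * s t ^+ n.+1.
    apply/funext => t; rewrite /fn /logc [(- s t) ^+ n.+1]exprNn.
    by move: ((-1) ^+ n.+1) (s t ^+ n.+1) (n.+1%:R^-1) => a b c; ring.
  apply: (Ab_scale yF1 yF2 wnu1 wnu2 (bound n)) => //.
  rewrite cabsM cabsV cabs_nat cabsN cabsX cabsN cabs1 expr1n mul1r.
  by rewrite invf_le1 ?ltr0n// ler1n.
have cx : cvgn (series (geometric (1 : R) 2^-1)).
  by apply: is_cvg_geometric_series; rewrite ger0_norm//; lra.
have [] := @Ab_series R F1 F2 nu1 nu2 yF1 yF2 wnu1 wnu2 fn
   (fun n => 1 * (M * (6 * (7 / 8) ^+ (n %/ m)))) (fun n => 1 * (M * (6 * (7 / 8) ^+ (n %/ m))))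
   (M * (48 * m%:R)) (M * (48 * m%:R)) (fun t => clog1p (s t)) fnA.
- by rewrite !mulr_gt0.
- by rewrite !mulr_gt0.
- by under eq_esum do rewrite mul1r; apply: esum_divn_geom => //; exact: ltW.
- by under eq_esum do rewrite mul1r; apply: esum_divn_geom => //; exact: ltW.
- by move=> t; rewrite ps.
- move=> e ee0; have [N hN] := cvg_tail cx ee0.
  exists N => t; have h : forall n, cabs (logc (s t) n) <= geometric 1 2^-1 n.
    move=> n; apply: le_trans (cabs_logc _ _) _; rewrite /= mul1r.
    by apply: lerXn2r; rewrite ?nnegrE ?cabs_ge0.
  have := csum_tail N.+1 h cx.
  by rewrite big_ord_recl add0r => h1; apply: le_trans h1 hN.
by move=> h _; do 2 eexists; exact: h.
Qed.

(** One factor 2 comes from [csum_tail], the other from 1/(1 - |z|) <= 2. *)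
Lemma clog1p_small z : cabs z <= 2^-1 -> cabs (clog1p z) <= 4 * cabs z.
Proof.
move=> z2; have z0 := cabs_ge0 z.
have zn : `|cabs z| < 1 by rewrite ger0_norm//; lra.
have cx := is_cvg_geometric_series (a := 1) zn.
have h : forall n, cabs (logc z n) <= geometric 1 (cabs z) n.
  by move=> n; rewrite /= mul1r cabs_logc.
have := csum_tail 1 h cx; rewrite big_ord1 subr0 -/(clog1p z).
have -> : limn (series (geometric 1 (cabs z))) = 1 * (1 - cabs z)^-1.
  by apply: cvg_lim => //; exact: cvg_geometric_series.
rewrite /series /= big_nat1 expr0 mulr1 mul1r.
have h1 : (1 - cabs z)^-1 - 1 <= 2 * cabs z.
  rewrite lerBlDr -[X in X <= _]mul1r ler_pdivrMr; last by lra.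
  by nra.
lra.
Qed.

End ExpLog.

(** * Wiener-Hopf factorization *)

Section Supports.
Variable R : realType.
Local Notation C := R[i].
Implicit Types (f g h : R -> C) (z : C) (S : pred int).

Definition supp_in S h := forall k, ~~ S k -> fcoefth h k = 0.

Definition add_closed S := forall i j, S i -> S j -> S (i + j).

Lemma acoef_eq0 h k : ((acoef h k)%:E <= 0)%E -> fcoefth h k = 0.
Proof.
by rewrite lee_fin => h0; apply: cabs_eq0; apply/eqP; rewrite eq_le h0 cabs_ge0.
Qed.

Lemma supp_mul S f g : add_closed S -> contper f -> contper g ->
  supp_in S f -> supp_in S g -> supp_in S (fun t => f t * g t).
Proof.
move=> SS [cf pf] [cg pg] hf hg k kS; apply: acoef_eq0.
apply: le_trans (fcoef_conv k cf pf cg pg) _; rewrite /convol esum1// => j _.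
have [Sj|Sj] := boolP (S j); last by rewrite hf// cabs0 mul0r.
have [Skj|Skj] := boolP (S (k - j)); last by rewrite hg// cabs0 mulr0.
by have := SS _ _ Sj Skj; rewrite addrC subrK (negbTE kS).
Qed.

Lemma supp_sub S S' h : {subset S <= S'} -> supp_in S h -> supp_in S' h.
Proof. by move=> SS hS k kS; apply: hS; apply: contra kS => /SS. Qed.

Lemma supp_add S f g : contC f -> contC g -> supp_in S f -> supp_in S g -> supp_in S (fun t => f t + g t).
Proof. by move=> cf cg hf hg k kS; rewrite fcoefD// hf// hg// addr0. Qed.

Lemma supp_scale S z f : contC f -> supp_in S f -> supp_in S (fun t => z * f t).
Proof. by move=> cf hf k kS; rewrite fcoefZ// hf// mulr0. Qed.

Lemma supp_pow S f n : add_closed S -> contper f -> supp_in S f -> supp_in S (fun t => f t ^+ n.+1).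
Proof.
move=> SS cf hf; elim: n => [|n IH]; first by rewrite (_ : (fun t => _) = f).
rewrite (_ : (fun t => _) = fun t => f t * f t ^+ n.+1); last by apply/funext => t; rewrite exprS.
by apply: supp_mul => //; exact: contperX.
Qed.

(** After subtraction of their constant terms both factors are supported in [S], and so is their
    product, which therefore has no constant term. *)
Lemma fcoef0_mul S f g : add_closed S -> ~~ S 0 -> contper f -> contper g ->
  supp_in (fun k => S k || (k == 0)) f -> supp_in (fun k => S k || (k == 0)) g ->
  fcoefth (fun t => f t * g t) 0 = fcoefth f 0 * fcoefth g 0.
Proof.
move=> SS S0 cf cg hf hg; have [[ccf pf] [ccg pg]] := (cf, cg).
pose f' t := f t - fcoefth f 0; pose g' t := g t - fcoefth g 0.
have str (h : R -> C) : contper h -> supp_in (fun k => S k || (k == 0)) h ->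
    contper (fun t => h t - fcoefth h 0) /\ supp_in S (fun t => h t - fcoefth h 0).
  move=> ch hh; have [cch ph] := ch; split.
    by split; [apply: contCB => //; exact: contC_cst|move=> t; rewrite ph].
  move=> k kS; rewrite fcoefB//; last exact: contC_cst.
  rewrite fcoef_cst; case: eqP => [->|/eqP k0]; first by rewrite subrr.
  by rewrite hh ?subr0// negb_or kS.
have [cf' hf'] := str f cf hf; have [cg' hg'] := str g cg hg.
have e0 : fcoefth (fun t => f' t * g' t) 0 = 0 by exact: (supp_mul SS cf' cg' hf' hg').
have -> : (fun t => f t * g t) = fun t => f' t * g' t + (fcoefth f 0 * g t + (fcoefth g 0 * f t - fcoefth f 0 *
    fcoefth g 0)).
  by apply/funext => t; rewrite /f' /g'; ring.
have c1 : contC (fun t => f' t * g' t) by have [] := contperM cf' cg'.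
have c2 : contC (fun t => fcoefth f 0 * g t) by apply: contCM => //; exact: contC_cst.
have c3 : contC (fun t => fcoefth g 0 * f t) by apply: contCM => //; exact: contC_cst.
have c4 : contC (fun _ : R => fcoefth f 0 * fcoefth g 0) by exact: contC_cst.
rewrite fcoefD//; last by apply: contCD => //; exact: contCB.
rewrite fcoefD//; last exact: contCB.
rewrite fcoefB// e0 fcoef_cst eqxx !fcoefZ//; ring.
Qed.

Lemma contper_eq f g : contper f -> contper g -> (forall k, fcoefth f k = fcoefth g k) -> f = g.
Proof.
move=> [cf pf] [cg pg] e; apply/funext => t; apply/eqP; rewrite -subr_eq0; apply/eqP.
apply: (@fcoef_unique _ (fun t => f t - g t)).
- exact: contCB.
- exact: per2piB.
- by move=> k; rewrite fcoefB// e subrr.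
Qed.

End Supports.

Section Factorization.
Variable R : realType.
Local Notation C := R[i].
Variables (F1 F2 : R -> R) (nu1 nu2 : nat -> R).
Hypotheses (yF1 : young_fun F1) (yF2 : young_fun F2) (wnu1 : weight nu1) (wnu2 : weight nu2).
Implicit Types (f g h s : R -> C) (z : C) (L l : R).
Local Notation inAf := (@inAf R F1 F2 nu1 nu2).

Lemma exists_dbl : exists D, dbl nu1 D /\ dbl nu2 D.
Proof.
have [D1 h1] := weight_dbl wnu1; have [D2 h2] := weight_dbl wnu2.
exists (Num.max D1 D2); split; [apply: h1|apply: h2]; rewrite le_max lexx ?orbT//.
Qed.

Lemma inAf_contper f : inAf f -> contper f.
Proof. by move=> [L [l []]]. Qed.

Lemma inAf_exp f : inAf f -> inAf (fun t => cexp (f t)).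
Proof. by move=> [L [l fA]]; have [D [h1 h2]] := exists_dbl; have [] := Ab_exp yF1 yF2 wnu1 wnu2 h1 h2 fA. Qed.

Lemma inAf_mulr f g : inAf f -> inAf g -> inAf (fun t => f t * g t).
Proof. by have [D [h1 h2]] := exists_dbl; exact: (inAf_mul yF1 yF2 wnu1 wnu2 h1 h2). Qed.

Lemma inAf_cst z : inAf (fun=> z).
Proof. exact: Ab_cst. Qed.

Lemma inAf_opp f : inAf f -> inAf (fun t => - f t).
Proof.
move=> fA; rewrite (_ : (fun t => _) = fun t => -1 * f t); last by apply/funext => t; rewrite mulN1r.
exact: inAf_mulr (inAf_cst _) fA.
Qed.

Lemma inAf_addr f g : inAf f -> inAf g -> inAf (fun t => f t + g t).
Proof. exact: inAf_add. Qed.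

Lemma cexp_sub1_small z : cabs z <= 32^-1 -> cabs (cexp z - 1) <= 8^-1.
Proof.
move=> z32; have z0 := cabs_ge0 z.
have h : forall n, cabs (expc z n) <= exp_coeff (cabs z) n by move=> n; rewrite cabs_expc.
have := csum_tail 1 h (is_cvg_series_exp_coeff (cabs z)).
rewrite -cexp_series big_ord1 /series /= big_nat1 {1}/expc /exp_coeff /= !expr0 fact0 !divr1.
have e1 : expR (cabs z) <= 32 / 31.
  have h1 := expR_ge1Dx (- cabs z); have := expRD (cabs z) (- cabs z).
  rewrite subrr expR0 => h2; have h3 := expR_gt0 (cabs z); nra.
by rewrite -/(exp_coeff (cabs z)) -/(expR (cabs z)) => /le_trans; apply; lra.
Qed.

Lemma inAf_log f g : inAf f -> contper g -> (forall t, cexp (g t) = f t) -> inAf g.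
Proof.
move=> fA [cg pg] gf; have e0 : 0 < 32^-1 :> R by [].
have [n _ /(_ n (leqnn n)) hn] := fejer_cvg cg pg e0.
pose q := fejer n g; have qA : inAf q by exact: inAf_fejer.
pose s t := f t * cexp (- q t) + (- 1).
have sE t : s t = cexp (g t - q t) - 1 by rewrite /s -gf -cexpD.
have sA : inAf s by apply: inAf_addr (inAf_cst _); apply: inAf_mulr fA (inAf_exp (inAf_opp qA)).
have s8 t : cabs (s t) <= 8^-1 by rewrite sE; apply: cexp_sub1_small; exact: hn.
have s2 t : cabs (s t) <= 2^-1 by apply: le_trans (s8 t) _; lra.
(* Both sides are logarithms of 1 + s. The precision 1/32 of the Fejér mean gives |s| <= 1/8, so
   their imaginary parts are at most 1/32 and 4 * 1/8, hence less than 1 apart. *)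
have lE t : g t - q t = clog1p (s t).
  apply: cexp_inj_small; last by rewrite cexp_clog1p// sE [1 + _]addrC subrK.
  have h1 := le_trans (Im_le_cabs _) (hn t).
  have h2 := le_trans (Im_le_cabs _) (clog1p_small (s2 t)).
  by apply: le_trans (ler_normB _ _) _; have := s8 t; rewrite -/q in h1; lra.
have -> : g = fun t => q t + clog1p (s t) by apply/funext => t; rewrite -lE addrC subrK.
have [D [h1 h2]] := exists_dbl; have [L [l sAb]] := sA.
exact: inAf_addr qA (Ab_log yF1 yF2 wnu1 wnu2 h1 h2 sAb s2).
Qed.

Definition coef_restr (S : pred int) h : R -> C := evT (fun k => if S k then fcoefth h k else 0).

Lemma inAf_proj S h : inAf h -> inAf (coef_restr S h) /\ forall k, fcoefth (coef_restr S h) k = if S k then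
    fcoefth h k else 0.
Proof.
move=> [L [l [[ch ph] L0 l0 hL [h1 h2]]]].
have le : (nZ (fun k => if S k then fcoefth h k else 0%R) <= L%:E)%E.
  apply: le_trans hL; apply: le_esum => k _; rewrite lee_fin.
  by case: ifP => _; rewrite ?cabs0 ?cabs_ge0.
have fin : (nZ (fun k => if S k then fcoefth h k else 0%R) < +oo)%E by exact: le_lt_trans le (ltry _).
have E k : fcoefth (coef_restr S h) k = if S k then fcoefth h k else 0 by exact: (fcoef_evT k fin).
split => //; exists L, l.
have [c1 p1 _] := Wf_evT fin.
have ale k : acoef (coef_restr S h) k <= acoef h k by rewrite /acoef E; case: ifP => _; rewrite ?cabs0 ?cabs_ge0.
have p := @acoef_ge0 _ (coef_restr S h); have ph0 := @acoef_ge0 _ h.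
split; [exact: (conj c1 p1)|exact: L0|exact: l0| |].
- by apply: le_trans le; apply: le_esum => k _; rewrite E.
- split; first exact: (pball_le yF1 wnu1 p ph0 l0 (lexx _) ale h1).
  exact: (pball_le yF2 wnu2 (nonneg_opp p) (nonneg_opp ph0) l0 (lexx _) (fun k => ale (- k)) h2).
Qed.

(** The coefficients of exp f - 1 are dominated by those of the powers f^n / n! with n >= 1, which
    are all supported in [S]. *)
Lemma exp_strict S f : add_closed S -> ~~ S 0 -> inAf f -> supp_in S f ->
  supp_in (fun k => S k || (k == 0)) (fun t => cexp (f t)) /\ fcoefth (fun t => cexp (f t)) 0 = 1.
Proof.
move=> SS S0 fA hf; have [D [h1 h2]] := exists_dbl; have cf := inAf_contper fA.
have [L [l fAb]] := fA; have [eA he] := Ab_exp yF1 yF2 wnu1 wnu2 h1 h2 fAb.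
have [ce pe] := inAf_contper eA.
have z k : ~~ S k -> fcoefth (fun t => cexp (f t) - 1) k = 0.
  move=> kS; apply: acoef_eq0; apply: le_trans (he k) _; rewrite esum1// => n _.
  rewrite /acoef (_ : (fun t => _) = fun t => (n.+1`!%:R)^-1 * f t ^+ n.+1); last first.
    by apply/funext => t; rewrite /expc mulrC.
  have [c1 _] := contperX n.+1 cf.
  by rewrite fcoefZ// (supp_pow n SS cf hf kS) mulr0 cabs0.
have E k : fcoefth (fun t => cexp (f t)) k = fcoefth (fun t => cexp (f t) - 1) k + (k == 0)%:R.
  rewrite fcoefB//; last exact: contC_cst.
  by rewrite fcoef_cst; case: eqP => _; rewrite ?subrK ?subr0 ?addr0.
split; last by rewrite E z// add0r.
by move=> k; rewrite negb_or => /andP[kS k0]; rewrite E z// (negbTE k0) addr0.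
Qed.

Let neg (k : int) := k < 0.
Let pos (k : int) := 0 < k.
Let neg0 : ~~ neg 0. Proof. by []. Qed.
Let pos0 : ~~ pos 0. Proof. by []. Qed.
Let negD : add_closed neg. Proof. by move=> i j; rewrite /neg; lia. Qed.
Let posD : add_closed pos. Proof. by move=> i j; rewrite /pos; lia. Qed.

(** The constant term of [g] is assigned entirely to the analytic factor, which fixes both zeroth
    coefficients and makes G(a) visible as that of [up]. *)
Lemma factorization f g : inAf f -> contper g -> (forall t, cexp (g t) = f t) ->
  exists um up : R -> C,
  [/\ forall t, f t = um t * up t, [/\ inAf um, inAf up, inAf (fun t => (um t)^-1) & inAf (fun t => (up t)^-1)],
    supp_in (fun k => k <= 0) um /\ supp_in (fun k => k <= 0) (fun t => (um t)^-1),
    supp_in (fun k => 0 <= k) up /\ supp_in (fun k => 0 <= k) (fun t => (up t)^-1) &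
    fcoefth um 0 = 1 /\ fcoefth up 0 = cexp (fcoefth g 0)].
Proof.
move=> fA cg gf; have gA := inAf_log fA cg gf.
have [lmA lmE] := inAf_proj neg gA; have [lpA lpE] := inAf_proj pos gA.
set lm := coef_restr neg g in lmA lmE; set lp := coef_restr pos g in lpA lpE.
have slm : supp_in neg lm by move=> k kS; rewrite lmE (negbTE kS).
have slp : supp_in pos lp by move=> k kS; rewrite lpE (negbTE kS).
have sN S h : contper h -> supp_in S h -> supp_in S (fun t => - h t).
  by move=> [ch _] hS k kS; rewrite fcoefN// hS// oppr0.
have [clm clp] := (inAf_contper lmA, inAf_contper lpA).
have gE : g = fun t => lm t + (fcoefth g 0 + lp t).
  have cc : contper (fun t => fcoefth g 0 + lp t) by apply: contperD clp; exact: contper_cst.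
  apply: (contper_eq cg (contperD clm cc)).
  have [[c1 _] [c2 _]] := (clm, clp).
  have c3 : contC (fun _ : R => fcoefth g 0) by exact: contC_cst.
  move=> k; rewrite (fcoefD k c1 (contCD c3 c2)) (fcoefD k c3 c2).
  rewrite lmE lpE fcoef_cst /neg /pos.
  by case: (ltrgtP k 0) => [||->]; rewrite ?addr0 ?add0r.
have subm : {subset (fun k => neg k || (k == 0)) <= (fun k : int => k <= 0)} by move=> k; rewrite /in_mem /= /neg; lia.
have subp : {subset (fun k => pos k || (k == 0)) <= (fun k : int => 0 <= k)} by move=> k; rewrite /in_mem /= /pos; lia.
have [m1 m2] := exp_strict negD neg0 lmA slm.
have [m3 _] := exp_strict negD neg0 (inAf_opp lmA) (sN _ _ clm slm).
have [p1 p2] := exp_strict posD pos0 lpA slp.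
have [p3 _] := exp_strict posD pos0 (inAf_opp lpA) (sN _ _ clp slp).
pose z := cexp (fcoefth g 0).
have EA := inAf_exp lmA; have PA := inAf_exp lpA.
have ENA := inAf_exp (inAf_opp lmA); have PNA := inAf_exp (inAf_opp lpA).
have iE h : (fun t => (cexp (h t))^-1) = fun t => cexp (- h t) by apply/funext => t; rewrite cexpN.
have izE h : (fun t => (z * cexp (h t))^-1) = fun t => z^-1 * cexp (- h t) by apply/funext => t; rewrite cexpN invfM.
exists (fun t => cexp (lm t)), (fun t => z * cexp (lp t)).
rewrite iE izE; split.
- by move=> t; rewrite -gf [in LHS]gE !cexpD.
- split; [exact: EA|exact: (inAf_mulr (inAf_cst z) PA)|exact: ENA|].
  exact: (inAf_mulr (inAf_cst z^-1) PNA).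
- by split; [exact: (supp_sub subm m1)|exact: (supp_sub subm m3)].
- have [c1 _] := inAf_contper PA; have [c2 _] := inAf_contper PNA.
  split; [exact: (supp_scale z c1 (supp_sub subp p1))|exact: (supp_scale z^-1 c2 (supp_sub subp p3))].
- have [c1 _] := inAf_contper PA.
  by rewrite m2 (fcoefZ _ _ c1) p2 mulr1.
Qed.

End Factorization.

(** * Uniqueness of the factorization up to constants *)

Section Uniqueness.
Variable R : realType.
Local Notation C := R[i].
Implicit Types (f g : R -> C).

Lemma fcoef0_mulN f g : contper f -> contper g ->
  supp_in (fun k => k <= 0) f -> supp_in (fun k => k <= 0) g ->
  fcoefth (fun t => f t * g t) 0 = fcoefth f 0 * fcoefth g 0.
Proof.
move=> cf cg sf sg; apply: (@fcoef0_mul _ (fun k => k < 0) f g _ _ cf cg) => //; first by move=> i j; lia.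
- by apply: supp_sub sf => k; rewrite /in_mem /=; lia.
- by apply: supp_sub sg => k; rewrite /in_mem /=; lia.
Qed.

Lemma fcoef0_mulP f g : contper f -> contper g ->
  supp_in (fun k => 0 <= k) f -> supp_in (fun k => 0 <= k) g ->
  fcoefth (fun t => f t * g t) 0 = fcoefth f 0 * fcoefth g 0.
Proof.
move=> cf cg sf sg; apply: (@fcoef0_mul _ (fun k => 0 < k) f g _ _ cf cg) => //; first by move=> i j; lia.
- by apply: supp_sub sf => k; rewrite /in_mem /=; lia.
- by apply: supp_sub sg => k; rewrite /in_mem /=; lia.
Qed.

(* [um / vm = vp / up] is both analytic and antianalytic, hence constant. *)
Lemma factorization_fcoef0 (um up vm vp iup ivm : R -> C) :
  contper um -> contper up -> contper vm -> contper vp -> contper iup -> contper ivm ->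
  (forall t, um t * up t = vm t * vp t) ->
  (forall t, up t * iup t = 1) -> (forall t, vm t * ivm t = 1) ->
  supp_in (fun k => k <= 0) um -> supp_in (fun k => k <= 0) vm -> supp_in (fun k => k <= 0) ivm ->
  supp_in (fun k => 0 <= k) up -> supp_in (fun k => 0 <= k) iup -> supp_in (fun k => 0 <= k) vp ->
  fcoefth um 0 * fcoefth up 0 = fcoefth vm 0 * fcoefth vp 0.
Proof.
move=> cum cup cvm cvp ciup civm e eup evm sum svm sivm sup siup svp.
have one0 : fcoefth (fun _ : R => 1 : C) 0 = 1 by rewrite fcoef_cst eqxx.
have up1 : fcoefth up 0 * fcoefth iup 0 = 1.
  by rewrite -(fcoef0_mulP cup ciup sup siup) (_ : (fun t => _) = fun=> 1)//; apply/funext => t; exact: eup.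
have vm1 : fcoefth vm 0 * fcoefth ivm 0 = 1.
  by rewrite -(fcoef0_mulN cvm civm svm sivm) (_ : (fun t => _) = fun=> 1)//; apply/funext => t; exact: evm.
have XE : (fun t => um t * ivm t) = fun t => vp t * iup t.
  apply/funext => t; rewrite -[um t]mulr1 -(eup t) mulrA e.
  rewrite -[RHS]mul1r -(evm t); ring.
have := congr1 (fun h => fcoefth h 0) XE; rewrite /= (fcoef0_mulN cum civm sum sivm) (fcoef0_mulP cvp ciup svp
    siup) => X0.
transitivity ((fcoefth um 0 * fcoefth ivm 0) * (fcoefth up 0 * fcoefth vm 0)).
  by rewrite -[LHS]mulr1 -vm1; ring.
by rewrite X0 -[RHS]mulr1 -up1; ring.
Qed.

End Uniqueness.

Section SupportProducts.
Variable R : realType.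
Local Notation C := R[i].
Implicit Types (f g h : R -> C) (S T U : pred int).

Lemma supp_mul2 S T U f g : (forall i j, S i -> T j -> U (i + j)) -> contper f -> contper g ->
  supp_in S f -> supp_in T g -> supp_in U (fun t => f t * g t).
Proof.
move=> STU [cf pf] [cg pg] hf hg k kS; apply: acoef_eq0.
apply: le_trans (fcoef_conv k cf pf cg pg) _; rewrite /convol esum1// => j _.
have [Sj|Sj] := boolP (S j); last by rewrite hf// cabs0 mul0r.
have [Skj|Skj] := boolP (T (k - j)); last by rewrite hg// cabs0 mulr0.
by have := STU _ _ Sj Skj; rewrite addrC subrK (negbTE kS).
Qed.

Lemma Wf_proj S h : Wf h -> Wf (coef_restr S h) /\ forall k, fcoefth (coef_restr S h) k = if S k then fcoefth h
    k else 0.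
Proof.
move=> [ch ph fh].
have fin : (nZ (fun k => if S k then fcoefth h k else 0%R) < +oo)%E.
  apply: le_lt_trans fh; apply: le_esum => k _; rewrite lee_fin.
  by case: ifP => _; rewrite ?cabs0 ?cabs_ge0.
split; first exact: Wf_evT.
by move=> k; exact: (fcoef_evT k fin).
Qed.

Lemma Wf_contper h : Wf h -> contper h.
Proof. by move=> [ch ph _]; split; [exact: ch|exact: ph]. Qed.

Lemma Wf_real h : Wf h -> exists2 B, 0 <= B & (nW h <= B%:E)%E.
Proof. by move=> [_ _ fh]; apply: esum_le_real fh => k; rewrite lee_fin cabs_ge0. Qed.

Lemma Wf_mul f g : Wf f -> Wf g -> Wf (fun t => f t * g t).
Proof.
move=> wf wg; have [[cf pf _] [cg pg _]] := (wf, wg).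
have [[B _ hB] [B' _ hB']] := (Wf_real wf, Wf_real wg).
split; [exact: contCM|exact: per2piM|].
exact: le_lt_trans (nW_mul cf pf cg pg hB hB') (ltry _).
Qed.

Lemma Wf_add f g : Wf f -> Wf g -> Wf (fun t => f t + g t).
Proof.
move=> wf wg; have [[cf pf _] [cg pg _]] := (wf, wg).
have [[B _ hB] [B' _ hB']] := (Wf_real wf, Wf_real wg).
split; [exact: contCD|exact: per2piD|].
exact: le_lt_trans (nW_add cf cg hB hB') (ltry _).
Qed.

Lemma Wf_fin h (M : nat) : contper h -> (forall k, (M < `|k|)%N -> fcoefth h k = 0) -> Wf h.
Proof.
move=> [ch ph] hM; have [B hB] := per_boundedC ch ph.
have B0 : 0 <= B by exact: le_trans (cabs_ge0 _) (hB 0).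
split; [exact: ch|exact: ph|].
have := @nW_fin _ h M (2 * B) _ hM (fun k => fcoef_bound k ch hB).
by rewrite mulr_ge0// => /(_ isT) h1; exact: le_lt_trans h1 (ltry _).
Qed.

Definition tpoly N (x : nat -> C) t : C := \sum_(j < N.+1) x j * expi (j%:~R * t).

Lemma contper_expi (k : int) : contper (fun t : R => expi (k%:~R * t)).
Proof. by split; [exact: contC_expiM|move=> t; rewrite mulrDr expiD expi_int2pi mulr1]. Qed.

Lemma contper_tpoly N x : contper (tpoly N x).
Proof.
split.
  by apply: contC_sum => j; apply: contCM; [exact: contC_cst|exact: contC_expiM].
by move=> t; apply: eq_bigr => j _; have [_ ->] := contper_expi j.
Qed.

Lemma fcoef_tpoly N x (k : int) : fcoefth (tpoly N x) k =
  if k is Posz n then if (n <= N)%N then x n else 0 else 0.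
Proof.
rewrite /tpoly fcoef_sum => [|j]; last by apply: contCM; [exact: contC_cst|exact: contC_expiM].
rewrite (eq_bigr (fun j : 'I_N.+1 => x j * (k == j%:Z)%:R)) => [|j _]; last first.
  by rewrite fcoefZ ?fcoef_expi//; exact: contC_expiM.
case: k => n; last by rewrite big1// => j _; rewrite mulr0.
case: leqP => nN; last first.
  rewrite big1// => j _; rewrite (_ : (_ == _) = false) ?mulr0//.
  by apply/negP => /eqP[nj]; have := ltn_ord j; rewrite -nj ltnNge; case/negP.
have nN' : (n < N.+1)%N by [].
rewrite (bigD1 (Ordinal nN'))//= eqxx mulr1 big1 ?addr0// => j jn.
rewrite (_ : (_ == _) = false) ?mulr0//.
by apply/negP => /eqP[nj]; move/eqP: jn; apply; apply: val_inj.
Qed.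

Lemma fcoef_mul_tpoly f N x k : contC f ->
  fcoefth (fun t => f t * tpoly N x t) k = \sum_(j < N.+1) x j * fcoefth f (k - j%:Z).
Proof.
move=> cf; rewrite (_ : (fun t => _) = fun t => \sum_(j < N.+1) x j * (f t * expi (j%:~R * t))); last first.
  by apply/funext => t; rewrite /tpoly mulr_sumr; apply: eq_bigr => j _; ring.
have c1 (j : 'I_N.+1) : contC (fun t => f t * expi (j%:~R * t)) by apply: contCM => //; exact: contC_expiM.
rewrite fcoef_sum => [|j]; last by apply: contCM => //; exact: contC_cst.
by apply: eq_bigr => j _; rewrite fcoefZ// fcoef_shift.
Qed.

End SupportProducts.

(** * Toeplitz systems *)

Section ToeplitzRelations.
Variable R : realType.
Local Notation C := R[i].
Variables um up ium iup : R -> C.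
Hypotheses (wum : Wf um) (wup : Wf up) (wium : Wf ium) (wiup : Wf iup).
Hypotheses (um1 : forall t, um t * ium t = 1) (up1 : forall t, up t * iup t = 1).
Hypotheses (sum_ : supp_in (fun k => k <= 0) um) (sium : supp_in (fun k => k <= 0) ium).
Hypotheses (sup_ : supp_in (fun k => 0 <= k) up) (siup : supp_in (fun k => 0 <= k) iup).

Definition symb t := um t * up t.
Definition symb_b t := um t * iup t.
Definition symb_c t := ium t * up t.

Lemma Wf_symb : Wf symb. Proof. exact: Wf_mul. Qed.
Lemma Wf_symb_b : Wf symb_b. Proof. exact: Wf_mul. Qed.
Lemma Wf_symb_c : Wf symb_c. Proof. exact: Wf_mul. Qed.

(** [cutb] and [cutc] are the moduli of the tails of b at plus infinity and of c at minus infinity.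
    Their end points, one weak and one strict, match the supports k > N of w and k <= s of u in
    [toeplitz_relations]. *)
Definition cutb (m : int) k : R := if m <= k then acoef symb_b k else 0.
Definition cutc (m : int) k : R := if k < - m then acoef symb_c k else 0.

Lemma cutb_ge0 m : nonneg (cutb m).
Proof. by move=> k; rewrite /cutb; case: ifP => _ //; exact: acoef_ge0. Qed.
Lemma cutc_ge0 m : nonneg (cutc m).
Proof. by move=> k; rewrite /cutc; case: ifP => _ //; exact: acoef_ge0. Qed.

(* Splitting [symb * X] into its parts of index [< 0], in [0, N] and [> N], one divides
   once by [um] and once by [up]. *)
Lemma toeplitz_relations N s x : (s <= N)%N ->
  (forall k : nat, (s < k <= N)%N -> fcoefth (fun t => symb t * tpoly N x t) k = 0) ->
  exists u w : R -> C,
  [/\ Wf u /\ Wf w,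
    (forall t, up t * tpoly N x t = u t + symb_c t * w t) /\
    (forall t, um t * tpoly N x t = symb_b t * u t + w t),
    supp_in (fun k => k <= s%:Z) u /\ supp_in (fun k => N%:Z < k) w,
    (forall k, k < 0 -> ((acoef u k)%:E <= convol (cutc N) (acoef w) k)%E) /\
    (forall k, ((acoef w k)%:E <= convol (cutb (N.+1%:Z - s%:Z)) (acoef u) k)%E) &
    forall k, 0 <= k -> fcoefth u k = fcoefth (fun t => ium t * tpoly s (fun j => fcoefth (fun t => symb t *
        tpoly N x t) j) t) k].
Proof.
move=> sN hx; have cX := contper_tpoly N x; set X := tpoly N x in hx cX *.
have wX : Wf X.
  apply: (@Wf_fin _ _ N) => //; case=> [n|n] /= nN; rewrite fcoef_tpoly//=.
  by rewrite leqNgt nN.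
have wfX : Wf (fun t => symb t * X t) by exact: (Wf_mul Wf_symb wX).
set fX := (fun t => symb t * X t) in hx wfX *.
pose Y := tpoly s (fun j => fcoefth fX j).
have cY := contper_tpoly s (fun j => fcoefth fX j); rewrite -/Y in cY.
have wY : Wf Y.
  apply: (@Wf_fin _ _ s) => //; case=> [n|n] /= nN; rewrite fcoef_tpoly//=.
  by rewrite leqNgt nN.
have [wG GE] := Wf_proj (fun k => N%:Z < k) wfX; set G := coef_restr _ _ in wG GE.
have [wM ME] := Wf_proj (fun k => k < 0) wfX; set Fm := coef_restr _ _ in wM ME.
have [[cG cM] cf] := (Wf_contper wG, Wf_contper wM, Wf_contper wfX).
have split_fX : fX = fun t => (Y t + Fm t) + G t.
  apply: (contper_eq cf (contperD (contperD cY cM) cG)) => k.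
  have [[[c1 _] [c2 _]] [c3 _]] := (cY, cM, cG).
  rewrite (fcoefD k (contCD c1 c2) c3) (fcoefD k c1 c2) GE ME /Y fcoef_tpoly.
  case: k => n; last by rewrite (_ : (N%:Z < Negz n) = false)// addr0 add0r.
  rewrite ltz_nat ltNge le0z_nat /= addr0; have [ns|sn] := leqP n s.
    by rewrite ltnNge (leq_trans ns sN) /= addr0.
  by rewrite add0r; case: ltnP => // nN; rewrite hx// sn.
(* The part of index at most s is divided by the antianalytic factor, the part beyond N by the
   analytic one, so that both quotients keep their one-sided supports. *)
pose u t := ium t * (Y t + Fm t); pose w t := iup t * G t.
have wu : Wf u by exact: (Wf_mul wium (Wf_add wY wM)).
have ww : Wf w by exact: (Wf_mul wiup wG).
have ium1 t : ium t * um t = 1 by rewrite mulrC.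
have iup1 t : iup t * up t = 1 by rewrite mulrC.
have r1 t : up t * X t = u t + symb_c t * w t.
  rewrite /u /w /symb_c.
  have -> : ium t * up t * (iup t * G t) = ium t * G t * (iup t * up t) by ring.
  rewrite iup1 mulr1 -mulrDr -[Y t + Fm t + G t]/((fun t => Y t + Fm t + G t) t) -split_fX /fX /symb.
  have -> : ium t * (um t * up t * X t) = (ium t * um t) * (up t * X t) by ring.
  by rewrite ium1 mul1r.
have r2 t : um t * X t = symb_b t * u t + w t.
  rewrite /u /w /symb_b.
  have -> : um t * iup t * (ium t * (Y t + Fm t)) = iup t * (Y t + Fm t) * (ium t * um t) by ring.
  rewrite ium1 mulr1 -mulrDr -[Y t + Fm t + G t]/((fun t => Y t + Fm t + G t) t) -split_fX /fX /symb.
  have -> : iup t * (um t * up t * X t) = (iup t * up t) * (um t * X t) by ring.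
  by rewrite iup1 mul1r.
have [cu cw] := (Wf_contper wu, Wf_contper ww).
have [cum cup] := (Wf_contper wum, Wf_contper wup).
have [cium ciup] := (Wf_contper wium, Wf_contper wiup).
have [cb cc] := (Wf_contper Wf_symb_b, Wf_contper Wf_symb_c).
have sG : supp_in (fun k => N%:Z < k) G by move=> k kN; rewrite GE (negbTE kN).
have sM : supp_in (fun k => k < 0) Fm by move=> k kN; rewrite ME (negbTE kN).
have sX : supp_in (fun k => 0 <= k) X by move=> [n|n]//= _; rewrite fcoef_tpoly.
have sX' : supp_in (fun k => k <= N%:Z) X.
  by move=> [n|n]//=; rewrite lez_nat fcoef_tpoly => /negbTE ->.
have sY : supp_in (fun k => k <= s%:Z) Y.
  by move=> [n|n]//=; rewrite lez_nat fcoef_tpoly => /negbTE ->.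
have sYM : supp_in (fun k => k <= s%:Z) (fun t => Y t + Fm t).
  have [[c1 _] [c2 _]] := (cY, cM); apply: supp_add => //.
  by apply: supp_sub sM => k; rewrite /in_mem /=; lia.
have su : supp_in (fun k => k <= s%:Z) u.
  by apply: supp_mul2 cium (contperD cY cM) sium sYM; move=> i j; lia.
have sw : supp_in (fun k => N%:Z < k) w.
  by apply: supp_mul2 ciup cG siup sG; move=> i j; lia.
have supX : supp_in (fun k => 0 <= k) (fun t => up t * X t).
  by apply: supp_mul2 cup cX sup_ sX; move=> i j; lia.
have sumX : supp_in (fun k => k <= N%:Z) (fun t => um t * X t).
  by apply: supp_mul2 cum cX sum_ sX'; move=> i j; lia.
have [[ccu pu] [ccw pw]] := (cu, cw); have [[ccb pb] [ccc pc]] := (cb, cc).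
exists u, w; split.
- by split; [exact: wu|exact: ww].
- by split; [exact: r1|exact: r2].
- by split; [exact: su|exact: sw].
- split=> k.
    (* [up X] has no negative frequencies, so u is given there by -c w; as w lives beyond N, only
       c_j with j < -N contribute. *)
    move=> k0; have e1 : fcoefth u k = - fcoefth (fun t => symb_c t * w t) k.
      have e2 : fcoefth (fun t => up t * X t) k = 0 by apply: supX; lia.
      move: e2; rewrite (_ : (fun t => _) = fun t => u t + symb_c t * w t); last exact/funext.
      rewrite fcoefD//; last exact: contCM.
      by move=> /eqP; rewrite addr_eq0 => /eqP.
    rewrite /acoef e1 cabsN; apply: le_trans (fcoef_conv k ccc pc ccw pw) _.
    apply: le_esum => j _; rewrite lee_fin /cutc -/(acoef symb_c j) -/(acoef w (k - j)).
    case: ifP => // jN; rewrite mul0r {2}/acoef sw ?cabs0 ?mulr0//; lia.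
  have [kN|kN] := leP k N%:Z.
    rewrite /acoef sw -?leNgt// cabs0; apply: esum_ge0 => j _.
    by rewrite lee_fin mulr_ge0 ?cutb_ge0 ?cabs_ge0.
  (* [um X] has no frequencies beyond N, so w is given there by -b u; as u lives on k <= s, only b_j
     with j >= N + 1 - s contribute. *)
  have e1 : fcoefth w k = - fcoefth (fun t => symb_b t * u t) k.
    have e2 : fcoefth (fun t => um t * X t) k = 0 by apply: sumX; lia.
    move: e2; rewrite (_ : (fun t => _) = fun t => symb_b t * u t + w t); last exact/funext.
    rewrite fcoefD//; last exact: contCM.
    by rewrite addrC => /eqP; rewrite addr_eq0 => /eqP.
  rewrite /acoef e1 cabsN; apply: le_trans (fcoef_conv k ccb pb ccu pu) _.
  apply: le_esum => j _; rewrite lee_fin /cutb -/(acoef symb_b j) -/(acoef u (k - j)).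
  case: ifP => // jN; rewrite mul0r {2}/acoef su ?cabs0 ?mulr0//; lia.
- move=> k k0; rewrite (_ : u = fun t => ium t * Y t + ium t * Fm t); last first.
    by apply/funext => t; rewrite /u mulrDr.
  have [[[c1 p1] [c2 p2]] [c3 p3]] := (cY, cM, cium).
  rewrite fcoefD; [|exact: contCM|exact: contCM].
  have -> : fcoefth (fun t => ium t * Fm t) k = 0.
    by apply: (@supp_mul2 _ _ _ (fun k => k < 0) _ _ _ cium cM sium sM); [move=> i j; lia|lia].
  by rewrite addr0.
Qed.

End ToeplitzRelations.

(** * Tails, contraction and determinant estimates *)

Section SequenceEstimates.
Variable R : realType.
Implicit Types (x y v : int -> R).

Lemma esum_tail_small x (e : R) : nonneg x -> (\esum_(k in [set: int]) (x k)%:E < +oo)%E -> 0 < e ->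
  exists m : nat, (\esum_(k in [set: int]) (if (m <= `|k|)%N then x k else 0)%:E <= e%:E)%E.
Proof.
move=> x0 ns e0; have c0 k : (0 <= (x k)%:E)%E by rewrite lee_fin.
set S := (\esum_(k in [set: int]) (x k)%:E)%E in ns *.
have S0 : (0 <= S)%E by exact: esum_ge0.
have [X [finX _] hX] : exists2 X, fsets [set: int] X & (S - e%:E < \sum_(k \in X) (x k)%:E)%E.
  have nf : S \is a fin_num by rewrite ge0_fin_numE.
  by have [_ [X fX <-] hX] := ub_ereal_sup_adherent e0 nf; exists X.
exists (\max_(k <- fset_set X) `|k|%N).+1.
apply: (@le_trans _ _ (\esum_(k in ~` X) (x k)%:E)%E).
  rewrite [leRHS]esum_mkcond; apply: le_esum => k _; rewrite in_setC.
  have [kX|kX] := boolP (k \in X); last by rewrite /= lee_fin; case: ifP.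
  rewrite ifF//= ltnNge; apply/negbTE; rewrite negbK.
  by apply: (@leq_bigmax_seq _ _ xpredT (fun k : int => `|k|%N)) => //; rewrite in_fset_set.
move: hX; rewrite -(esum_fset finX) => [hX|i _]; last exact: c0.
have E : S = (\esum_(k in X) (x k)%:E + \esum_(k in ~` X) (x k)%:E)%E.
  by rewrite /S (esumID X)// !setTI.
have A0 : (0 <= \esum_(k in X) (x k)%:E)%E by exact: esum_ge0.
have B0 : (0 <= \esum_(k in ~` X) (x k)%:E)%E by exact: esum_ge0.
rewrite E in ns hX; move: A0 B0 ns hX.
case: (\esum_(k in X) _)%E => [A| |]//; case: (\esum_(k in ~` X) _)%E => [B| |]//.
by rewrite -EFinD -EFinB lte_fin !lee_fin; lra.
Qed.

(** Substituting the second inequality into the first gives S <= V + S/2 for the sum S of x;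
    finiteness of S is assumed so that S/2 can be absorbed. *)
Lemma contraction_estimate x y v ct bt (V : R) : nonneg x -> nonneg y -> nonneg v -> nonneg ct -> nonneg bt ->
  (\esum_(k in [set: int]) (x k)%:E < +oo)%E ->
  (\esum_(k in [set: int]) (ct k)%:E <= 1)%E ->
  (\esum_(k in [set: int]) (bt k)%:E <= (2^-1)%:E)%E ->
  (\esum_(k in [set: int]) (v k)%:E <= V%:E)%E ->
  (forall k, ((x k)%:E <= (v k)%:E + convol ct y k)%E) ->
  (forall k, ((y k)%:E <= convol bt x k)%E) ->
  (\esum_(k in [set: int]) (x k)%:E <= (2 * V)%:E)%E.
Proof.
move=> x0 y0 v0 c0 b0 fx hc hb hv hx hy.
have xe0 k : (0 <= (x k)%:E)%E by rewrite lee_fin.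
have S0 : (0 <= \esum_(k in [set: int]) (x k)%:E)%E by exact: esum_ge0.
set S := (\esum_(k in [set: int]) (x k)%:E)%E in fx S0 *.
have SE : S = (fine S)%:E by rewrite fineK// ge0_fin_numE.
have hX : (\esum_(k in [set: int]) (x k)%:E <= (fine S)%:E)%E by rewrite -SE.
have hY : (\esum_(k in [set: int]) (y k)%:E <= (2^-1 * fine S)%:E)%E.
  by apply: le_trans (esum_conv_le b0 x0 hb hX); apply: le_esum => k _; exact: hy.
have hC := esum_conv_le c0 y0 hc hY.
have cv0 k : (0 <= convol ct y k)%E by apply: esum_ge0 => j _; rewrite lee_fin mulr_ge0.
have : (S <= V%:E + (1 * (2^-1 * fine S))%:E)%E.
  apply: le_trans (leeD hv hC); rewrite -esumD => [|k _|k _]; [|by rewrite lee_fin|exact: cv0].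
  by apply: le_esum => k _; exact: hx.
rewrite SE -EFinD !lee_fin => h; lra.
Qed.

Lemma bigmax_le_ereal n (F : 'I_n -> R) (B : \bar R) : (0 <= B)%E -> (forall i, ((F i)%:E <= B)%E) ->
  ((\big[Num.max/0]_(i < n) F i)%:E <= B)%E.
Proof.
move=> B0 hF; apply: (big_ind (fun z : R => (z%:E <= B)%E)) => // p q hp hq.
by rewrite /Num.max; case: ifP.
Qed.

Lemma bigmax_ge0 n (F : 'I_n -> R) : (forall i, 0 <= F i) -> 0 <= \big[Num.max/0]_(i < n) F i.
Proof.
move=> F0; apply: (big_ind (fun z : R => 0 <= z)) => // p q p0 q0.
by rewrite le_max p0.
Qed.

Lemma le_convol x x' y y' k : nonneg x -> nonneg y -> (forall k, x k <= x' k) -> (forall k, y k <= y' k) ->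
  (convol x y k <= convol x' y' k)%E.
Proof. by move=> x0 y0 xx yy; apply: le_esum => j _; rewrite lee_fin ler_pM. Qed.

Lemma convol_ge0 x y k : nonneg x -> nonneg y -> (0 <= convol x y k)%E.
Proof. by move=> x0 y0; apply: esum_ge0 => j _; rewrite lee_fin mulr_ge0. Qed.

Lemma det_bound n (A : 'M[R[i]]_n) (d : R) : (forall i j, cabs (A i j) <= d) ->
  cabs (\det A) <= n`!%:R * d ^+ n.
Proof.
move=> hA; rewrite /determinant (le_trans (cabs_sum _ _ _))//.
apply: (@le_trans _ _ (\sum_(s : 'S_n) d ^+ n)).
  apply: ler_sum => s _; rewrite cabsM cabsX cabsN cabs1 expr1n mul1r cabs_prod.
  apply: (@le_trans _ _ (\prod_(i < n) d)); last by rewrite prodr_const card_ord.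
  by apply: ler_prod => i _; rewrite cabs_ge0 hA.
by rewrite sumr_const card_Sn mulr_natl.
Qed.

End SequenceEstimates.

(** * Invertibility and uniform bounds for finite Toeplitz systems *)

Section ToeplitzSolutions.
Variable R : realType.
Local Notation C := R[i].
Variables um up ium iup : R -> C.
Hypotheses (wum : Wf um) (wup : Wf up) (wium : Wf ium) (wiup : Wf iup).
Hypotheses (um1 : forall t, um t * ium t = 1) (up1 : forall t, up t * iup t = 1).
Hypotheses (sum_ : supp_in (fun k => k <= 0) um) (sium : supp_in (fun k => k <= 0) ium).
Hypotheses (sup_ : supp_in (fun k => 0 <= k) up) (siup : supp_in (fun k => 0 <= k) iup).

Let f := symb um up.
Let b := symb_b um iup.
Let c := symb_c up ium.
Let cutB := cutb um iup.
Let cutC := cutc up ium.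
Let wf : Wf f. Proof. exact: (Wf_mul wum wup). Qed.
Let wb : Wf b. Proof. exact: (Wf_mul wum wiup). Qed.
Let wc : Wf c. Proof. exact: (Wf_mul wium wup). Qed.

(* With [N] beyond such an [m], [u] and [w] in [toeplitz_relations] solve a contractive system. *)
Definition small_tails (m : nat) :=
  (\esum_(k in [set: int]) (cutB m k)%:E <= (2^-1)%:E)%E /\ (\esum_(k in [set: int]) (cutC m k)%:E <= 1)%E.

Lemma cutB_anti (m m' k : int) : m <= m' -> cutB m' k <= cutB m k.
Proof.
move=> mm; rewrite /cutB /cutb; case: ifP => h1; case: ifP => h2 //; last exact: acoef_ge0.
by exfalso; move: h1 h2; lia.
Qed.

Lemma cutC_anti (m m' k : int) : m <= m' -> cutC m' k <= cutC m k.
Proof.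
move=> mm; rewrite /cutC /cutc; case: ifP => h1; case: ifP => h2 //; last exact: acoef_ge0.
by exfalso; move: h1 h2; lia.
Qed.

Lemma exists_small_tails : exists m0 : nat, forall m : nat, (m0 <= m)%N -> small_tails m.
Proof.
have [_ _ fb] := wb; have [_ _ fc] := wc.
have h2 : 0 < 2^-1 :> R by [].
have [m1 hm1] := esum_tail_small (@acoef_ge0 _ b) fb h2.
have [m2 hm2] := esum_tail_small (@acoef_ge0 _ c) fc ltr01.
exists (maxn m1 m2) => m; rewrite geq_max => /andP[m1m m2m]; split.
- apply: le_trans hm1; apply: le_esum => k _; rewrite lee_fin /cutB /cutb.
  case: ifP => mk; last by case: ifP => _ //; exact: acoef_ge0.
  by rewrite ifT//; move: m1m mk; lia.
- apply: le_trans hm2; apply: le_esum => k _; rewrite lee_fin /cutC /cutc.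
  case: ifP => mk; last by case: ifP => _ //; exact: acoef_ge0.
  by rewrite ifT//; move: m2m mk; lia.
Qed.

Lemma small_tailsW m (m' : int) : small_tails m -> m%:Z <= m' ->
  (\esum_(k in [set: int]) (cutB m' k)%:E <= (2^-1)%:E)%E /\ (\esum_(k in [set: int]) (cutC m' k)%:E <= 1)%E.
Proof.
move=> [h1 h2] mm; split.
- by apply: le_trans h1; apply: le_esum => k _; rewrite lee_fin; exact: cutB_anti.
- by apply: le_trans h2; apply: le_esum => k _; rewrite lee_fin; exact: cutC_anti.
Qed.

Definition toepmx N : 'M[C]_N.+1 := \matrix_(j < N.+1, k < N.+1) fcoefth f (j%:Z - k%:Z).

Definition seqof N (v : 'cV[C]_N.+1) (j : nat) : C := v (inord j) 0.

Lemma toepmx_mul N (v : 'cV[C]_N.+1) (j : 'I_N.+1) :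
  (toepmx N *m v) j 0 = fcoefth (fun t => f t * tpoly N (seqof v) t) j.
Proof.
rewrite fcoef_mul_tpoly; last by case: wf.
rewrite mxE; apply: eq_bigr => k _; rewrite mxE /seqof inord_val mulrC; congr (_ * _).
Qed.

Lemma nW0_eq0 (h : R -> C) : Wf h -> (nW h <= 0)%E -> forall t, h t = 0.
Proof.
move=> wh h0 t; have := le_trans (sup_le_nW t wh) h0.
by rewrite lee_fin => h1; apply: cabs_eq0; apply/eqP; rewrite eq_le h1 cabs_ge0.
Qed.

(** For a kernel vector the contraction holds with V = 0 and forces u = 0, hence w = 0; then [up X]
    vanishes and so does X, [up] being invertible. *)
Lemma toepmx_unit m N : small_tails m -> (m <= N)%N -> toepmx N \in unitmx.
Proof.
move=> st mN; rewrite unitmxE unitfE; apply/negP => /eqP d0.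
have /det0P[v v0 vA] : \det (toepmx N)^T == 0 by rewrite det_tr d0.
have Av : toepmx N *m v^T = 0 by apply: trmx_inj; rewrite trmx_mul trmxK vA trmx0.
pose x := seqof v^T.
have hx (k : nat) : (k <= N)%N -> fcoefth (fun t => f t * tpoly N x t) k = 0.
  move=> kN; have := toepmx_mul v^T (Ordinal (kN : (k < N.+1)%N)).
  by rewrite Av mxE => <-.
have [|u [w [[wu ww] [r1 r2] [su sw] [R1 R2] R3]]] :=
  @toeplitz_relations _ um up ium iup wum wup wium wiup um1 up1 sum_ sium sup_ siup N 0 x (leq0n N).
  by move=> k /andP[_]; exact: hx.
have mN1z : m%:Z <= N.+1%:Z - 0%:Z by rewrite subr0 lez_nat leqW.
have t1 := (small_tailsW st mN1z).1.
have mNz : m%:Z <= N%:Z by rewrite lez_nat.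
have t3 := (small_tailsW st mNz).2.
have u0 : (nW u <= (2 * 0)%:E)%E.
  apply: (@contraction_estimate _ (acoef u) (acoef w) (fun=> 0) (cutC N) (cutB (N.+1%:Z - 0%:Z)) 0) => //.
  - exact: acoef_ge0.
  - exact: acoef_ge0.
  - exact: cutc_ge0.
  - exact: cutb_ge0.
  - by case: wu.
  - by rewrite esum1.
  - move=> k; rewrite add0e; have [k0|k0] := ltP k 0; first exact: R1.
    rewrite /acoef R3// (_ : (fun t => _) = fun=> 0); last first.
      by apply/funext => t; rewrite /tpoly big_ord1 hx// mul0r mulr0.
    rewrite fcoef_cst; case: ifP => _; rewrite cabs0;
    by apply: convol_ge0; [exact: cutc_ge0|exact: acoef_ge0].
rewrite mulr0 in u0.
have uz := nW0_eq0 wu u0.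
have wz : forall t, w t = 0.
  apply: (nW0_eq0 ww); rewrite /nW /nZ esum1// => k _; apply/eqP; rewrite eq_le; apply/andP; split; last by
      rewrite lee_fin cabs_ge0.
  apply: le_trans (R2 k) _; rewrite /convol esum1// => j _; rewrite /acoef.
  by rewrite (_ : u = fun=> 0) ?fcoef_cst; [case: ifP => _; rewrite cabs0 mulr0|apply/funext].
have Xz t : tpoly N x t = 0.
  have := r1 t; rewrite uz wz mulr0 addr0 => h.
  by rewrite -[LHS]mul1r -(up1 t) [up t * _]mulrC -mulrA h mulr0.
move/eqP: v0; apply; apply/rowP => j; rewrite mxE.
have := fcoef_tpoly N x j; rewrite -ltnS ltn_ord /x /seqof inord_val mxE => <-.
by rewrite (_ : tpoly N _ = fun=> 0) ?fcoef_cst; [case: ifP|apply/funext].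
Qed.

(** At non-negative indices u has the coefficients of e^(ist) times [ium], whatever N is, so
    contraction gives the bound 2 V. The margin m + s <= N keeps the relevant tail of b, starting at
    N + 1 - s, beyond m. *)
Lemma toeplitz_solution m N s V : small_tails m -> (m + s <= N)%N -> (nW ium <= V%:E)%E ->
  exists x u w, [/\ toepmx N *m \col_j x (val j) = \col_j ((val j == s)%:R),
    (forall k, ((acoef u k)%:E <= (acoef ium (k - s%:Z))%:E + convol (cutC N) (acoef w) k)%E) /\
    (forall k, ((acoef w k)%:E <= convol (cutB (N.+1%:Z - s%:Z)) (acoef u) k)%E),
    [/\ Wf u, Wf w & (nW u <= (2 * V)%:E)%E],
    (forall t, up t * tpoly N x t = u t + c t * w t) /\
    (forall t, um t * tpoly N x t = b t * u t + w t) &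
    [/\ supp_in (fun k => k <= s%:Z) u, supp_in (fun k => N%:Z < k) w & fcoefth u 0 = fcoefth ium (- s%:Z)]].
Proof.
move=> st mN hV; have mN' : (m <= N)%N by apply: leq_trans mN; rewrite leq_addr.
have uA := toepmx_unit st mN'.
pose v := invmx (toepmx N) *m (\col_(j < N.+1) ((val j == s)%:R : C)).
have Av : toepmx N *m v = \col_(j < N.+1) ((val j == s)%:R) by rewrite mulmxA mulmxV// mul1mx.
have vx : v = \col_(j < N.+1) seqof v (val j).
  by apply/colP => j; rewrite [RHS]mxE /seqof inord_val.
have hx (k : nat) : (k <= N)%N -> fcoefth (fun t => f t * tpoly N (seqof v) t) k = (k == s)%:R.
  move=> kN; have := toepmx_mul v (Ordinal (kN : (k < N.+1)%N)).
  by rewrite Av mxE => <-.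
have sN : (s <= N)%N by apply: leq_trans mN; rewrite leq_addl.
have [|u [w [[wu ww] [r1 r2] [su sw] [R1 R2] R3]]] :=
  @toeplitz_relations _ um up ium iup wum wup wium wiup um1 up1 sum_ sium sup_ siup N s (seqof v) sN.
  by move=> k /andP[sk kN]; rewrite hx// gtn_eqF.
have R3' k : 0 <= k -> fcoefth u k = fcoefth ium (k - s%:Z).
  move=> k0; rewrite R3// -fcoef_shift; congr (fcoefth _ k); apply/funext => t.
  congr (_ * _); rewrite /tpoly big_ord_recr /= big1 ?add0r => [|j _].
    by rewrite hx// eqxx mul1r.
  have js : (j < s)%N by [].
  by rewrite hx ?ltn_eqF ?mul0r// (leq_trans (ltnW js)).
have h1 k : ((acoef u k)%:E <= (acoef ium (k - s%:Z))%:E + convol (cutC N) (acoef w) k)%E.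
  have cv0 : (0 <= convol (cutC N) (acoef w) k)%E.
    by apply: convol_ge0; [exact: cutc_ge0|exact: acoef_ge0].
  have [k0|k0] := ltP k 0; first by apply: le_trans (R1 k k0) _; rewrite leeDr// lee_fin cabs_ge0.
  by rewrite {1}/acoef R3'// leeDl.
have mN1z : m%:Z <= N.+1%:Z - s%:Z by move: mN; lia.
have t1 := (small_tailsW st mN1z).1.
have mNz : m%:Z <= N%:Z by rewrite lez_nat.
have t3 := (small_tailsW st mNz).2.
exists (seqof v), u, w; split.
- by rewrite -vx Av.
- by split; [exact: h1|exact: R2].
- split; [exact: wu|exact: ww|].
  have vn : nonneg (fun k => acoef ium (k - s%:Z)) by move=> k; exact: acoef_ge0.
  have hv : (\esum_(k in [set: int]) (acoef ium (k - s%:Z))%:E <= V%:E)%E.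
    rewrite -(@esum_reindex_bij _ _ _ (fun k => k - s%:Z) (fun k => (acoef ium k)%:E))//.
    by exists (fun k => k + s%:Z) => k; rewrite ?subrK ?addrK.
  have fu : (nW u < +oo)%E by case: wu.
  exact: (contraction_estimate (@acoef_ge0 _ u) (@acoef_ge0 _ w) vn (@cutc_ge0 _ up ium N)
    (@cutb_ge0 _ um iup _) fu t3 t1 hv h1 R2).
- by split; [exact: r1|exact: r2].
- by split; [exact: su|exact: sw|rewrite R3'// sub0r].
Qed.

End ToeplitzSolutions.

Section Recursion.
Variable R : realType.

(** Once e_i <= 1/2 one has 1/(1 - e_i) <= 1 + 2 e_i <= exp (2 e_i), so the product of the growth
    factors is at most exp (2 S). The finitely many earlier terms are bounded by their sum. *)
Lemma product_recursion_bounded (d e : nat -> R) (S : R) : (forall i, 0 <= d i) -> (forall i, 0 <= e i) ->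
  (forall n, \sum_(i < n) e i <= S) -> (forall i, d i.+1 * (1 - e i) <= d i) ->
  exists2 B, 0 <= B & forall i, d i <= B.
Proof.
move=> d0 e0 hS rec.
have [n1 hn1] : exists n1, forall n, (n1 <= n)%N -> e n <= 2^-1.
  have cs : cvgn (series e).
    apply: nondecreasing_is_cvgn; first by apply: nondecreasing_series => n _ _; exact: e0.
    by exists S => _ [n _ <-]; rewrite /series /= big_mkord.
  have h2 : 0 < 2^-1 :> R by [].
  have /cvgrPdist_le/(_ _ h2) [n1 _ hn1] := cvg_series_cvg_0 cs; exists n1 => n /hn1 /=.
  by rewrite sub0r normrN ger0_norm.
have S0 : 0 <= S by have := hS 0%N; rewrite big_ord0.
have bound k : d (n1 + k)%N <= d n1 * expR (2 * \sum_(n1 <= i < n1 + k) e i).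
  elim: k => [|k IH]; first by rewrite addn0 big_geq// mulr0 expR0 mulr1.
  rewrite addnS big_nat_recr ?leq_addr//= mulrDr expRD mulrA.
  have ek := hn1 (n1 + k)%N (leq_addr _ _); have ek0 := e0 (n1 + k)%N.
  have h1 : d (n1 + k).+1 <= d (n1 + k)%N * (1 + 2 * e (n1 + k)%N).
    have := rec (n1 + k)%N; have := d0 (n1 + k).+1; set D := d _; set E := e _ in ek ek0 *.
    move=> D0 hrec; have p1 : 0 <= 1 + 2 * E by lra.
    have := ler_wpM2r p1 hrec; have : 0 <= D * (E * (1 - 2 * E)) by rewrite !mulr_ge0//; lra.
    nra.
  apply: le_trans h1 _; apply: ler_pM => //; first by lra.
  exact: expR_ge1Dx.
exists (\sum_(i < n1) d i + d n1 * expR (2 * S)).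
  by rewrite addr_ge0 ?sumr_ge0// mulr_ge0// expR_ge0.
move=> i; have [n1i|in1] := leqP n1 i.
  rewrite -(subnKC n1i); apply: le_trans (bound _) _.
  apply: (@le_trans _ _ (d n1 * expR (2 * S))); last by rewrite lerDr sumr_ge0.
  rewrite ler_wpM2l// ler_expR ler_pM2l//; apply: le_trans (hS (n1 + (i - n1))%N).
  rewrite -(big_mkord xpredT e) [leRHS](big_cat_nat (n := n1)) ?leq_addr//= lerDr.
  by apply: sumr_ge0.
rewrite (bigD1 (Ordinal in1))//= -addrA lerDl addr_ge0 ?sumr_ge0// mulr_ge0// expR_ge0.
Qed.

End Recursion.

(** * Summability of the defects *)

Section ToeplitzAsymptotics.
Variable R : realType.
Local Notation C := R[i].
Variables um up ium iup : R -> C.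
Hypotheses (wum : Wf um) (wup : Wf up) (wium : Wf ium) (wiup : Wf iup).
Hypotheses (um1 : forall t, um t * ium t = 1) (up1 : forall t, up t * iup t = 1).
Hypotheses (sum_ : supp_in (fun k => k <= 0) um) (sium : supp_in (fun k => k <= 0) ium).
Hypotheses (sup_ : supp_in (fun k => 0 <= k) up) (siup : supp_in (fun k => 0 <= k) iup).

Let b := symb_b um iup.
Let c := symb_c up ium.
Let cutB := cutb um iup.
Let cutC := cutc up ium.
Let wb : Wf b. Proof. exact: (Wf_mul wum wiup). Qed.
Let wc : Wf c. Proof. exact: (Wf_mul wium wup). Qed.

Variable Bc : R.
Hypothesis hBc : forall i : nat,
  (\esum_(j in [set: nat]) (j%:R * acoef c (- j%:Z) * acoef b (j%:Z + i%:Z))%:E <= Bc%:E)%E.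
Variable V : R.
Hypothesis hV : (nW ium <= V%:E)%E.

(** All [u i] with i < n are replaced by their pointwise maximum U, whose l^1 norm is at most 2 V
    independently of n. The defect of index i involves only c_(-j) with j > m + i, so summing over i
    produces the factor j that [hBc] controls. *)
Lemma sum_defect_le (m : nat) (u w : nat -> R -> C) : small_tails um up ium iup m ->
  (forall i k, ((acoef (u i) k)%:E <= (acoef ium k)%:E + convol (cutC (m + i)%:Z) (acoef (w i)) k)%E) ->
  (forall i k, ((acoef (w i) k)%:E <= convol (cutB (m + i).+1%:Z) (acoef (u i)) k)%E) ->
  (forall i, contper (w i)) -> (forall i, (nW (u i) <= (2 * V)%:E)%E) ->
  (forall i, supp_in (fun k => k <= 0) (u i)) -> (forall i, supp_in (fun k => (m + i)%:Z < k) (w i)) ->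
  forall n, \sum_(i < n) acoef (fun t => c t * w i t) 0 <= Bc * (2 * V).
Proof.
move=> st H1 H2 cw uV su sw n.
pose U k := \big[Num.max/0]_(i < n) acoef (u i) k.
pose Wm k := \big[Num.max/0]_(i < n) acoef (w i) k.
have U0 : nonneg U by move=> k; apply: bigmax_ge0 => i; exact: acoef_ge0.
have W0 : nonneg Wm by move=> k; apply: bigmax_ge0 => i; exact: acoef_ge0.
have uU (i : 'I_n) k : acoef (u i) k <= U k by exact: (le_bigmax _ (fun i : 'I_n => acoef (u i) k) i).
have wW (i : 'I_n) k : acoef (w i) k <= Wm k by exact: (le_bigmax _ (fun i : 'I_n => acoef (w i) k) i).
have cC k : nonneg (cutC k) by exact: cutc_ge0.
have cB k : nonneg (cutB k) by exact: cutb_ge0.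
(* This bound grows with n; it only supplies the finiteness that the contraction estimate
   requires. *)
have Ufin : (\esum_(k in [set: int]) (U k)%:E < +oo)%E.
  apply: (@le_lt_trans _ _ (\sum_(i < n) 2 * V)%:E); last exact: ltry.
  apply: (@le_trans _ _ (\esum_(k in [set: int]) \sum_(i < n) (acoef (u i) k)%:E)%E).
    apply: le_esum => k _; apply: bigmax_le_ereal.
      by apply: sume_ge0 => i _; rewrite lee_fin acoef_ge0.
    move=> i; rewrite sumEFin lee_fin (bigD1 i)//= lerDl.
    by apply: sumr_ge0 => j _; exact: acoef_ge0.
  rewrite esum_sum => [|k i _ _]; last by rewrite lee_fin acoef_ge0.
  by rewrite -sumEFin; apply: lee_sum => i _; exact: uV.
have [t1 t2] := st.
have tB : (\esum_(k in [set: int]) (cutB m.+1%:Z k)%:E <= (2^-1)%:E)%E.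
  by apply: le_trans t1; apply: le_esum => k _; rewrite lee_fin; apply: cutB_anti; lia.
(* Both inequalities survive the maximum because the tails shrink as i grows, so those for i = 0
   serve every i. *)
have hU : (\esum_(k in [set: int]) (U k)%:E <= (2 * V)%:E)%E.
  apply: (contraction_estimate U0 W0 (@acoef_ge0 _ ium) (cC m%:Z) (cB m.+1%:Z) Ufin t2 tB hV).
  - move=> k; apply: bigmax_le_ereal.
      by apply: adde_ge0; [rewrite lee_fin acoef_ge0|apply: convol_ge0].
    move=> i; apply: le_trans (H1 i k) _; apply: leeD => //.
    apply: le_convol => //; first exact: acoef_ge0.
    by move=> k'; apply: cutC_anti; rewrite lez_nat leq_addr.
  - move=> k; apply: bigmax_le_ereal; first exact: convol_ge0.
    move=> i; apply: le_trans (H2 i k) _.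
    apply: le_convol => //; first exact: acoef_ge0.
    by move=> k'; apply: cutB_anti; rewrite lez_nat ltnS leq_addr.
have [[cc pc] [cb pb]] := (Wf_contper wc, Wf_contper wb).
have E2 (i : 'I_n) (j : nat) : ((acoef (w i) j%:Z)%:E <= \esum_(l in [set: nat]) (acoef b (j%:Z + l%:Z) * U (-
    l%:Z))%:E)%E.
  apply: le_trans (H2 i j%:Z) _; rewrite /convol.
  rewrite (@esum_reindex_bij _ _ _ (fun l : int => j%:Z + l)); last first.
    by exists (fun l => l - j%:Z) => l; clear; lia.
  rewrite esum_intE => [|k]; last by rewrite lee_fin; apply: mulr_ge0; [exact: cB|exact: acoef_ge0].
  rewrite [X in (_ + X)%E]esum1 => [|l _]; last first.
    by rewrite [acoef (u i) _]/acoef su ?cabs0 ?mulr0//; lia.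
  rewrite adde0; apply: le_esum => l _; rewrite lee_fin.
  apply: ler_pM; [exact: cB|exact: acoef_ge0| |].
    by rewrite /cutB /cutb; case: ifP => _ //; exact: acoef_ge0.
  have -> : j%:Z - (j%:Z + l%:Z) = - l%:Z by clear; lia.
  exact: uU.
have E1 (i : 'I_n) : ((acoef (fun t => c t * w i t)%R 0)%:E <=
    \esum_(j in [set: nat]) \esum_(l in [set: nat]) ((m + i < j)%N%:R * (acoef c (- j%:Z) * acoef b (j%:Z +
        l%:Z)) * U (- l%:Z))%:E)%E.
  have [ccw pw] := cw i.
  apply: le_trans (fcoef_conv 0 cc pc ccw pw) _; rewrite /convol -esum_opp.
  rewrite esum_intE => [|k]; last by rewrite lee_fin; apply: mulr_ge0; exact: cabs_ge0.
  rewrite [X in (_ + X)%E]esum1 => [|l _]; last first.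
    by rewrite (_ : cabs (fcoefth (w i) _) = 0) ?mulr0// sw ?cabs0 ?mulr0//; lia.
  rewrite adde0; apply: le_esum => j _; rewrite sub0r opprK -/(acoef (w i) j%:Z) -/(acoef c _).
  have [mij|jmi] := ltnP (m + i) j; last first.
    rewrite [acoef (w i) _]/acoef sw ?cabs0 ?mulr0; last by rewrite ltz_nat -leqNgt.
    by apply: esum_ge0 => l _; rewrite !mul0r.
  rewrite EFinM; apply: (@le_trans _ _ ((acoef c (- j%:Z))%:E * \esum_(l in [set: nat]) (acoef b (j%:Z + l%:Z)
      * U (- l%:Z))%:E)%E).
    by apply: lee_wpmul2l; [rewrite lee_fin acoef_ge0|exact: E2].
  rewrite -esumZ ?acoef_ge0// => [|l]; last by rewrite lee_fin mulr_ge0// acoef_ge0.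
  by apply: le_esum => l _; rewrite -EFinM lee_fin mul1r mulrA.
have q0 (i : nat) (j l : nat) : 0 <= (m + i < j)%N%:R * (acoef c (- j%:Z) * acoef b (j%:Z + l%:Z)) * U (- l%:Z).
  by rewrite !mulr_ge0// acoef_ge0.
have p0 (j l : nat) : 0 <= j%:R * acoef c (- j%:Z) * acoef b (j%:Z + l%:Z).
  by rewrite !mulr_ge0// acoef_ge0.
rewrite -lee_fin -sumEFin.
apply: (@le_trans _ _ (\sum_(i < n) \esum_(j in [set: nat]) \esum_(l in [set: nat]) ((m + i < j)%N%:R * (acoef
    c (- j%:Z) * acoef b (j%:Z + l%:Z)) * U (- l%:Z))%:E)%E).
  by apply: lee_sum => i _; exact: E1.
rewrite -esum_sum => [|j i _ _]; last by apply: esum_ge0 => l _; rewrite lee_fin.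
apply: (@le_trans _ _ (\esum_(j in [set: nat]) \esum_(l in [set: nat]) (U (- l%:Z) * (j%:R * acoef c (- j%:Z) *
    acoef b (j%:Z + l%:Z)))%:E)%E).
  apply: le_esum => j _; rewrite -esum_sum => [|l i _ _]; last by rewrite lee_fin.
  apply: le_esum => l _; rewrite sumEFin lee_fin -!mulr_suml mulrC ler_wpM2l// -mulrA ler_wpM2r ?mulr_ge0 ?acoef_ge0//.
  rewrite -natr_sum ler_nat.
  (* At most j indices i satisfy m + i < j; this count is the weight j in [hBc]. *)
  have cnt k : (\sum_(i < k) (m + i < j) <= minn k j)%N.
    elim: k => [|k IH]; first by rewrite big_ord0.
    rewrite big_ord_recr /=; move: IH; set S := (\sum_(i < k) _)%N; move: S => S.
    by case: (ltnP (m + k) j) => h1 h2 /=; move: h1 h2; clear; lia.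
  by apply: leq_trans (cnt n) _; exact: geq_minr.
rewrite esum_swap => [|j l]; last by rewrite lee_fin mulr_ge0.
apply: (@le_trans _ _ (\esum_(l in [set: nat]) (Bc%:E * (U (- l%:Z))%:E))%E).
  apply: le_esum => l _; rewrite muleC.
  have p0' j : (0 <= (j%:R * acoef c (- j%:Z) * acoef b (j%:Z + l%:Z))%:E)%E by rewrite lee_fin.
  apply: (@le_trans _ _ (\esum_(j in [set: nat]) ((U (- l%:Z))%:E * (j%:R * acoef c (- j%:Z) * acoef b (j%:Z +
      l%:Z))%:E))%E).
    by apply: le_esum => j _; rewrite EFinM.
  by rewrite (esumZ (U0 _) p0'); apply: lee_wpmul2l; [rewrite lee_fin|exact: hBc].
have Bc0 : 0 <= Bc.
  by rewrite -lee_fin; apply: le_trans (hBc 0); apply: esum_ge0 => j _; rewrite lee_fin.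
rewrite esumZ// => [|l]; last by rewrite lee_fin.
rewrite EFinM; apply: lee_wpmul2l; first by rewrite lee_fin.
apply: le_trans hU; rewrite -esum_opp esum_intE => [|k]; last by rewrite lee_fin.
by rewrite leeDl// esum_ge0// => l _; rewrite lee_fin.
Qed.

End ToeplitzAsymptotics.

(** * Toeplitz determinants *)

Section DeterminantIdentities.
Variable R : realType.
Local Notation C := R[i].
Implicit Types (a : int -> C).

Definition toep a N : 'M[C]_N.+1 := \matrix_(j < N.+1, k < N.+1) a (j%:Z - k%:Z).

(** Cramer's rule: deleting the first row and column of a Toeplitz matrix leaves the Toeplitz matrix
    of one order less. *)
Lemma toep_first_entry a N (x : nat -> C) :
  toep a N.+1 *m \col_j x (val j) = \col_j ((val j == 0)%N%:R) ->
  \det (toep a N.+1) * x 0%N = \det (toep a N).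
Proof.
move=> Tx; set T := toep a N.+1 in Tx *.
have h : \adj T *m (T *m \col_j x (val j)) = \det T *: \col_j x (val j).
  by rewrite mulmxA mul_adj_mx mul_scalar_mx.
have := congr1 (fun v : 'cV_N.+2 => v ord0 0) h.
rewrite Tx [RHS]mxE [X in _ = _ * X]mxE /= => <-.
rewrite mxE (bigD1 ord0) //= [X in _ * X]mxE /= mulr1 big1 ?addr0 => [|j j0]; last first.
  rewrite [X in _ * X]mxE (_ : (_ == _) = false) ?mulr0//.
  by apply/negP => /eqP e; move/eqP: j0; apply; apply: val_inj.
rewrite [\adj T _ _]mxE /cofactor addn0 expr0 mul1r.
congr (\det _); apply/matrixP => i j.
by rewrite !mxE; congr a; rewrite /= /bump /=; lia.
Qed.

(* Jacobi's identity on complementary minors, with the rows of the large matrix rotated so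
   that the wanted minor becomes its upper left block. *)
Lemma toep_shifted_minor a n K (X : 'M[C]_(n.+1 + K, K)) :
  toep a (n + K) *m X = \matrix_(j, s) ((val j == val s)%:R) ->
  cabs (\det (toep (fun k => a (k + K%:Z)) n)) = cabs (\det (toep a (n + K))) * cabs (\det (dsubmx X)).
Proof.
move=> TX; pose T : 'M[C]_(n.+1 + K) := toep a (n + K).
have lt_rot (j : 'I_(n.+1 + K)) : ((j + K) %% (n.+1 + K) < n.+1 + K)%N by rewrite ltn_mod.
pose rot (j : 'I_(n.+1 + K)) := Ordinal (lt_rot j).
have rot_inj : injective rot.
  move=> j k /(congr1 val) /= /eqP; rewrite eqn_modDr => /eqP.
  by rewrite !modn_small// => /val_inj.
pose s := perm rot_inj.
pose T' := row_perm s T.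
have T'X : T' *m X = col_mx 0 1%:M.
  rewrite /T' row_permE -mulmxA TX -row_permE; apply/matrixP => j k.
  rewrite !mxE permE; case: splitP => i ji; rewrite !mxE /=.
    rewrite (_ : (_ == _) = false)//; apply/negP => /eqP.
    rewrite ji modn_small; last by rewrite ltn_add2r.
    by have := ltn_ord k; lia.
  have -> : ((j + K) %% (n.+1 + K) = i)%N.
    rewrite ji -addnA [(i + K)%N]addnC addnA modnDl; apply: modn_small.
    by apply: leq_trans (ltn_ord i) _; exact: leq_addl.
  by [].
(* Determinants of both sides give det T' * det (dsubmx X) = det (ulsubmx T'), and the upper left
   block is the shifted Toeplitz matrix. *)
have blk : T' *m block_mx 1%:M (usubmx X) 0 (dsubmx X) = block_mx (ulsubmx T') 0 (dlsubmx T') 1%:M.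
  have := T'X; rewrite -{1}(vsubmxK X) -{1 2}(submxK T') !mulmx_block mul_block_col.
  rewrite !mulmx1 !mulmx0 !addr0 => h.
  have [h1 h2] := eq_col_mx h.
  by rewrite h1 h2.
have := congr1 (fun M => cabs (\det M)) blk.
rewrite det_mulmx det_ublock det_lblock !det1 mul1r mulr1 cabsM.
have -> : cabs (\det T') = cabs (\det (toep a (n + K))).
  by rewrite /T' row_permE det_mulmx det_perm cabsM cabsX cabsN cabs1 expr1n mul1r.
move=> ->; congr (cabs (\det _)); apply/matrixP => i j; rewrite !mxE permE.
rewrite /= modn_small ?ltn_add2r//; congr a; lia.
Qed.

End DeterminantIdentities.

(** Only the coefficients of [g] from p - s onwards meet the support of [f]. *)
Lemma acoef_mul_le (R : realType) (f g : R -> R[i]) (s p : int) (A B : R) :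
  contper f -> contper g -> (nW f <= A%:E)%E -> supp_in (fun k => k <= s) f -> 0 <= B ->
  (forall q, p - s <= q -> acoef g q <= B) -> acoef (fun t => f t * g t) p <= A * B.
Proof.
move=> [cf pf] [cg pg] fA sf B0 gB; rewrite -lee_fin.
apply: le_trans (fcoef_conv p cf pf cg pg) _.
have c0 j : (0 <= (cabs (fcoefth f j))%:E)%E by rewrite lee_fin cabs_ge0.
apply: (@le_trans _ _ (\esum_(j in [set: int]) (B%:E * (cabs (fcoefth f j))%:E))%E).
  apply: le_esum => j _; rewrite -EFinM lee_fin mulrC.
  have [js|js] := boolP (j <= s); last by rewrite sf// cabs0 !mulr0.
  by apply: ler_wpM2r; [exact: cabs_ge0|apply: gB; move: js; clear; lia].
by rewrite (esumZ B0 c0) mulrC EFinM; apply: lee_wpmul2l; [rewrite lee_fin|exact: fA].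
Qed.

(** Beyond n - K the indices are at least n/2 for large n, so doubling replaces the weight at k by
    the weight at n, up to [D0]. *)
Lemma decay_uniform (R : realType) (nu : nat -> R) (x : int -> R) K (e : R) : weight nu -> nonneg x ->
  (fun k : nat => x k%:Z * nu k) @ \oo --> 0 -> 0 < e ->
  \forall n \near \oo, forall k : int, n%:Z - K%:Z < k -> x k <= e / nu n.
Proof.
move=> wnu x0 hx e0; have [D0 /(_ D0 (lexx _)) [D1 hD]] := weight_dbl wnu.
have Dp : 0 < D0 by exact: lt_le_trans D1.
have e10 : 0 < e / D0 by rewrite divr_gt0.
have /cvgrPdist_le/(_ _ e10) [k0 _ hk0] := hx.
(* From n >= k0 + 2 K and k > n - K follow both k >= k0 and n <= 2 k. *)
exists (k0 + 2 * K)%N => // n /= k0n k hk.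
case: k hk => k hk; last by exfalso; move: hk k0n; clear; lia.
have k0k : (k0 <= k)%N by move: hk k0n; clear; lia.
have kp := weight_gt0 wnu k; have np := weight_gt0 wnu n.
have /= := hk0 k k0k; rewrite sub0r normrN ger0_norm; last first.
  by apply: mulr_ge0; [exact: x0|exact: ltW].
have n2k : (n <= 2 * k)%N by move: hk k0n; clear; lia.
have hn := hD _ _ n2k => h.
rewrite ler_pdivlMr//; apply: (@le_trans _ _ (x k * (D0 * nu k))); first exact: ler_wpM2l.
by rewrite mulrCA mulrC -ler_pdivlMr.
Qed.

(** * Growth of the Toeplitz determinants and of their shifts *)

Section ToeplitzMain.
Variable R : realType.
Local Notation C := R[i].
Variables um up ium iup : R -> C.
Hypotheses (wum : Wf um) (wup : Wf up) (wium : Wf ium) (wiup : Wf iup).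
Hypotheses (um1 : forall t, um t * ium t = 1) (up1 : forall t, up t * iup t = 1).
Hypotheses (sum_ : supp_in (fun k => k <= 0) um) (sium : supp_in (fun k => k <= 0) ium).
Hypotheses (sup_ : supp_in (fun k => 0 <= k) up) (siup : supp_in (fun k => 0 <= k) iup).

Let b := symb_b um iup.
Let c := symb_c up ium.

Variable Bc : R.
Hypothesis hBc : forall i : nat,
  (\esum_(j in [set: nat]) (j%:R * acoef c (- j%:Z) * acoef b (j%:Z + i%:Z))%:E <= Bc%:E)%E.

Let G := fcoefth um 0 * fcoefth up 0.

Lemma um0_ium0 : fcoefth um 0 * fcoefth ium 0 = 1.
Proof.
rewrite -(fcoef0_mulN (Wf_contper wum) (Wf_contper wium) sum_ sium).
by rewrite (_ : (fun t => _) = fun=> 1) ?fcoef_cst ?eqxx//; apply/funext.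
Qed.

Lemma up0_iup0 : fcoefth up 0 * fcoefth iup 0 = 1.
Proof.
rewrite -(fcoef0_mulP (Wf_contper wup) (Wf_contper wiup) sup_ siup).
by rewrite (_ : (fun t => _) = fun=> 1) ?fcoef_cst ?eqxx//; apply/funext.
Qed.

Lemma G_gt0 : 0 < cabs G.
Proof.
apply: cabs_gt0; apply/negP => /eqP G0.
have : G * (fcoefth ium 0 * fcoefth iup 0) = 1.
  by rewrite /G mulrACA um0_ium0 up0_iup0 mulr1.
by rewrite G0 mul0r => /eqP; rewrite eq_sym oner_eq0.
Qed.

Lemma det_toepmx_bounded : exists m B, [/\ small_tails um up ium iup m, 0 <= B &
  forall N, (m <= N)%N -> cabs (\det (toepmx um up N)) <= B * cabs G ^+ N].
Proof.
have [V V0 hV] := Wf_real wium.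
have [m hm] := exists_small_tails wum wup wium wiup.
(* The system of index m.+1 + i compares the determinants of indices m.+1 + i and m + i, so the
   defects are summed from m.+1 on. *)
have st := hm m (leqnn m); have st1 := hm m.+1 (leqnSn m).
have sol i : exists y : (nat -> C) * (R -> C) * (R -> C),
    [/\ toepmx um up (m.+1 + i) *m \col_j y.1.1 (val j) = \col_j ((val j == 0%N)%:R),
    (forall k, ((acoef y.1.2 k)%:E <= (acoef ium k)%:E + convol (cutc up ium (m.+1 + i)%:Z) (acoef y.2) k)%E) /\
    (forall k, ((acoef y.2 k)%:E <= convol (cutb um iup (m.+1 + i).+1%:Z) (acoef y.1.2) k)%E),
    Wf y.2 /\ (nW y.1.2 <= (2 * V)%:E)%E,
    supp_in (fun k => k <= 0) y.1.2 /\ supp_in (fun k => (m.+1 + i)%:Z < k) y.2 &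
    G * y.1.1 0%N = 1 + fcoefth um 0 * fcoefth (fun t => c t * y.2 t) 0].
  have mN : (m.+1 + 0 <= m.+1 + i)%N by rewrite leq_add2l.
  have [x [u [w [h1 [h2 h3] [wu ww h4] [h5 h6] [su sw u0]]]]] :=
    toeplitz_solution wum wup wium wiup um1 up1 sum_ sium sup_ siup st1 mN hV.
  exists (x, u, w) => /=; split; [exact: h1| |by split; [exact: ww|exact: h4]|by split; [exact: su|exact: sw]|].
    by split => k; [have := h2 k; rewrite subr0|have := h3 k; rewrite subr0].
  have cX := contper_tpoly (m.+1 + i) x.
  have sX : supp_in (fun k => 0 <= k) (tpoly (m.+1 + i) x).
    by move=> k k0; rewrite fcoef_tpoly; case: k k0.
  have cc : contper c by apply: Wf_contper; exact: (Wf_mul wium wup).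
  have [ccw _] := contperM cc (Wf_contper ww).
  have [cu _] := Wf_contper wu.
  have : fcoefth (fun t => up t * tpoly (m.+1 + i) x t) 0 = fcoefth u 0 + fcoefth (fun t => c t * w t) 0.
    by rewrite -(fcoefD 0 cu ccw); congr (fcoefth _ 0); apply/funext.
  rewrite (fcoef0_mulP (Wf_contper wup) cX sup_ sX) u0 oppr0 fcoef_tpoly /= => e.
  by rewrite /G -mulrA e mulrDr um0_ium0.
have [y hy] := choice sol.
(* [e i] is |G X_0 - 1|, while [d i] is the determinant normalized by its expected growth; Cramer's
   rule reads d_(i+1) |G X_0| = d_i. *)
pose e i := cabs (fcoefth um 0) * acoef (fun t => c t * (y i).2 t) 0.
pose d i := cabs (\det (toepmx um up (m + i))) / cabs G ^+ (m + i).
have GX n : 0 < cabs G ^+ n by rewrite exprn_gt0// G_gt0.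
have d0 i : 0 <= d i by apply: divr_ge0; [exact: cabs_ge0|exact: ltW].
have e0 i : 0 <= e i by apply: mulr_ge0; exact: cabs_ge0.
have sumE n : \sum_(i < n) e i <= cabs (fcoefth um 0) * (Bc * (2 * V)).
  rewrite -mulr_sumr; apply: ler_wpM2l; first exact: cabs_ge0.
  apply: (@sum_defect_le _ um up ium iup wum wup wium wiup Bc hBc V hV m.+1
    (fun i => (y i).1.2) (fun i => (y i).2) st1).
  - by move=> i; have [_ [h _] _ _ _] := hy i.
  - by move=> i; have [_ [_ h] _ _ _] := hy i.
  - by move=> i; have [_ _ [h _] _ _] := hy i; exact: Wf_contper.
  - by move=> i; have [_ _ [_ h] _ _] := hy i.
  - by move=> i; have [_ _ _ [h _] _] := hy i.
  - by move=> i; have [_ _ _ [_ h] _] := hy i.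
have rec i : d i.+1 * (1 - e i) <= d i.
  have [h1 _ _ _ h2] := hy i.
  have hD : \det (toepmx um up (m + i).+1) * (y i).1.1 0%N = \det (toepmx um up (m + i)).
    exact: (@toep_first_entry R (fcoefth (symb um up)) (m + i) (y i).1.1 h1).
  have hx : 1 - e i <= cabs G * cabs ((y i).1.1 0%N).
    rewrite -cabsM h2 /e -[acoef _ 0]/(cabs _) -cabsM.
    by have := cabsB (1 + fcoefth um 0 * fcoefth (fun t => c t * (y i).2 t) 0) (fcoefth um 0 * fcoefth (fun t
        => c t * (y i).2 t) 0);
      rewrite addrK cabs1; set A := cabs _; set B := cabs _; lra.
  rewrite /d addnS ler_pdivlMr// -hD (cabsM (\det _)).
  set D := cabs (\det _).
  have -> : D / cabs G ^+ (m + i).+1 * (1 - e i) * cabs G ^+ (m + i) = D * ((1 - e i) / cabs G).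
    by rewrite exprS; field; rewrite gt_eqF ?G_gt0//= gt_eqF.
  by apply: ler_wpM2l; [exact: cabs_ge0|rewrite ler_pdivrMr ?G_gt0// mulrC].
have [B B0 hB] := product_recursion_bounded d0 e0 sumE rec.
exists m, B; split => // N mN; have := hB (N - m)%N.
by rewrite /d subnKC// ler_pdivrMr.
Qed.

(** X is recovered from [um X] by multiplication with [ium], which uses only indices at or above the
    wanted one. Up to N = n + K the function [um X] agrees with b u, and u lives on k <= s < K, so
    only b_k with k > n - K enter. Every entry of the K by K minor thus carries a factor [Mb]. *)
Lemma det_shift_bound m B V n K (Mb : R) : small_tails um up ium iup m -> 0 <= B ->
  (forall N, (m <= N)%N -> cabs (\det (toepmx um up N)) <= B * cabs G ^+ N) ->
  0 <= V -> (nW ium <= V%:E)%E -> (m <= n)%N -> 0 <= Mb ->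
  (forall k : int, n%:Z - K%:Z < k -> acoef b k <= Mb) ->
  cabs (\det (toep (fun k => fcoefth (symb um up) (k + K%:Z)) n)) <=
    B * cabs G ^+ (n + K) * (K`!%:R * (V * (2 * V * Mb)) ^+ K).
Proof.
move=> st B0 hB V0 hV mn Mb0 hMb.
have sol (s : 'I_K) : exists x : nat -> C,
    toepmx um up (n + K) *m \col_j x (val j) = \col_j ((val j == s)%:R) /\
    forall p, (n < p <= n + K)%N -> cabs (x p) <= V * (2 * V * Mb).
  have mN : (m + s <= n + K)%N by rewrite leq_add// ltnW.
  have [x [u [w [h1 _ [wu ww h4] [_ h6] [su sw _]]]]] :=
    toeplitz_solution wum wup wium wiup um1 up1 sum_ sium sup_ siup st mN hV.
  exists x; split => // p /andP[np pN].
  have cX := contper_tpoly (n + K) x.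
  have cmX := contperM (Wf_contper wum) cX.
  have cb : contper b by apply: Wf_contper; exact: (Wf_mul wum wiup).
  have [cbu _] := contperM cb (Wf_contper wu); have [cw _] := Wf_contper ww.
  have V1 : 0 <= 2 * V * Mb by rewrite !mulr_ge0.
  have -> : cabs (x p) = acoef (fun t => ium t * (um t * tpoly (n + K) x t)) p%:Z.
    rewrite (_ : (fun t => _) = tpoly (n + K) x); last first.
      by apply/funext => t; rewrite mulrA [ium t * _]mulrC um1 mul1r.
    by rewrite /acoef fcoef_tpoly pN.
  apply: (acoef_mul_le (Wf_contper wium) cmX hV sium V1) => q; rewrite subr0 => pq.
  have [qN|Nq] := leP q (n + K)%:Z; last first.
    rewrite /acoef (@supp_mul2 _ (fun k => k <= 0) (fun k => k <= (n + K)%:Z) (fun k => k <= (n + K)%:Z) _ _ _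
        (Wf_contper wum) cX sum_) ?cabs0//.
    - by clear; move=> i j; lia.
    - move=> k kN; rewrite fcoef_tpoly; case: k kN => // k; rewrite lez_nat => /negbTE -> //.
    - by rewrite -ltNge.
  have -> : acoef (fun t => um t * tpoly (n + K) x t) q = acoef (fun t => u t * b t) q.
    rewrite /acoef (_ : (fun t => _) = fun t => b t * u t + w t); last by apply/funext.
    rewrite (fcoefD q cbu cw) (sw q) ?addr0; last by rewrite -leNgt.
    by congr (cabs (fcoefth _ q)); apply/funext => t; rewrite mulrC.
  apply: (acoef_mul_le (Wf_contper wu) cb h4 su Mb0) => r hr.
  apply: hMb; have := ltn_ord s; move: np pq hr; clear; lia.
have [x hx] := choice sol.
pose X : 'M[C]_(n.+1 + K, K) := \matrix_(p < n.+1 + K, s < K) x s (val p).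
have TX : toep (fcoefth (symb um up)) (n + K) *m X = \matrix_(j, s) ((val j == val s)%:R).
  apply/matrixP => j s; have [h _] := hx s.
  rewrite [RHS]mxE [LHS]mxE; have := congr1 (fun v : 'cV_(n + K).+1 => v j 0) h; rewrite !mxE => h'.
  rewrite -h'; apply: eq_bigr => k _; congr (_ * _); by rewrite !mxE.
rewrite (toep_shifted_minor TX); apply: ler_pM; [exact: cabs_ge0|exact: cabs_ge0| |].
  by apply: hB; rewrite (leq_trans mn)// leq_addr.
apply: det_bound => i j; rewrite !mxE; have [_ h] := hx j; apply: h => /=.
by have := ltn_ord i; clear; lia.
Qed.

Lemma det_shift_small (psi : nat -> R) K : weight psi -> (0 < K)%N ->
  (fun k : nat => acoef b k%:Z * psi k) @ \oo --> 0 ->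
  (fun n => cabs (\det (toep (fun k => fcoefth (symb um up) (k + K%:Z)) n)) / cabs G ^+ n * psi n) @ \oo --> 0.
Proof.
move=> wpsi K0 hb; have [m [B [st B0 hB]]] := det_toepmx_bounded.
have [V V0 hV] := Wf_real wium.
have Gp := G_gt0.
pose Q := B * cabs G ^+ K * (K`!%:R * (V * (2 * V)) ^+ K).
have Q0 : 0 <= Q by rewrite !mulr_ge0 ?exprn_ge0 ?mulr_ge0// ltW.
apply/cvgrPdist_le => e e0.
have Q1 : 0 < Q + 1 by rewrite ltr_wpDl.
(* The cap 1 gives Mb <= 1, so that Mb ^+ K <= Mb; the added 1 covers Q = 0. *)
pose e1 := Num.min 1 (e / (Q + 1)).
have e10 : 0 < e1 by rewrite lt_min ltr01 divr_gt0.
have a0 : nonneg (acoef b) by exact: acoef_ge0.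
near=> n.
have mn : (m <= n)%N by near: n; exists m.
have hMb : forall k : int, n%:Z - K%:Z < k -> acoef b k <= e1 / psi n.
  by near: n; exact: (decay_uniform K wpsi a0 hb e10).
have pn : 0 < psi n by exact: weight_gt0.
have pn1 := weight_ge1 wpsi n.
set Mb := e1 / psi n in hMb.
have Mb0 : 0 <= Mb by apply: divr_ge0; exact: ltW.
have Mb1 : Mb <= 1.
  by rewrite /Mb ler_pdivrMr// mul1r; apply: le_trans pn1; rewrite ge_min lexx.
have hdet := det_shift_bound st B0 hB V0 hV mn Mb0 hMb.
have Gn : 0 < cabs G ^+ n by rewrite exprn_gt0.
rewrite sub0r normrN ger0_norm; last by rewrite !mulr_ge0 ?cabs_ge0 ?invr_ge0// ltW.
rewrite -ler_pdivlMr// ler_pdivrMr//; apply: le_trans hdet _.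
have -> : B * cabs G ^+ (n + K) * (K`!%:R * (V * (2 * V * Mb)) ^+ K) = Q * Mb ^+ K * cabs G ^+ n.
  have -> : V * (2 * V * Mb) = V * (2 * V) * Mb by ring.
  by rewrite /Q exprD [(V * (2 * V) * Mb) ^+ K]exprMn; ring.
rewrite ler_pM2r//; apply: (@le_trans _ _ (Q * Mb)).
  apply: ler_wpM2l => //; rewrite -{2}[Mb]expr1; exact: ler_wiXn2l.
rewrite /Mb mulrA ler_pM2r ?invr_gt0//.
apply: (@le_trans _ _ (Q * (e / (Q + 1)))).
  by apply: ler_wpM2l => //; rewrite ge_min lexx orbT.
rewrite mulrA ler_pdivrMr// mulrC ler_pM2l//; lra.
Unshelve. all: by end_near.
Qed.

End ToeplitzMain.

(** * N-functions *)

Section MonotoneIntegrals.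
Variable R : realType.
Notation mu := (@lebesgue_measure R).

(** The properties shared by a generator p and its generalized inverse, so that both N-functions are
    treated by one argument. *)
Definition nonneg_mono (f : R -> R) :=
  (forall x, 0 <= x -> 0 <= f x) /\ (forall x y, 0 <= x -> x <= y -> f x <= f y).

Variable f : R -> R.
Hypothesis mf : nonneg_mono f.
Let F x := Rintegral mu `[0, x] f.

Lemma integrable_mono (x y : R) : 0 <= x -> mu.-integrable `[x, y] (EFin \o f).
Proof.
move=> x0; have [f0 fm] := mf.
have mfg : measurable_fun `[x, y]%classic f.
  (* Cutting the argument off at 0 yields a function monotone on the whole line, which agrees with f
     on the interval. *)
  have mg : measurable_fun `[x, y]%classic (fun t => f (Num.max 0 t)).
    apply: measurable_realfun.nondecreasing_measurable => // s t st.
    by apply: fm; [rewrite le_max lexx|rewrite ge_max !le_max lexx/= st orbT].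
  apply: eq_measurable_fun mg => t /set_mem /= /andP[xt _].
  by rewrite max_r// (le_trans x0).
apply: measurable_bounded_integrable => //.
  rewrite /= lebesgue_measure_itv /=; case: ifP => _ //; exact: ltry.
exists (f y); split; first exact: num_real.
move=> M hM t /= ; rewrite in_itv /= => /andP[xt ty].
rewrite ger0_norm ?f0 ?(le_trans x0)//; apply: le_trans (ltW hM).
by apply: fm => //; exact: le_trans xt.
Qed.

Lemma itv_length (x y : R) : x <= y -> fine (mu `]x, y]) = y - x.
Proof.
rewrite lebesgue_measure_itv /= lte_fin le_eqVlt => /predU1P[->|->]; last by [].
by rewrite ltxx subrr.
Qed.

(** The two-sided bound says that f is a subgradient of its primitive, which is the convexity clause
    of [young_fun]. *)
Lemma mono_primitive_bounds (x y : R) : 0 <= x -> x <= y -> f x * (y - x) <= F y - F x <= f y * (y - x).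
Proof.
move=> x0 xy; have [f0 fm] := mf.
have i0y : mu.-integrable `[0, y] (EFin \o f) by exact: integrable_mono.
have ixy : mu.-integrable `]x, y] (EFin \o f).
  apply: (integrableS _ _ _ (integrable_mono y x0)) => //.
  by move=> t; rewrite /= !in_itv /= => /andP[xt ->]; rewrite (ltW xt).
have -> : F y - F x = Rintegral mu `]x, y] f.
  by rewrite /F; apply: Rintegral_itvB => //; rewrite bnd_simp.
have ic (r : R) : mu.-integrable `]x, y] (EFin \o (fun=> r)).
  apply: measurable_bounded_integrable => //.
  - rewrite /= lebesgue_measure_itv /=; case: ifP => _ //; exact: ltry.
  - exact: bounded_cst.
rewrite -(itv_length xy) -!Rintegral_cst//; apply/andP; split; apply: le_Rintegral => //.
- by move=> t /=; rewrite in_itv /= => /andP[xt _]; apply: fm => //; exact: ltW.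
- by move=> t /=; rewrite in_itv /= => /andP[xt ty]; apply: fm => //; exact: le_trans x0 (ltW xt).
Qed.

Lemma mono_primitive0 : F 0 = 0.
Proof. by rewrite /F set_itv1 Rintegral_set1. Qed.

(** The right half of the interval alone contributes this much. Positivity of F and the crude Young
    inequality both rest on it. *)
Lemma mono_primitive_ge (x : R) : 0 <= x -> f (x / 2) * (x / 2) <= F x.
Proof.
move=> x0; have h0 : 0 <= x / 2 by rewrite divr_ge0.
have h1 : x / 2 <= x by lra.
have /andP[h _] := mono_primitive_bounds h0 h1.
have /andP[h' _] := mono_primitive_bounds (lexx 0) h0.
have [f0 _] := mf; have := f0 0 (lexx 0); have := mono_primitive0.
rewrite (_ : x - x / 2 = x / 2) in h; last by field.
move=> F0 f00; have : 0 <= f 0 * (x / 2 - 0) by apply: mulr_ge0 => //; lra.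
lra.
Qed.

Lemma young_primitive : (forall x, 0 < x -> 0 < f x) -> Delta2_0 F -> young_fun F.
Proof.
move=> fp [K hK]; have [f0 fm] := mf.
have Fp (z : R) : 0 < z -> 0 < F z.
  move=> z0; have h := mono_primitive_ge (ltW z0).
  by apply: lt_le_trans h; rewrite mulr_gt0 ?fp// divr_gt0.
exists f; split => //; first exact: mono_primitive0.
  move=> y z y0 z0; have [zy|/ltW yz] := leP z y.
    by have /andP[h _] := mono_primitive_bounds z0 zy; lra.
  have /andP[_ h] := mono_primitive_bounds y0 yz.
  have -> : f z * (y - z) = - (f z * (z - y)) by ring.
  lra.
have [e /= e0 he] := hK.
exists K, (e / 2); split; first by rewrite divr_gt0.
move=> x /andP[]; rewrite le_eqVlt => /predU1P[<- _|x0 xe].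
  by rewrite mulr0 mono_primitive0 mulr0.
rewrite -ler_pdivrMr ?Fp//; apply: he => //=.
by rewrite sub0r normrN gtr0_norm//; lra.
Qed.

End MonotoneIntegrals.

Section NFunctions.
Variables (R : realType) (p : R -> R).
Hypothesis Np : Ngen p.

Lemma Ngen_mono : nonneg_mono p.
Proof. by have [p0 [_ [pm _]]] := Np. Qed.

Lemma qinv_has_sup (s : R) : 0 <= s -> has_sup [set t | 0 <= t /\ p t <= s].
Proof.
move=> s0; have [_ [_ [pm [p00 [_ pinf]]]]] := Np; split.
  by exists 0; split; rewrite ?p00.
have /cvgryPgt/(_ s) [A [_ hA]] := pinf.
exists (Num.max 0 (A + 1)) => t [t0 pt]; rewrite leNgt; apply/negP.
rewrite gt_max => /andP[_ At]; have h : s < p t by apply: hA; lra.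
by have := lt_le_trans h pt; rewrite ltxx.
Qed.

Lemma qinv_ub (s t : R) : 0 <= s -> 0 <= t -> p t <= s -> t <= qinv p s.
Proof. by move=> s0 t0 pt; apply: (sup_upper_bound (qinv_has_sup s0)). Qed.

Lemma qinv_mono : nonneg_mono (qinv p).
Proof.
have [_ [_ [_ [p00 _]]]] := Np; split => [x x0|x y x0 xy].
  by apply: qinv_ub => //; rewrite p00.
apply: sup_le; [|exists 0; split; rewrite ?p00//|exact: qinv_has_sup (le_trans x0 xy)].
by move=> t [t0 pt]; exists t; split => //; split => //; exact: le_trans xy.
Qed.

(** Right-continuity at 0 together with p 0 = 0 provides some t > 0 with p t <= s. *)
Lemma qinv_gt0 (s : R) : 0 < s -> 0 < qinv p s.
Proof.
move=> s0; have [p0 [prc [_ [p00 _]]]] := Np.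
have /cvgrPdist_le/(_ _ s0) [e /= e0 he] := prc 0 (lexx 0).
have h2 : 0 < e / 2 by rewrite divr_gt0.
apply: (lt_le_trans h2); apply: qinv_ub; [exact: ltW|exact: ltW|].
have : `|0 - e / 2| < e by rewrite sub0r normrN gtr0_norm//; lra.
by move=> /(he _)/(_ h2); rewrite p00 sub0r normrN ger0_norm// p0// ltW.
Qed.

Lemma young_PhiN : Delta2_0 (PhiN p) -> young_fun (PhiN p).
Proof. by apply: young_primitive Ngen_mono _; have [_ [_ [_ [_ []]]]] := Np. Qed.

Lemma young_PsiN : Delta2_0 (PsiN p) -> young_fun (PsiN p).
Proof. exact: young_primitive qinv_mono qinv_gt0. Qed.

(* A crude form of Young's inequality: comparing [p (x / 2)] with [y / 2] decides which of the
   two primitives alone already dominates [x * y / 4]. *)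
Lemma weak_young (x y : R) : 0 <= x -> 0 <= y -> x * y <= 4 * (PhiN p x + PsiN p y).
Proof.
move=> x0 y0.
have hP := mono_primitive_ge Ngen_mono x0; have hQ := mono_primitive_ge qinv_mono y0.
have x20 : 0 <= x / 2 by rewrite divr_ge0.
have y20 : 0 <= y / 2 by rewrite divr_ge0.
have P0 : 0 <= p (x / 2) * (x / 2) by rewrite mulr_ge0//; have [-> ] := Ngen_mono.
have Q0 : 0 <= qinv p (y / 2) * (y / 2) by rewrite mulr_ge0//; have [-> ] := qinv_mono.
rewrite -/(PhiN p x) in hP; rewrite -/(PsiN p y) in hQ.
have [h|/ltW h] := leP (y / 2) (p (x / 2)).
  have := ler_wpM2r x20 h; have : y / 2 * (x / 2) = x * y / 4 by field.
  lra.
have := ler_wpM2r y20 (qinv_ub y20 x20 h); have : x / 2 * (y / 2) = x * y / 4 by field.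
lra.
Qed.

End NFunctions.

(** * The asymptotic formulas *)

Section Reflection.
Variable R : realType.
Local Notation C := R[i].
Local Notation Re := (@complex.Re R).
Local Notation Im := (@complex.Im R).
Implicit Types h : R -> C.

Definition refl h (t : R) : C := h (- t).

Lemma contper_refl h : contper h -> contper (refl h).
Proof.
move=> [[c1 c2] ph]; split; last first.
  by move=> t; rewrite /refl opprD -(ph (- t - 2 * pi)) subrK.
have opp x : {for x, continuous (fun t : R => - t)} by exact: opp_continuous.
split => x; [apply: (@continuous_comp _ _ _ (fun t : R => - t) (Re \o h))
            |apply: (@continuous_comp _ _ _ (fun t : R => - t) (Im \o h))]; by [exact: opp|exact: c1|exact: c2].
Qed.

Lemma fcoef_refl_trig N (a : 'I_N -> 'I_N -> C) (z : C) (k : int) :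
  let P t := z * \sum_(j < N) \sum_(l < N) a j l * expi ((j%:Z - l%:Z)%:~R * t) in
  fcoefth (refl P) k = fcoefth P (- k).
Proof.
move=> P.
have ct (i : int) (y : C) : contC (fun t : R => y * expi (i%:~R * t)).
  by apply: contCM; [exact: contC_cst|exact: contC_expiM].
have -> : refl P = fun t => z * \sum_(j < N) \sum_(l < N) a j l * expi ((l%:Z - j%:Z)%:~R * t).
  apply/funext => t; rewrite /refl /P; congr (z * _); apply: eq_bigr => j _; apply: eq_bigr => l _.
  by congr (_ * expi _); rewrite -[j%:Z - l%:Z]opprB rmorphN /= mulrNN.
rewrite /P.
rewrite fcoefZ; last by apply: contC_sum => j; apply: contC_sum => l; exact: ct.
rewrite fcoefZ; last by apply: contC_sum => j; apply: contC_sum => l; exact: ct.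
congr (z * _).
rewrite fcoef_sum => [|j]; last by apply: contC_sum => l; exact: ct.
rewrite fcoef_sum => [|j]; last by apply: contC_sum => l; exact: ct.
apply: eq_bigr => j _.
rewrite fcoef_sum => [|l]; last exact: ct.
rewrite fcoef_sum => [|l]; last exact: ct.
apply: eq_bigr => l _; rewrite !fcoefZ ?fcoef_expi; [|exact: contC_expiM|exact: contC_expiM].
by rewrite -eqr_opp opprB.
Qed.

(** Fejér means satisfy this by inspection of their exponentials, and uniform approximation carries
    it over to [h]; no change of variables in the integral is involved. *)
Lemma fcoef_refl h k : contper h -> fcoefth (refl h) k = fcoefth h (- k).
Proof.
move=> ch; have [cc ph] := ch; have [crh _] := contper_refl ch.
apply/eqP; rewrite -subr_eq0; apply/eqP/cabs_eq0/eqP; rewrite eq_le cabs_ge0 andbT.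
apply/ler_addgt0Pl => e e0; rewrite addr0.
have e40 : 0 < e / 4 by rewrite divr_gt0.
have [n _ /(_ n (leqnn n)) hn] := fejer_cvg cc ph e40.
have cF : contC (fejer n h).
  by apply: contCM; [exact: contC_cst|apply: contC_sum => j; apply: contC_sum => l; apply: contCM; [exact:
      contC_cst|exact: contC_expiM]].
have pF : per2pi (fejer n h).
  move=> t; congr (_ * _); apply: eq_bigr => j _; apply: eq_bigr => l _; congr (_ * _).
  by have [_ ->] := contper_expi R (j%:Z - l%:Z).
have [crF _] := contper_refl (conj cF pF).
have h1 : cabs (fcoefth (refl h) k - fcoefth (refl (fejer n h)) k) <= 2 * (e / 4).
  rewrite -fcoefB//; apply: fcoef_bound; first exact: contCB.
  by move=> x; exact: hn.
have h2 : cabs (fcoefth h (- k) - fcoefth (fejer n h) (- k)) <= 2 * (e / 4).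
  by rewrite -fcoefB//; apply: fcoef_bound; [exact: contCB|exact: hn].
have E : fcoefth (refl (fejer n h)) k = fcoefth (fejer n h) (- k) by exact: fcoef_refl_trig.
rewrite E in h1.
have -> : fcoefth (refl h) k - fcoefth h (- k) =
  (fcoefth (refl h) k - fcoefth (fejer n h) (- k)) - (fcoefth h (- k) - fcoefth (fejer n h) (- k)) by ring.
apply: le_trans (cabsB _ _) _; move: h1 h2; clear; lra.
Qed.

Lemma inAf_refl (F1 F2 : R -> R) (nu1 nu2 : nat -> R) h : inAf F1 F2 nu1 nu2 h -> inAf F2 F1 nu2 nu1 (refl h).
Proof.
move=> [L [l [ch L0 l0 hL [h1 h2]]]]; exists L, l.
have E : acoef (refl h) = fun k => acoef h (- k).
  by apply/funext => k; rewrite /acoef fcoef_refl.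
split; [exact: contper_refl|exact: L0|exact: l0| |].
- apply: le_trans hL; rewrite /nW /nZ -(esum_opp (fun k => (cabs (fcoefth h k))%:E)).
  by apply: le_esum => k _; rewrite fcoef_refl.
- split; rewrite E; first exact: h2.
  by rewrite (_ : (fun k => acoef h (- - k)) = acoef h)//; apply/funext => k; rewrite opprK.
Qed.

End Reflection.

(** * Decay of the shifted and of the corner determinants *)

Section ShiftedToeplitz.
Variable R : realType.
Local Notation C := R[i].
Variables (F1 F2 : R -> R) (nu1 nu2 : nat -> R) (M : R).
Hypotheses (yF1 : young_fun F1) (yF2 : young_fun F2) (wnu1 : weight nu1) (wnu2 : weight nu2).
Hypothesis wY : forall x y, 0 <= x -> 0 <= y -> x * y <= 4 * (F2 x + F1 y).
Hypotheses (M0 : 0 < M) (hM : forall k : nat, k%:R <= M * nu2 k * nu1 k).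

(** Since [nu1] increases, j <= M nu2_j nu1_(j+i); the factor j is thus split between the two
    sequences and Young's inequality is applied termwise. The bound does not depend on i. *)
Lemma pairing_bound (x y : int -> R) (S1 S2 : R) (i : nat) : nonneg x -> nonneg y ->
  (\esum_(k in [set: nat]) (F1 (y k%:Z * nu1 k))%:E <= S1%:E)%E ->
  (\esum_(k in [set: nat]) (F2 (x (- k%:Z) * nu2 k))%:E <= S2%:E)%E ->
  (\esum_(j in [set: nat]) (j%:R * x (- j%:Z) * y (j%:Z + i%:Z))%:E <= (4 * M * (S2 + S1))%:E)%E.
Proof.
move=> x0 y0 h1 h2.
have a0 k : 0 <= x (- k%:Z) * nu2 k by apply: mulr_ge0; [exact: x0|exact: weight_ge0].
have b0 k : 0 <= y k%:Z * nu1 k by apply: mulr_ge0; [exact: y0|exact: weight_ge0].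
have A0 (k : nat) : (0 <= (F2 (x (- k%:Z) * nu2 k))%:E)%E by rewrite lee_fin young_ge0.
have B0 (k : nat) : (0 <= (F1 (y k%:Z * nu1 k))%:E)%E by rewrite lee_fin young_ge0.
have M40 : 0 <= 4 * M by rewrite mulr_ge0// ltW.
apply: (@le_trans _ _ (\esum_(j in [set: nat]) ((4 * M)%:E * ((F2 (x (- j%:Z) * nu2 j))%:E + (F1 (y (j + i)%:Z
    * nu1 (j + i)%N))%:E)))%E).
  apply: le_esum => j _; rewrite -EFinD -EFinM lee_fin -PoszD.
  have xx := x0 (- j%:Z); have yy := y0 (j + i)%N.
  have m1 := weight_mono wnu1 (leq_addr i j); have n20 := weight_ge0 wnu2 j.
  apply: (@le_trans _ _ (M * ((x (- j%:Z) * nu2 j) * (y (j + i)%N * nu1 (j + i)%N)))).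
    have -> : M * (x (- j%:Z) * nu2 j * (y (j + i)%N * nu1 (j + i)%N)) = (M * nu2 j * nu1 (j + i)%N) * (x (-
        j%:Z) * y (j + i)%N) by ring.
    rewrite -mulrA; apply: ler_wpM2r; first exact: mulr_ge0.
    apply: le_trans (hM j) _; apply: ler_wpM2l => //; apply: mulr_ge0 => //; exact: ltW.
  have -> : 4 * M * (F2 (x (- j%:Z) * nu2 j) + F1 (y (j + i)%N * nu1 (j + i)%N)) = M * (4 * (F2 (x (- j%:Z) *
      nu2 j) + F1 (y (j + i)%N * nu1 (j + i)%N))) by ring.
  by rewrite ler_pM2l//; apply: wY; [exact: a0|exact: b0].
rewrite esumZ// => [|k]; last exact: adde_ge0.
rewrite [leRHS]EFinM; apply: lee_wpmul2l; first by rewrite lee_fin.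
rewrite esumD => [|k _|k _]; [|exact: A0|exact: B0].
rewrite EFinD; apply: leeD; first exact: h2.
apply: le_trans h1.
rewrite -(@esum_image _ _ _ [set: nat] (fun j => (j + i)%N) (fun k => (F1 (y k%:Z * nu1 k))%:E)); last first.
  by move=> j k _ _ /addIn.
rewrite esum_mkcond; apply: le_esum => k _; case: ifP => _ //; exact: B0.
Qed.

Variables um up ium iup : R -> C.
Hypotheses (Aum : inAf F1 F2 nu1 nu2 um) (Aup : inAf F1 F2 nu1 nu2 up).
Hypotheses (Aium : inAf F1 F2 nu1 nu2 ium) (Aiup : inAf F1 F2 nu1 nu2 iup).
Hypotheses (um1 : forall t, um t * ium t = 1) (up1 : forall t, up t * iup t = 1).
Hypotheses (sum_ : supp_in (fun k => k <= 0) um) (sium : supp_in (fun k => k <= 0) ium).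
Hypotheses (sup_ : supp_in (fun k => 0 <= k) up) (siup : supp_in (fun k => 0 <= k) iup).

Lemma inAf_Wf h : inAf F1 F2 nu1 nu2 h -> Wf h.
Proof.
move=> [L [l [[ch ph] _ _ hL _]]]; split; [exact: ch|exact: ph|exact: le_lt_trans hL (ltry _)].
Qed.

Lemma inAf_decay h : inAf F1 F2 nu1 nu2 h -> (fun k : nat => acoef h k%:Z * nu1 k) @ \oo --> 0.
Proof. by move=> [L [l [_ _ l0 _ [h1 _]]]]; apply: (pball_cvg0 yF1 wnu1 (@acoef_ge0 _ h) l0 h1). Qed.

Lemma shifted_det_small K : (0 < K)%N ->
  (fun n => cabs (\det (toep (fun k => fcoefth (symb um up) (k + K%:Z)) n)) /
            cabs (fcoefth um 0 * fcoefth up 0) ^+ n * nu1 n) @ \oo --> 0.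
Proof.
move=> K0.
have Ab : inAf F1 F2 nu1 nu2 (symb_b um iup) by exact: inAf_mulr.
have Ac : inAf F1 F2 nu1 nu2 (symb_c up ium) by exact: inAf_mulr.
have [L [l [_ _ l0 _ [hb _]]]] := Ab; have [L' [l' [_ _ l0' _ [_ hc]]]] := Ac.
have xb := @acoef_ge0 _ (symb_b um iup).
have xc : nonneg (fun k => acoef (symb_c up ium) (- k)) by move=> k; exact: acoef_ge0.
have f1 := modular_pball yF1 wnu1 xb l0 hb.
have f2 := modular_pball yF2 wnu2 xc l0' hc.
have [|S1 _ hS1] := esum_le_real _ f1.
  by move=> k; rewrite lee_fin young_ge0// mulr_ge0 ?weight_ge0.
have [|S2 _ hS2] := esum_le_real _ f2.
  by move=> k; rewrite lee_fin young_ge0// mulr_ge0 ?weight_ge0.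
apply: (det_shift_small (inAf_Wf Aum) (inAf_Wf Aup) (inAf_Wf Aium) (inAf_Wf Aiup)
  um1 up1 sum_ sium sup_ siup (Bc := 4 * M * (S2 + S1)) _ wnu1 K0 (inAf_decay Ab)).
by move=> i; apply: (pairing_bound i (@acoef_ge0 _ (symb_c up ium)) xb hS1 hS2).
Qed.

Lemma corner_det_small K h : (0 < K)%N -> inAf F1 F2 nu1 nu2 h ->
  (fun n => cabs (\det (\matrix_(j < K, k < K) fcoefth h ((n.+1 + j)%:Z - k%:Z))) * nu1 n) @ \oo --> 0.
Proof.
move=> K0 Ah; apply/cvgrPdist_le => e e0.
pose e1 := Num.min 1 (e / K`!%:R).
have f0 : 0 < K`!%:R :> R by rewrite ltr0n fact_gt0.
have e10 : 0 < e1 by rewrite lt_min ltr01 divr_gt0.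
near=> n.
have hMb : forall k : int, n%:Z - K%:Z < k -> acoef h k <= e1 / nu1 n.
  by near: n; exact: (decay_uniform K wnu1 (@acoef_ge0 _ h) (inAf_decay Ah) e10).
have pn := weight_gt0 wnu1 n; have pn1 := weight_ge1 wnu1 n.
set d := e1 / nu1 n in hMb.
have d0 : 0 <= d by apply: divr_ge0; exact: ltW.
have d1 : d <= 1 by rewrite /d ler_pdivrMr// mul1r; apply: le_trans pn1; rewrite ge_min lexx.
rewrite sub0r normrN ger0_norm; last by apply: mulr_ge0; [exact: cabs_ge0|exact: ltW].
rewrite -ler_pdivlMr//.
apply: (@le_trans _ _ (K`!%:R * d ^+ K)).
  apply: det_bound => i j; rewrite mxE; apply: hMb.
  by have := ltn_ord j; clear; lia.
apply: (@le_trans _ _ (K`!%:R * d)).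
  by rewrite ler_pM2l// -{2}[d]expr1; exact: ler_wiXn2l.
rewrite /d mulrA ler_pM2r ?invr_gt0// mulrC -ler_pdivlMr//.
by rewrite ge_min lexx orbT.
Unshelve. all: by end_near.
Qed.

End ShiftedToeplitz.

(** * Continuous logarithms, the algebra on the circle, and the error terms *)

Section Assembly.
Variable R : realType.
Local Notation C := R[i].
Local Notation Re := (@complex.Re R).
Local Notation Im := (@complex.Im R).

(** The values of [h] are multiples of 2 pi. A non-zero value would, by the intermediate value
    theorem, force |h| to take a value in (0, 1]. *)
Lemma cos_eq1_continuous (h : R -> R) : continuous h -> h 0 = 0 -> (forall t, cos (h t) = 1) -> forall t, h t = 0.
Proof.
move=> ch h0 hc t; apply/eqP/negPn/negP => ht.
pose k s := `|h s|.
have ck : continuous k by move=> s; apply: continuous_comp; [exact: ch|exact: norm_continuous].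
have kt : 0 < k t by rewrite /k normr_gt0.
have k0 : k 0 = 0 by rewrite /k h0 normr0.
pose v := Num.min 1 (k t).
have v0 : 0 < v by rewrite lt_min ltr01.
have vt : v <= k t by rewrite ge_min lexx orbT.
have [s ks] : exists s, k s = v.
  have [t0|t0] := leP 0 t.
  - have [|s _ ks] := @IVT R k 0 t v t0 (continuous_subspaceT ck); last by exists s.
    by rewrite k0 min_l ?max_r ?(ltW v0)// ltW.
  - have [|s _ ks] := @IVT R k t 0 v (ltW t0) (continuous_subspaceT ck); last by exists s.
    by rewrite k0 min_r ?max_l ?(ltW v0)// ltW.
have hs : h s = 0 by apply: cos_eq1_small; rewrite // -/(k s) ks ge_min lexx.
by move: v0; rewrite -ks /k hs normr0 ltxx.
Qed.

(** The increment of the given logarithm over one period is a continuous multiple of 2 pi i, and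
    winding number 0 makes it vanish at 0, hence everywhere; so that logarithm is periodic. *)
Lemma exists_clog (a : C -> C) : windnum a 0 -> exists g, is_clog a g.
Proof.
move=> [g [c1 [c2 [ga w]]]]; exists g; split => //; split => //; split => //.
have key t : Re (g (t + 2 * pi) - g t) = 0 /\ cos (Im (g (t + 2 * pi) - g t)) = 1.
  by apply: cexp_eq1; rewrite cexpD cexpN !ga expi_periodic divff// -ga cexp_neq0.
have ct : continuous (fun t => Im (g (t + 2 * pi)) - Im (g t)).
  move=> t; apply: continuousB; last exact: c2.
  apply: (@continuous_comp _ _ _ (fun t : R => t + 2 * pi) (fun t => Im (g t))); last exact: c2.
  by apply: continuousD => //; exact: cst_continuous.
have h0 : Im (g (0 + 2 * pi)) - Im (g 0) = 0 by rewrite add0r w mulr0.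
have hc t : cos (Im (g (t + 2 * pi)) - Im (g t)) = 1 by rewrite -cImB; have [] := key t.
have hI := cos_eq1_continuous ct h0 hc.
move=> t; have [r _] := key t; apply: complex_eq.
  by apply/eqP; rewrite -subr_eq0 -cReB r.
by apply/eqP; rewrite -subr_eq0 hI.
Qed.

Lemma clogP (a : C -> C) : (exists g, is_clog a g) -> is_clog a (clog a).
Proof. by rewrite /clog; case: pselect => // h _; case: cid. Qed.

Lemma contper_L1T (f : C -> C) : contper (f \o @expi R) -> L1T f.
Proof. by move=> [[c1 c2] _]; split; exact: integrable_2pi. Qed.

Lemma contper_LinfT (f : C -> C) : contper (f \o @expi R) -> LinfT f.
Proof.
move=> cf; split; first exact: contper_L1T.
have [cc ph] := cf; have [B hB] := per_boundedC cc ph.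
by exists B; apply: aeW => t _; exact: hB.
Qed.

Lemma esum_nat_shift (u : nat -> R) : (forall n, 0 <= u n) ->
  (\esum_(n in [set: nat]) (u n)%:E < +oo)%E <-> Defs.summable (fun n => u n.+1).
Proof.
move=> u0; have u0' n : 0 <= u n.+1 by [].
rewrite summableP//; split => h.
- apply: le_lt_trans h.
  rewrite -(@esum_image _ _ _ [set: nat] succn (fun n => (u n)%:E)); last by move=> i j _ _ [].
  by rewrite esum_mkcond; apply: le_esum => k _; case: ifP => _ //; rewrite lee_fin.
- have [|B B0 hB] := esum_le_real _ h; first by move=> n; rewrite lee_fin.
  apply: (@le_lt_trans _ _ (u 0%N + B)%:E); last exact: ltry.
  apply: esum_nat_lim => [n|N]; first by rewrite lee_fin.
  apply: (@le_trans _ _ (\sum_(n < N.+1) (u n)%:E)%E).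
    by rewrite big_ord_recr /= leeDl// lee_fin.
  rewrite big_ord_recl EFinD leeD2l//; apply: le_trans hB.
  by apply: (le_esum_nat (u := fun n => (u n.+1)%:E)) => n; rewrite lee_fin.
Qed.

(** Finiteness of the modular and membership in some ball are equivalent by [pball_modular] and
    [modular_pball]. The remaining discrepancy is index 0 in the negative half, which
    [esum_nat_shift] bridges. *)
Lemma inA_inAf (Phi Psi : R -> R) (phi psi : nat -> R) (f : C -> C) :
  young_fun Phi -> young_fun Psi -> weight phi -> weight psi ->
  inA Phi Psi phi psi f <-> inAf Psi Phi psi phi (f \o @expi R).
Proof.
move=> yP yQ wP wQ; set h := f \o @expi R.
have a0 := @acoef_ge0 _ h.
have p0 n : 0 <= Phi (acoef h (- n%:Z) * phi n) by rewrite young_ge0// mulr_ge0 ?weight_ge0.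
have q0 n : 0 <= Psi (acoef h n%:Z * psi n) by rewrite young_ge0// mulr_ge0 ?weight_ge0.
have a0' : nonneg (fun k => acoef h (- k)) by move=> k; exact: a0.
split.
- move=> [/inW_Wf wf [_ [s1 s2]]].
  have /(esum_nat_shift p0) h1 : Defs.summable (fun n => Phi (acoef h (- n.+1%:Z) * phi n.+1)) := s1.
  have /(summableP q0) h2 : Defs.summable (fun n => Psi (acoef h n%:Z * psi n)) := s2.
  have [|B1 B10 hB1] := esum_le_real _ h1; first by move=> n; rewrite lee_fin.
  have [|B2 B20 hB2] := esum_le_real _ h2; first by move=> n; rewrite lee_fin.
  have [L L0 hL] := Wf_real wf.
  exists (L + 1), (1 + B1 + B2); split.
  + exact: (Wf_contper wf).
  + by rewrite ltr_wpDl.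
  + by rewrite -addrA ltr_wpDr// addr_ge0.
  + by apply: le_trans hL _; rewrite lee_fin lerDl.
  + split.
    * apply: (pball_modular yQ wQ a0 _ _ hB2); move: B10 B20; clear; lra.
    * apply: (pball_modular yP wP a0' _ _ hB1); move: B10 B20; clear; lra.
- move=> [L [l [ch L0 l0 hL [h1 h2]]]]; split.
    apply/inW_Wf; have [cc ph] := ch; split; [exact: cc|exact: ph|exact: le_lt_trans hL (ltry _)].
  split; first exact: contper_L1T.
  split.
    by apply/(esum_nat_shift p0); exact: (modular_pball yP wP a0' l0 h2).
  by apply/(summableP q0); exact: (modular_pball yQ wQ a0 l0 h1).
Qed.

(** The identity is solved for its error term: d is D divided by the prefactor, minus b, and both
    parts are small on their own. The modulus of the prefactor is a constant times |G|^n whatever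
    the sign exponent; [1 + 0] is the shape with delta_1 = 0. *)
Lemma asymptotic_split (G E Z : C) (D b : nat -> C) (s : nat -> nat) (psi : nat -> R) :
  G != 0 -> E != 0 -> Z != 0 -> (forall n, 0 <= psi n) ->
  (fun n => cabs (D n) / cabs G ^+ n * psi n) @ \oo --> 0 ->
  (fun n => cabs (b n) * psi n) @ \oo --> 0 ->
  exists d : nat -> C, (fun n => cabs (d n) * psi n) @ \oo --> 0 /\
    forall n, D n = G ^+ n.+1 * E * (1 + 0) * (-1) ^+ (s n) * Z * (b n + d n).
Proof.
move=> G0 E0 Z0 p0 hD hb.
pose P n := G ^+ n.+1 * E * (1 + 0) * (-1) ^+ (s n) * Z.
have P0 n : P n != 0 by rewrite /P addr0 mulr1 !mulf_neq0// expf_neq0// oppr_eq0 oner_eq0.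
have cP n : cabs (P n) = cabs G ^+ n * (cabs G * cabs E * cabs Z).
  rewrite /P addr0 !cabsM !cabsX cabsN cabs1 expr1n exprSr; ring.
exists (fun n => D n / P n - b n); split; last first.
  by move=> n; rewrite -/(P n) addrC subrK mulrC divfK.
have gp := cabs_gt0 G0; have ep := cabs_gt0 E0; have zp := cabs_gt0 Z0.
pose K := (cabs G * cabs E * cabs Z)^-1.
have lim : (fun n => K * (cabs (D n) / cabs G ^+ n * psi n) + cabs (b n) * psi n) @ \oo --> 0.
  rewrite -[X in _ --> X](addr0 0) -{1}(mulr0 K); apply: cvgD => //.
  by apply: cvgM => //; exact: cvg_cst.
have cst0 : (fun=> 0 : R) @ \oo --> (0 : R) by exact: cvg_cst.
apply: (squeeze_cvgr _ cst0 lim); near=> n.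
rewrite mulr_ge0 ?cabs_ge0//=.
have -> : K * (cabs (D n) / cabs G ^+ n * psi n) = cabs (D n / P n) * psi n.
  rewrite cabsM cabsV cP /K; field; rewrite !gt_eqF//=; exact: exprn_gt0.
by rewrite -mulrDl; apply: ler_wpM2r => //; exact: cabsB.
Unshelve. all: by end_near.
Qed.

End Assembly.

(** * From functions of the angle to symbols on the circle *)

Section WienerHopf.
Variable R : realType.
Local Notation C := R[i].
Variables (Phi Psi : R -> R) (phi psi : nat -> R).
Hypotheses (yP : young_fun Phi) (yQ : young_fun Psi) (wP : weight phi) (wQ : weight psi).
Local Notation inB := (inAf Psi Phi psi phi).

Lemma Hminus_supp (f : C -> C) : Hminus f <-> LinfT f /\ supp_in (fun k => k <= 0) (f \o @expi R).
Proof.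
split=> [[hL hf]|[hL hf]]; split => //; last first.
  by move=> n n0; apply: hf; rewrite -ltNge ltz_nat.
move=> [[|k]|k] hk; [by move: hk; rewrite lexx|exact: hf|by move: hk].
Qed.

Lemma Hplus_supp (f : C -> C) : Hplus f <-> LinfT f /\ supp_in (fun k => 0 <= k) (f \o @expi R).
Proof.
split=> [[hL hf]|[hL hf]]; split => //; last first.
  by move=> n n0; apply: hf; rewrite -ltNge oppr_lt0 ltz_nat.
by move=> [k|k] hk; [move: hk|rewrite NegzE; exact: hf].
Qed.

Lemma exists_WHfact (a : C -> C) (g : R -> C) : inB (a \o @expi R) -> contper g ->
  (forall t, cexp (g t) = a (expi t)) -> exists am ap, WHfact Phi Psi phi psi a am ap.
Proof.
move=> Aa cg ga.
have [um [up [e [Am Ap Aim Aip] [sm sim] [sp sip] _]]] := factorization yQ yP wQ wP Aa cg ga.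
(* The factors arise as functions of the angle; their Fourier series turn them into functions of the
   complex variable. *)
pose am := evC (fcoefth um); pose ap := evC (fcoefth up).
have am_um : am \o @expi R = um by rewrite [RHS](Wf_repr (inAf_Wf Am)).
have ap_up : ap \o @expi R = up by rewrite [RHS](Wf_repr (inAf_Wf Ap)).
have iam : (fun t => (am t)^-1) \o @expi R = fun t => (um t)^-1 by rewrite -am_um.
have iap : (fun t => (ap t)^-1) \o @expi R = fun t => (up t)^-1 by rewrite -ap_up.
have IN f u : f \o @expi R = u -> inB u -> inA Phi Psi phi psi f.
  by move=> <- h; apply/(inA_inAf _ yP yQ wP wQ).
have LI f u : f \o @expi R = u -> inB u -> LinfT f.
  by move=> <- h; apply: contper_LinfT; exact: inAf_contper h.
exists am, ap; split.
  by move=> _ /Tcirc_expi[t ->]; have := e t; rewrite -am_um -ap_up.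
split; first exact: IN am_um Am.
split; first by apply/Hminus_supp; split; [exact: LI am_um Am|rewrite am_um].
split; first exact: IN iam Aim.
split; first by apply/Hminus_supp; split; [exact: LI iam Aim|rewrite iam].
split; first exact: IN ap_up Ap.
split; first by apply/Hplus_supp; split; [exact: LI ap_up Ap|rewrite ap_up].
split; first exact: IN iap Aip.
by apply/Hplus_supp; split; [exact: LI iap Aip|rewrite iap].
Qed.

Lemma fcoef_shiftX (a : C -> C) K k : fcoef (fun t => a t * t ^+ K) k = fcoefth (a \o @expi R) (k - K%:Z).
Proof.
rewrite -fcoef_shift /fcoef; congr (fcoefth _ k); apply/funext => t /=.
by rewrite -expiX.
Qed.

Lemma fcoef_shiftV (a : C -> C) K k : fcoef (fun t => a t * t ^- K) k = fcoefth (a \o @expi R) (k + K%:Z).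
Proof.
rewrite -{1}[K%:Z]opprK -fcoef_shift /fcoef; congr (fcoefth _ k); apply/funext => t /=.
by rewrite -expiX -expiN rmorphN mulNr.
Qed.

Lemma Dn_shiftV (a : C -> C) K n :
  Dn n (fun t => a t * t ^- K) = \det (toep (fun k => fcoefth (a \o @expi R) (k + K%:Z)) n).
Proof. by congr (\det _); apply/matrixP => j k; rewrite !mxE fcoef_shiftV. Qed.

(** Transposition turns the entry a_(j-k-K) into a_(-(j-k+K)), a coefficient of the reflected symbol
    shifted in the other direction. *)
Lemma Dn_shiftX (a : C -> C) K n : contper (a \o @expi R) ->
  Dn n (fun t => a t * t ^+ K) = \det (toep (fun k => fcoefth (refl (a \o @expi R)) (k + K%:Z)) n).
Proof.
move=> ca; rewrite -det_tr; congr (\det _); apply/matrixP => j k.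
rewrite !mxE fcoef_shiftX fcoef_refl//; congr fcoefth; by clear; lia.
Qed.

Variable M : R.
Hypothesis wY : forall x y, 0 <= x -> 0 <= y -> x * y <= 4 * (Phi x + Psi y).
Hypotheses (M0 : 0 < M) (hM : forall k : nat, k%:R <= M * phi k * psi k).

Lemma WHfact_asymptotics (a am ap : C -> C) (g : R -> C) kappa : WHfact Phi Psi phi psi a am ap ->
  (forall t, Tcirc t -> a t != 0) -> inB (a \o @expi R) -> contper g ->
  (forall t, cexp (g t) = a (expi t)) -> (0 < kappa)%N ->
  [/\ (fun n => cabs (Dn n (fun t => a t * t ^- kappa)) / cabs (cexp (fcoefth g 0)) ^+ n * psi n) @ \oo --> 0,
      (fun n => cabs (\det (\matrix_(j < kappa, k < kappa)
         fcoef (fun t => am t * (ap t)^-1) ((n.+1 + j)%:Z - k%:Z))) * psi n) @ \oo --> 0,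
      (fun n => cabs (Dn n (fun t => a t * t ^+ kappa)) / cabs (cexp (fcoefth g 0)) ^+ n * phi n) @ \oo --> 0 &
      (fun n => cabs (\det (\matrix_(j < kappa, k < kappa)
         fcoef (fun t => (am t)^-1 * ap t) (- (n.+1 + j)%:Z + k%:Z))) * phi n) @ \oo --> 0].
Proof.
move=> [e [Aam [Ham [Aiam [Hiam [Aap [Hap [Aiap Hiap]]]]]]]] a0 Aa cg ga kappa0.
have T1 t : Tcirc (@expi R t) by rewrite /Tcirc /= cabs_expi.
have ae t : am (expi t) * ap (expi t) = a (expi t) by rewrite e.
have am0 t : am (expi t) != 0.
  by apply/negP => /eqP h; have := a0 _ (T1 t); rewrite -ae h mul0r eqxx.
have ap0 t : ap (expi t) != 0.
  by apply/negP => /eqP h; have := a0 _ (T1 t); rewrite -ae h mulr0 eqxx.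
pose um t := am (@expi R t); pose up t := ap (@expi R t).
pose ium t := (um t)^-1; pose iup t := (up t)^-1.
have Am : inB um := (inA_inAf _ yP yQ wP wQ).1 Aam.
have Ap : inB up := (inA_inAf _ yP yQ wP wQ).1 Aap.
have Aim : inB ium := (inA_inAf _ yP yQ wP wQ).1 Aiam.
have Aip : inB iup := (inA_inAf _ yP yQ wP wQ).1 Aiap.
have [_ sm] := (Hminus_supp _).1 Ham; have [_ sim] := (Hminus_supp _).1 Hiam.
have [_ sp] := (Hplus_supp _).1 Hap; have [_ sip] := (Hplus_supp _).1 Hiap.
have um1 t : um t * ium t = 1 := divff (am0 t).
have up1 t : up t * iup t = 1 := divff (ap0 t).
have aE : a \o @expi R = symb um up by apply/funext => t; rewrite /= -ae.
have [cm cp cim cip] : [/\ contper um, contper up, contper ium & contper iup].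
  by split; apply: inAf_contper; [exact: Am|exact: Ap|exact: Aim|exact: Aip].
(* The given factors need not be the exponential ones; comparing with those identifies the product
   of zeroth coefficients with G(a). *)
have GE : fcoefth um 0 * fcoefth up 0 = cexp (fcoefth g 0).
  have [vm [vp [ve [Bm Bp Bim _] [tm tim] [tp _] [z1 z2]]]] := factorization yQ yP wQ wP Aa cg ga.
  have [dm dp dim] : [/\ contper vm, contper vp & contper (fun t => (vm t)^-1)].
    by split; apply: inAf_contper; [exact: Bm|exact: Bp|exact: Bim].
  have e1 t : um t * up t = vm t * vp t by rewrite -ve /= -ae.
  have e2 t : vm t * (vm t)^-1 = 1.
    apply: divff; apply/negP => /eqP h.
    by have := a0 _ (T1 t); rewrite -[a _]/((a \o @expi R) t) ve h mul0r eqxx.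
  have := @factorization_fcoef0 R um up vm vp iup (fun t => (vm t)^-1) cm cp dm dp cip dim e1 up1 e2 sm tm tim
      sp sip tp.
  by rewrite z1 mul1r z2.
have GE' : fcoefth (refl up) 0 * fcoefth (refl um) 0 = cexp (fcoefth g 0).
  by rewrite !fcoef_refl// oppr0 mulrC.
have rs (S T : int -> bool) (h : R -> C) : (forall k, S (- k) = T k) -> contper h -> supp_in S h -> supp_in T (refl h).
  by move=> ST ch sh k kT; rewrite fcoef_refl//; apply: sh; rewrite ST.
have NP k : ((- k <= 0 :> int) = (0 <= k)) by rewrite oppr_le0.
have PN k : ((0 <= - k :> int) = (k <= 0)) by rewrite oppr_ge0.
have wY' x y : 0 <= x -> 0 <= y -> x * y <= 4 * (Psi x + Phi y).
  by move=> x0 y0; rewrite mulrC addrC; exact: wY.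
have hM' (k : nat) : k%:R <= M * psi k * phi k by rewrite mulrAC.
split.
- have := shifted_det_small yQ yP wQ wP wY M0 hM Am Ap Aim Aip um1 up1 sm sim sp sip kappa0.
  by rewrite GE -aE => h; under eq_fun do rewrite Dn_shiftV.
- by have := corner_det_small yQ wQ kappa0 (inAf_mulr yQ yP wQ wP Am Aip).
(* Reflection makes [up] antianalytic and [um] analytic, so the factors exchange roles together with
   the weights. *)
- have rsp := rs _ _ _ PN cp sp; have rsip := rs _ _ _ PN cip sip.
  have rsm := rs _ _ _ NP cm sm; have rsim := rs _ _ _ NP cim sim.
  have := shifted_det_small yP yQ wP wQ wY' M0 hM' (inAf_refl Ap) (inAf_refl Am) (inAf_refl Aip) (inAf_refl Aim)
    (fun t => up1 (- t)) (fun t => um1 (- t)) rsp rsip rsm rsim kappa0.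
  rewrite GE' (_ : symb (refl up) (refl um) = refl (a \o @expi R)); last first.
    by apply/funext => t; rewrite aE /symb /refl mulrC.
  have ca : contper (a \o @expi R) by rewrite aE; exact: contperM cm cp.
  by move=> h; under eq_fun do rewrite (Dn_shiftX _ _ ca).
- have h := corner_det_small yP wP kappa0 (inAf_refl (inAf_mulr yQ yP wQ wP Aim Ap)).
  have cc : contper (fun t => ium t * up t) by exact: contperM.
  have E n : \matrix_(j < kappa, k < kappa) fcoef (fun t => (am t)^-1 * ap t) (- (n.+1 + j)%:Z + k%:Z) =
      \matrix_(j < kappa, k < kappa) fcoefth (refl (fun t => ium t * up t)) ((n.+1 + j)%:Z - k%:Z).
    by apply/matrixP => j k; rewrite [LHS]mxE [RHS]mxE (fcoef_refl _ cc) opprB addrC.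
  by under eq_fun do rewrite E.
Qed.

End WienerHopf.

Unset Implicit Arguments.

Theorem theorem1p4 (R : realType) (p : R -> R) (phi psi : nat -> R) (M : R)
    (a : R[i] -> R[i]) :
  Ngen p ->
  Delta2_0 (PhiN p) -> Delta2_0 (PsiN p) ->
  weight phi -> weight psi ->
  0 < M -> (forall k : nat, k%:R <= M * phi k * psi k) ->
  inA (PhiN p) (PsiN p) phi psi a ->
  (forall t, Tcirc t -> a t != 0) ->
  windnum a 0 ->
  (exists am ap : R[i] -> R[i], WHfact (PhiN p) (PsiN p) phi psi a am ap) /\
  (forall am ap : R[i] -> R[i], WHfact (PhiN p) (PsiN p) phi psi a am ap ->
   forall kappa : nat, (0 < kappa)%N ->
   exists d1 d2 d3 : nat -> R[i],
     (fun n => cabs (d1 n)) @ \oo --> 0 /\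
     (fun n => cabs (d2 n) * psi n) @ \oo --> 0 /\
     (fun n => cabs (d3 n) * phi n) @ \oo --> 0 /\
     \forall n \near \oo,
       Dn n (fun t => a t * t ^- kappa) =
         Gc a ^+ n.+1 * Ec a * (1 + d1 n) * (-1) ^+ ((n + kappa) * kappa)
         * Gc (fun t => (am t)^-1 * ap t) ^+ kappa
         * (\det (\matrix_(j < kappa, k < kappa)
                    fcoef (fun t => am t * (ap t)^-1) ((n.+1 + j)%:Z - k%:Z))
            + d2 n) /\
       Dn n (fun t => a t * t ^+ kappa) =
         Gc a ^+ n.+1 * Ec a * (1 + d1 n) * (-1) ^+ ((n + kappa) * kappa)
         * Gc (fun t => am t * (ap t)^-1) ^+ kappa
         * (\det (\matrix_(j < kappa, k < kappa)
                    fcoef (fun t => (am t)^-1 * ap t) (- (n.+1 + j)%:Z + k%:Z))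
            + d3 n)).
Proof.
move=> Np dP dQ wP wQ M0 hM Aa a0 w0.
have yP := young_PhiN Np dP; have yQ := young_PsiN Np dQ.
have [c1 [c2 [pg ga]]] := clogP (exists_clog w0).
have cg : contper (clog a) by split; [split|].
have Ba := (inA_inAf a yP yQ wP wQ).1 Aa.
split; first exact: (exists_WHfact yP yQ wP wQ Ba cg ga).
move=> am ap WH kappa kappa0.
have [h1 h2 h3 h4] := WHfact_asymptotics yP yQ wP wQ (weak_young Np) M0 hM WH a0 Ba cg ga kappa0.
have G0 : Gc a != 0 := cexp_neq0 _.
have E0 : Ec a != 0 := cexp_neq0 _.
have Z0 (f : R[i] -> R[i]) : Gc f ^+ kappa != 0 by rewrite expf_neq0// cexp_neq0.
have [d2 [hd2 e2]] := @asymptotic_split R (Gc a) (Ec a) _ _ _ (fun n => (n + kappa) * kappa)%N psi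
  G0 E0 (Z0 (fun t => (am t)^-1 * ap t)) (weight_ge0 wQ) h1 h2.
have [d3 [hd3 e3]] := @asymptotic_split R (Gc a) (Ec a) _ _ _ (fun n => (n + kappa) * kappa)%N phi
  G0 E0 (Z0 (fun t => am t * (ap t)^-1)) (weight_ge0 wP) h3 h4.
exists (fun=> 0), d2, d3; split.
  by under eq_fun do rewrite cabs0; exact: cvg_cst.
split; first exact: hd2.
split; first exact: hd3.
by near=> n; split; [exact: e2|exact: e3].
Unshelve. all: by end_near.
Qed.
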